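(* Let $C\subseteq\mathbb{A}^2_{\mathbb{Q}}$ be the affine curve defined over $\mathbb{Q}$ by $y^2=x^3+x-1$. Let $f$ be the polynomial function on $C\times C$ defined by $$f((x_1,y_1),(x_2,y_2))=(x_1+y_1)^9+2(x_2+y_2)^9.$$ In the real topology, the $\mathbb{Q}$-rational points of the algebraic surface $C\times C$ are dense in $C(\mathbb{R})\times C(\mathbb{R})$, and the latter is homeomorphic to $\mathbb{R}^2$. Furthermore, the function $C(\mathbb{Q})\times C(\mathbb{Q})\to\mathbb{Q}$ induced by $f$ is injective away from finitely many $\mathbb{Q}$-rational points of $C\times C$.
   Context: A function $g:A\to B$ of sets is ''injective away from finitely many points of $A$'' if there is a finite subset $S\subseteq A$ such that the restriction of $g$ to $A\setminus S$ is injective. The real topology on $C(\mathbb{R})\subseteq\mathbb{R}^2$ is the subspace topology from the Euclidean topology of $\mathbb{R}^2$, and $C(\mathbb{R})\times C(\mathbb{R})$ carries the product topology. *)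

(* Defs.v *)
From mathcomp Require Import all_boot all_order all_algebra.
From mathcomp Require Import all_classical all_reals all_analysis.

Set Implicit Arguments.
Unset Strict Implicit.
Unset Printing Implicit Defensive.

Import Order.TTheory GRing.Theory Num.Theory.
Import numFieldNormedType.Exports.
Local Open Scope classical_set_scope.
Local Open Scope ring_scope.

Definition curve (K : comNzRingType) : set (K * K) :=
  [set p | p.2 ^+ 2 = p.1 ^+ 3 + p.1 - 1].

(* [set_type] is a sigma type whose library topology, for [K : realType], is
   the one induced by the inclusion into [K * K]. *)
Notation curve_pts K := (set_type (@curve K)).
Notation surface_pts K := (curve_pts K * curve_pts K)%type.

Lemma curve_map_subproof (K L : comNzRingType) (phi : {rmorphism K -> L})
    (p : curve_pts K) :
  (phi (set_val p).1, phi (set_val p).2) \in @curve L.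
Proof.
apply/mem_set; have /set_mem := valP p; rewrite /curve /= => e.
rewrite -!rmorphXn -rmorphD -(rmorph1 phi) -rmorphB; congr (phi _); exact: e.
Qed.

Definition curve_map (K L : comNzRingType) (phi : {rmorphism K -> L})
    (p : curve_pts K) : curve_pts L :=
  exist (fun q => q \in @curve L) _ (curve_map_subproof phi p).

Definition surface_map (K L : comNzRingType) (phi : {rmorphism K -> L})
    (p : surface_pts K) : surface_pts L :=
  (curve_map phi p.1, curve_map phi p.2).

Definition rational_points (R : realType) : set (surface_pts R) :=
  range (surface_map (@ratr R)).

Definition surface_fun (K : comNzRingType) (p : surface_pts K) : K :=
  let: (x1, y1) := set_val p.1 in
  let: (x2, y2) := set_val p.2 in
  (x1 + y1) ^+ 9 + 2 * (x2 + y2) ^+ 9.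

Definition homeomorphic (X Y : topologicalType) : Prop :=
  exists (f : X -> Y) (g : Y -> X),
    [/\ cancel f g, cancel g f, continuous f & continuous g].

Definition injective_away_from_finite (A B : Type) (g : A -> B) : Prop :=
  exists2 S : set A, finite_set S & set_inj (~` S) g.

(* Main.v *)
(* Let G = (1, 1). The ring Z[alpha], alpha^3 + alpha = 1, is norm-Euclidean and
   its units of norm 1 are squares up to a factor alpha, so for every rational
   point P the number x(P) - alpha is a square or alpha times a square in
   Q(alpha). Hence P, or both of P + G and P - G, are doubles, and descent on
   heights shows that the rational points are the multiples of G.

   Equality of f at two different pairs gives a relation with at most four terms
   between the ninth powers of x + y at points k G. Let N be the largest |k|. As
   the gcd of the denominators at m G and n G divides the denominator at
   gcd(m, n) G, the denominator d of N G (with x(N G) = a / d^2) can cancel only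
   if 2 ln d is at most about 0.73 h(N), h being the logarithmic height. A large
   x(N G) must be balanced by another term, hence by a multiple k G near infinity
   with k < N; then k G or (N - k) G is near infinity with index at most N / 2,
   so ln x(N G) is at most about 0.26 h(N). Since h(N) = max(ln a, 2 ln d) is
   unbounded, N is bounded, unless the terms of index N and -N cancel; x + y
   being injective on the real curve, this happens only for equal pairs.

   The ordinate identifies the real curve with R. The rational points being
   infinitely many, the pigeonhole principle gives two with close ordinates, whose
   difference is far out on the curve; translation by it is a small move, of
   constant sign on a bounded part of the curve. *)

From HB Require Import structures.
Require Import Defs.
From mathcomp Require Import all_boot all_order all_algebra.
From mathcomp Require Import all_classical all_reals all_analysis.
From mathcomp Require Import ring lra zify.
Import numFieldNormedType.Exports.
Import Order.TTheory GRing.Theory Num.Theory.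

Set Implicit Arguments.
Unset Strict Implicit.
Unset Printing Implicit Defensive.

Local Open Scope ring_scope.

(** * The group of rational points *)

(** The two bounds on h(N) leave a narrow margin, which depends on the exponent 9. In the
    denominators of the other terms, the divisor N / 2 of N accounts for 1/8 h(N), counted once by
    taking an lcm, and each of at most four smaller divisors for 1/18 h(N); as 2 (1/8 + 4/18) =
    25/36, adding 1/4 for the size of x(N G) gives 17/18. But the terms of index N and -N cancel to
    first order when their coefficients are equal: one factor d out of d^27 is lost, and their sum
    has only the order of x y^8, about x^13, instead of y^9, about x^(27/2). Both bounds are
    therefore multiplied by 27/26, and 27/26 * 17/18 = 51/52 is still below 1. For an odd exponent e
    the factor would be 3e / (3e - 1), so this estimate needs e > 6.

    No canonical height is built: the parallelogram law up to a bounded error suffices. No reduction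
    modulo primes is used either: the quadratic whose roots are x(P + Q) and x(P - Q) serves alike
    for heights, for divisibility of denominators and for sizes near infinity. *)

(* The complete addition formulas of Renes, Costello and Batina for curves
   y^2 = x^3 + a x + b, with a = 1 and b = -1. *)
Definition law (F : fieldType) (p q : F * F * F) : F * F * F :=
  let: (x1, y1, z1) := p in let: (x2, y2, z2) := q in
  let s := x1 * z2 + x2 * z1 in
  let u := x1 * y2 + x2 * y1 in
  let v := y1 * z2 + y2 * z1 in
  let e := y1 * y2 - s + 3 * (z1 * z2) in
  let g := y1 * y2 + s - 3 * (z1 * z2) in
  let h := x1 * x2 - 3 * s - z1 * z2 in
  let k := 3 * (x1 * x2) + z1 * z2 in
  (u * e - v * h, k * h + g * e, v * g + u * k).

Definition homog (p : option (rat * rat)) : rat * rat * rat :=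
  if p is Some (x, y) then (x, y, 1) else (0, 1, 0).

Definition dehomog (t : rat * rat * rat) : option (rat * rat) :=
  let: (x, y, z) := t in if z == 0 then None else Some (x / z, y / z).

Definition on_curve (p : option (rat * rat)) : bool :=
  if p is Some (x, y) then y ^+ 2 == x ^+ 3 + x - 1 else true.

(** Rational root test: the denominator divides the cube of the numerator, to which it is prime, so
    a root would be an integer. The resulting absence of rational 2-torsion frees the addition
    formulas from exceptions over the rationals. *)
Lemma cubic_no_rat_root (x : rat) : x ^+ 3 + x - 1 != 0.
Proof.
apply/eqP; rewrite -(divq_num_den x) => e.
have q0 : (denq x)%:~R != 0 :> rat by rewrite intr_eq0 denq_eq0.
have {}e : numq x ^+ 3 + numq x * denq x ^+ 2 = denq x ^+ 3.
  apply/eqP; rewrite -(eqr_int rat) !(rmorphD, rmorphM, rmorphXn) /=.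
  apply/eqP/(mulIf (expf_neq0 3 (invr_neq0 q0)))/eqP; rewrite -subr_eq0 -e.
  by apply/eqP; field.
have : (denq x %| numq x ^+ 3)%Z.
  have -> : numq x ^+ 3 = denq x * (denq x ^+ 2 - numq x * denq x).
    by rewrite mulrBr -exprS -e; ring.
  exact: dvdz_mulr.
have cop : coprimez (denq x) (numq x ^+ 3).
  by rewrite coprimezXr // coprimez_sym; have := coprime_num_den x.
rewrite -(mul1r (numq x ^+ 3)) Gauss_dvdzl // dvdz1 => /eqP q1.
have {}q1 : denq x = 1 by have := denq_gt0 x; lia.
move: e; rewrite q1 => e.
have [h|h] : numq x <= 0 \/ 1 <= numq x by lia.
  by nia.
by nia.
Qed.

Lemma curve_y_neq0 (x y : rat) : y ^+ 2 = x ^+ 3 + x - 1 -> y != 0.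
Proof.
by move=> e; have := cubic_no_rat_root x; rewrite -e expf_eq0 /=.
Qed.

(** Excludes the null triple and every class at infinity other than (0 : 1 : 0), so that [dehomog]
    loses only the scaling. *)
Definition proj_ok (t : rat * rat * rat) : Prop :=
  let: (x, y, z) := t in z = 0 -> x = 0 /\ y != 0.

Lemma law_on_curve (x1 y1 x2 y2 x y z : rat) :
  y1 ^+ 2 = x1 ^+ 3 + x1 - 1 -> y2 ^+ 2 = x2 ^+ 3 + x2 - 1 ->
  law (x1, y1, 1) (x2, y2, 1) = (x, y, z) ->
  y ^+ 2 * z = x ^+ 3 + x * z ^+ 2 - z ^+ 3.
Proof. by move=> e1 e2 [<- <- <-]; ring: e1 e2. Qed.

(* The third coordinate of [law P Q] is -(x1 - x2)^3 times the ordinate of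
   [P - Q], nonzero as the curve has no rational 2-torsion. *)
Lemma law_ok_affine (x1 y1 x2 y2 x y z : rat) :
  y1 ^+ 2 = x1 ^+ 3 + x1 - 1 -> y2 ^+ 2 = x2 ^+ 3 + x2 - 1 ->
  law (x1, y1, 1) (x2, y2, 1) = (x, y, z) ->
  z = 0 -> [/\ x = 0, y != 0, x1 = x2 & y1 = - y2].
Proof.
move=> e1 e2; have yn1 := curve_y_neq0 e1; have yn2 := curve_y_neq0 e2.
move=> E z0; have oc := law_on_curve e1 e2 E.
have x0 : x = 0.
  apply/eqP; rewrite -[_ == 0]/((0 < 3)%N && (x == 0)) -expf_eq0.
  by move: oc; rewrite z0 expr0n /= !mulr0 addr0 subr0 => <-.
have [x12|x12] := eqVneq x1 x2; last first.
  have d0 : x1 - x2 != 0 by rewrite subr_eq0.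
  (* Slope of the chord through P and -Q, so that (x', y') is P - Q. *)
  pose l := (y1 + y2) / (x1 - x2).
  pose x' := l ^+ 2 - x1 - x2; pose y' := l * (x1 - x') - y1.
  have oc' : y' ^+ 2 = x' ^+ 3 + x' - 1.
    by rewrite /y' /x' /l; field: e1 e2.
  have : (x1 - x2) ^+ 3 * y' = 0.
    rewrite -oppr0 -z0; move: E => [_ _ <-]; rewrite /y' /x' /l.
    by field: e1 e2.
  move/eqP; rewrite mulf_eq0 expf_eq0 /= (negPf d0) /=.
  by rewrite (negPf (curve_y_neq0 oc')).
subst x2.
have : (y1 - y2) * (y1 + y2) = 0 by ring: e1 e2.
move/eqP; rewrite mulf_eq0 subr_eq0 addr_eq0 => /orP[/eqP y12|/eqP y12].
  subst y2; move: E => [_ _ ez].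
  have : 8 * y1 ^+ 3 = 0 by rewrite -z0 -ez; ring: e1.
  by move/eqP; rewrite mulf_eq0 expf_eq0 /= (negPf yn1).
split=> //.
(* Here Q = -P and P - Q = 2 P, given by the tangent; the second coordinate of the sum is 8 y1^3
   times the ordinate of 2 P. *)
pose l := (3 * x1 ^+ 2 + 1) / (2 * y1).
pose x' := l ^+ 2 - x1 - x1; pose y' := l * (x1 - x') - y1.
have el : l * (2 * y1) = 3 * x1 ^+ 2 + 1 by rewrite /l divfK // mulf_neq0.
have oc' : y' ^+ 2 = x' ^+ 3 + x' - 1.
  have -> : y' ^+ 2 = x' ^+ 3 + x' - 1 + (y1 ^+ 2 - (x1 ^+ 3 + x1 - 1)) +
      (l * (2 * y1) - (3 * x1 ^+ 2 + 1)) * (x' - x1) by rewrite /y' /x'; ring.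
  by rewrite el e1 !subrr mul0r !addr0.
have -> : y = 8 * y1 ^+ 3 * y'.
  have {}y12 : y2 = - y1 by rewrite y12 opprK.
  move: E => [_ <- _]; rewrite y12 /y' /x'.
  have -> : 8 * y1 ^+ 3 * (l * (x1 - (l ^+ 2 - x1 - x1)) - y1) =
    12 * x1 * y1 ^+ 2 * (l * (2 * y1)) - (l * (2 * y1)) ^+ 3 - 8 * y1 ^+ 4.
    by ring.
  by rewrite el; ring: e1.
by rewrite !mulf_neq0 ?expf_neq0 ?(curve_y_neq0 oc').
Qed.

(** The formulas being complete, one pair of polynomial identities modulo the three curve equations
    replaces the case analysis on chords, tangents and opposite points. The triples are only
    proportional, hence the cross products; [dehomog_eq] shows that those with the third coordinate
    suffice. *)
Lemma law_assoc (F : fieldType) (x1 y1 x2 y2 x3 y3 : F) :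
  y1 ^+ 2 = x1 ^+ 3 + x1 - 1 -> y2 ^+ 2 = x2 ^+ 3 + x2 - 1 ->
  y3 ^+ 2 = x3 ^+ 3 + x3 - 1 ->
  let t := law (x1, y1, 1) (law (x2, y2, 1) (x3, y3, 1)) in
  let u := law (law (x1, y1, 1) (x2, y2, 1)) (x3, y3, 1) in
  t.1.1 * u.2 = u.1.1 * t.2 /\ t.1.2 * u.2 = u.1.2 * t.2.
Proof. by move=> e1 e2 e3 /=; split; ring: e1 e2 e3. Qed.

Lemma law_homog_ok p q :
  on_curve p -> on_curve q -> proj_ok (law (homog p) (homog q)).
Proof.
case: p q => [[x1 y1]|] [[x2 y2]|] /= => [/eqP e1 /eqP e2|/eqP e1 _|_ /eqP e2|_ _].
- case/(law_ok_affine e1 e2 (erefl _)) => *; split=> //.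
- by rewrite !(mulr0, mul0r, addr0, mulr1, add0r, subr0, mul1r) => /eqP;
    rewrite (negPf (curve_y_neq0 e1)).
- by rewrite !(mulr0, mul0r, addr0, mulr1, add0r, subr0, mul1r) => /eqP;
    rewrite (negPf (curve_y_neq0 e2)).
- by rewrite !(mulr0, mul0r, addr0, mulr1, add0r, subr0).
Qed.

Definition scale3 (k : rat) (t : rat * rat * rat) : rat * rat * rat :=
  (k * t.1.1, k * t.1.2, k * t.2).

Lemma dehomog_scale k t : k != 0 -> dehomog (scale3 k t) = dehomog t.
Proof.
case: t => [[x y] z] k0; rewrite /scale3 /= mulf_eq0 (negPf k0) /=.
case: eqP => // /eqP z0; congr (Some (_, _)); field; exact/andP.
Qed.

Lemma homog_dehomog t :
  proj_ok t -> exists2 k, k != 0 & t = scale3 k (homog (dehomog t)).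
Proof.
case: t => [[x y] z] /= ok; case: eqP => [z0|/eqP z0].
  by have [-> y0] := ok z0; exists y; rewrite // /scale3 /= z0 !mulr0 mulr1.
by exists z; rewrite // /scale3 /= mulr1 !mulrA !(mulrC z) !mulfK.
Qed.

Lemma law_scalel k t u : law (scale3 k t) u = scale3 (k ^+ 2) (law t u).
Proof.
by case: t u => [[x y] z] [[x' y'] z']; rewrite /law /scale3 /=;
  congr (_, _, _); ring.
Qed.

Lemma lawC (t u : rat * rat * rat) : law t u = law u t.
Proof.
by case: t u => [[x y] z] [[x' y'] z']; rewrite /law; congr (_, _, _); ring.
Qed.

Lemma law_scaler k t u : law t (scale3 k u) = scale3 (k ^+ 2) (law t u).
Proof. by rewrite lawC law_scalel lawC. Qed.

Lemma dehomog_eq t u : proj_ok t -> proj_ok u ->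
  t.1.1 * u.2 = u.1.1 * t.2 -> t.1.2 * u.2 = u.1.2 * t.2 ->
  dehomog t = dehomog u.
Proof.
case: t u => [[x y] z] [[x' y'] z'] /= ok ok' ex ey.
case: eqP => [z0|/eqP z0]; case: eqP => [z'0|/eqP z'0] //.
- have [_ y0] := ok z0; move/eqP: ey.
  by rewrite z0 mulr0 mulf_eq0 (negPf y0) (negPf z'0).
- have [_ y0] := ok' z'0; move/esym/eqP: ey.
  by rewrite z'0 mulr0 mulf_eq0 (negPf y0) (negPf z0).
congr (Some (_, _)); apply: (mulIf z0); apply: (mulIf z'0).
- by rewrite divfK // ex mulrAC divfK.
- by rewrite divfK // ey mulrAC divfK.
Qed.

Definition add_opt p q := dehomog (law (homog p) (homog q)).

Lemma on_curve_dehomog x y z :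
  y ^+ 2 * z = x ^+ 3 + x * z ^+ 2 - z ^+ 3 -> on_curve (dehomog (x, y, z)).
Proof.
move=> e /=; case: eqP => // /eqP z0 /=; apply/eqP.
apply: (mulIf (expf_neq0 3 z0)); rewrite -[RHS](_ : x ^+ 3 + x * z ^+ 2 - z ^+ 3 = _).
  by rewrite -e; field.
by field.
Qed.

Lemma add_opt_on_curve p q : on_curve p -> on_curve q -> on_curve (add_opt p q).
Proof.
rewrite /add_opt.
case: p q => [[x1 y1]|] [[x2 y2]|] => [/eqP e1 /eqP e2|/eqP e1 _|_ /eqP e2|_ _].
- case E: (law _ _) => [[x y] z]; apply: on_curve_dehomog.
  exact: (law_on_curve e1 e2 E).
- by rewrite /homog /law; apply: on_curve_dehomog; ring: e1.
- by rewrite /homog /law; apply: on_curve_dehomog; ring: e2.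
- by rewrite /homog /law; apply: on_curve_dehomog; ring.
Qed.

Lemma add_opt0 p : on_curve p -> add_opt p None = p.
Proof.
rewrite /add_opt; case: p => [[x y]|] /= => [/eqP e|_].
  have y0 := curve_y_neq0 e.
  rewrite !(mulr0, mul0r, addr0, mulr1, mul1r, add0r, subr0) (negPf y0) /=.
  by congr (Some (_, _)); field.
by [].
Qed.

Lemma add_optC p q : add_opt p q = add_opt q p.
Proof. by rewrite /add_opt lawC. Qed.

Lemma add_optA p q r : on_curve p -> on_curve q -> on_curve r ->
  add_opt p (add_opt q r) = add_opt (add_opt p q) r.
Proof.
move=> cp cq cr.
have [cqr cpq] := (add_opt_on_curve cq cr, add_opt_on_curve cp cq).
(* The formulas have bidegree (2, 2), so dehomogenising the inner sum only rescales the outer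
   one. *)
have [k k0 ek] := homog_dehomog (law_homog_ok cq cr).
have [l l0 el] := homog_dehomog (law_homog_ok cp cq).
have okl := law_homog_ok cp cqr; have okr := law_homog_ok cpq cr.
have [dl dr] : dehomog (law (homog p) (law (homog q) (homog r))) =
    add_opt p (add_opt q r) /\
  dehomog (law (law (homog p) (homog q)) (homog r)) = add_opt (add_opt p q) r.
  by rewrite ek law_scaler dehomog_scale ?expf_neq0 // el law_scalel
     dehomog_scale ?expf_neq0.
have {okl} okl : proj_ok (law (homog p) (law (homog q) (homog r))).
  rewrite ek law_scaler; case: (law _ _) okl => [[x y] z] /= ok /eqP.
  rewrite mulf_eq0 expf_eq0 (negPf k0) /= => /eqP /ok[-> y0].
  by rewrite mulr0 mulf_neq0 ?expf_neq0.
have {okr} okr : proj_ok (law (law (homog p) (homog q)) (homog r)).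
  rewrite el law_scalel; case: (law _ _) okr => [[x y] z] /= ok /eqP.
  rewrite mulf_eq0 expf_eq0 (negPf l0) /= => /eqP /ok[-> y0].
  by rewrite mulr0 mulf_neq0 ?expf_neq0.
rewrite -dl -dr; apply: dehomog_eq => //; move: cp cq cr; clear.
all: case: p q r => [[x1 y1]|] [[x2 y2]|] [[x3 y3]|] /=.
(* Goals 1 and 9 are the two coordinates in the case of three affine points. *)
1, 9: by move=> /eqP e1 /eqP e2 /eqP e3; have [] := law_assoc e1 e2 e3.
all: repeat (let e := fresh "e" in move=> /eqP e || move=> _).
all: by ring.
Qed.

Record curve_point := CurvePoint { pt_opt : option (rat * rat); pt_optP : on_curve pt_opt }.

HB.instance Definition _ := [isSub for pt_opt].
HB.instance Definition _ := [Choice of curve_point by <:].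

Definition neg_opt (p : option (rat * rat)) :=
  if p is Some (x, y) then Some (x, - y) else None.

Lemma neg_opt_on_curve p : on_curve p -> on_curve (neg_opt p).
Proof. by case: p => [[x y]|] //=; rewrite sqrrN. Qed.

Lemma add_optN p : on_curve p -> add_opt (neg_opt p) p = None.
Proof.
case: p => [[x y]|] //= /eqP e; rewrite /add_opt [dehomog _]/= ifT //.
by apply/eqP; ring.
Qed.

Definition curve_point0 := @CurvePoint None isT.
Definition curve_pointN (P : curve_point) := CurvePoint (neg_opt_on_curve (pt_optP P)).
Definition curve_pointD (P Q : curve_point) :=
  CurvePoint (add_opt_on_curve (pt_optP P) (pt_optP Q)).

Lemma curve_pointDA : associative curve_pointD.
Proof. by move=> P Q S; apply/val_inj/add_optA; apply: pt_optP. Qed.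

Lemma curve_pointDC : commutative curve_pointD.
Proof. by move=> P Q; apply/val_inj/add_optC. Qed.

Lemma curve_point0D : left_id curve_point0 curve_pointD.
Proof. by move=> P; rewrite curve_pointDC; apply/val_inj/add_opt0/pt_optP. Qed.

Lemma curve_pointND : left_inverse curve_point0 curve_pointN curve_pointD.
Proof. by move=> P; apply/val_inj/add_optN/pt_optP. Qed.

HB.instance Definition _ := GRing.isZmodule.Build curve_point
  curve_pointDA curve_pointDC curve_point0D curve_pointND.

Lemma affP x y (P : curve_point) : pt_opt P = Some (x, y) -> y ^+ 2 = x ^+ 3 + x - 1.
Proof. by move=> e; have := pt_optP P; rewrite e => /eqP. Qed.

Lemma aff_exists (x y : rat) : y ^+ 2 = x ^+ 3 + x - 1 ->
  exists P : curve_point, pt_opt P = Some (x, y).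
Proof. by move/eqP => e; exists (@CurvePoint (Some (x, y)) e). Qed.

Lemma pt_opt_inj : injective pt_opt. Proof. exact: val_inj. Qed.

Lemma pt_opt0 : pt_opt 0 = None. Proof. by []. Qed.

Lemma ept_affP (P : curve_point) : reflect (exists x y, pt_opt P = Some (x, y)) (P != 0).
Proof.
apply: (iffP idP) => [|[x [y e]]]; last by apply/eqP => p0; rewrite p0 in e.
case E: (pt_opt P) => [[x y]|] /eqP n0; first by exists x, y.
by case: n0; apply: pt_opt_inj.
Qed.

Lemma opp_aff (P : curve_point) x y : pt_opt P = Some (x, y) -> pt_opt (- P) = Some (x, - y).
Proof. by move=> e; rewrite /= e. Qed.

Lemma law_chord (F : fieldType) (x1 y1 x2 y2 x y z : F) :
  y1 ^+ 2 = x1 ^+ 3 + x1 - 1 -> y2 ^+ 2 = x2 ^+ 3 + x2 - 1 -> x1 != x2 ->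
  law (x1, y1, 1) (x2, y2, 1) = (x, y, z) ->
  let l := (y1 - y2) / (x1 - x2) in let x3 := l ^+ 2 - x1 - x2 in
  x = z * x3 /\ y = z * (l * (x1 - x3) - y1).
Proof.
move=> e1 e2; rewrite -subr_eq0 => d0 [<- <- <-].
by split; field: e1 e2.
Qed.

Lemma add_chord (P Q : curve_point) x1 y1 x2 y2 :
  pt_opt P = Some (x1, y1) -> pt_opt Q = Some (x2, y2) -> x1 != x2 ->
  let l := (y1 - y2) / (x1 - x2) in let x3 := l ^+ 2 - x1 - x2 in
  pt_opt (P + Q) = Some (x3, l * (x1 - x3) - y1).
Proof.
move=> eP eQ n; have [e1 e2] := (affP eP, affP eQ).
rewrite /= /add_opt eP eQ /homog; case E: (law _ _) => [[x y] z].
have [-> ->] := law_chord e1 e2 n E; rewrite /=; case: eqP => [z0|/eqP z0].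
  have [_ _ x12 _] := law_ok_affine e1 e2 E z0.
  by rewrite x12 eqxx in n.
by congr (Some (_, _)); rewrite mulrC mulKf.
Qed.

Lemma add_tangent (P : curve_point) x y : pt_opt P = Some (x, y) ->
  let l := (3 * x ^+ 2 + 1) / (2 * y) in let x3 := l ^+ 2 - x - x in
  pt_opt (P + P) = Some (x3, l * (x - x3) - y).
Proof.
move=> eP; have e := affP eP; have y0 := curve_y_neq0 e; rewrite /= /add_opt eP /=.
have z8 : (y * 1 + y * 1) * (y * y + (x * 1 + x * 1) - 3 * (1 * 1)) +
    (x * y + x * y) * (3 * (x * x) + 1 * 1) = 8 * y ^+ 3.
  by ring: e.
have y8 : 8 * y ^+ 3 != 0 by rewrite mulf_neq0 ?expf_neq0.
have eh (a b : rat) : a = 8 * y ^+ 3 * b -> a / (8 * y ^+ 3) = b.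
  by move=> ->; rewrite mulrC mulKf.
have el : (3 * x ^+ 2 + 1) / (2 * y) * (2 * y) = 3 * x ^+ 2 + 1.
  by rewrite divfK // mulf_neq0.
move: el; set l := (_ / _) => el.
rewrite z8 (negPf y8); congr (Some (_, _)); apply: eh.
  have -> : 8 * y ^+ 3 * (l ^+ 2 - x - x) =
      2 * y * (l * (2 * y)) ^+ 2 - 16 * x * y ^+ 3 by ring.
  by rewrite el; ring: e.
have -> : 8 * y ^+ 3 * (l * (x - (l ^+ 2 - x - x)) - y) =
    12 * x * y ^+ 2 * (l * (2 * y)) - (l * (2 * y)) ^+ 3 - 8 * y ^+ 4 by ring.
by rewrite el; ring: e.
Qed.

Lemma same_abscissa (P Q : curve_point) x y1 y2 :
  pt_opt P = Some (x, y1) -> pt_opt Q = Some (x, y2) -> P = Q \/ P = - Q.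
Proof.
move=> eP eQ; have := affP eP; rewrite -(affP eQ) => /eqP.
rewrite eqf_sqr => /orP[] /eqP e; [left|right]; apply: pt_opt_inj.
  by rewrite eP eQ e.
by rewrite (opp_aff eQ) eP e.
Qed.

Definition genG : curve_point := @CurvePoint (Some (1, 1)) isT.

(** * Heights *)

(** Infinity gets the abscissa 1 / 0, a point of the projective line in lowest terms, so that the
    relations below cover it. *)
Definition pnum (P : curve_point) : int := if pt_opt P is Some (x, _) then numq x else 1.
Definition pden (P : curve_point) : int := if pt_opt P is Some (x, _) then denq x else 0.

Lemma pnum_aff P x y : pt_opt P = Some (x, y) -> pnum P = numq x.
Proof. by rewrite /pnum => ->. Qed.

Lemma pden_aff P x y : pt_opt P = Some (x, y) -> pden P = denq x.
Proof. by rewrite /pden => ->. Qed.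

(** A square is nonnegative, so x^3 + x >= 1. Numerators are thus positive, which removes sign
    problems and cancellations from the height inequalities. *)
Lemma curve_x_gt0 (F : realDomainType) (x y : F) : y ^+ 2 = x ^+ 3 + x - 1 -> 0 < x.
Proof.
move=> e; rewrite ltNge; apply/negP => x0.
have : 0 <= y ^+ 2 := sqr_ge0 y.
by rewrite e; nra.
Qed.

Lemma pnum_gt0 P : 0 < pnum P.
Proof.
rewrite /pnum; case E: (pt_opt P) => [[x y]|] //.
by rewrite numq_gt0 (curve_x_gt0 (affP E)).
Qed.

Lemma pden_ge0 P : 0 <= pden P.
Proof. by rewrite /pden; case: (pt_opt P) => [[x y]|]. Qed.

Lemma pden_gt0 P : P != 0 -> 0 < pden P.
Proof. by case/ept_affP => x [y /pden_aff->]; rewrite denq_gt0. Qed.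

Lemma coprime_pnum_pden P : coprimez (pnum P) (pden P).
Proof.
rewrite /pnum /pden; case: (pt_opt P) => [[x y]|] //.
exact: coprime_num_den.
Qed.

Lemma pnumN P : pnum (- P) = pnum P.
Proof. by rewrite /pnum /=; case: (pt_opt P) => [[x y]|]. Qed.

Lemma pdenN P : pden (- P) = pden P.
Proof. by rewrite /pden /=; case: (pt_opt P) => [[x y]|]. Qed.

(* The abscissas of P + Q and P - Q are the roots of kum0 X^2 - kum1 X + kum2,
   where p_i / q_i are the abscissas of P and Q. *)
Definition kum0 (p1 q1 p2 q2 : int) : int := (p1 * q2 - p2 * q1) ^+ 2.
Definition kum1 (p1 q1 p2 q2 : int) : int :=
  2 * ((p1 * p2 + q1 * q2) * (p1 * q2 + p2 * q1) - 2 * q1 ^+ 2 * q2 ^+ 2).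
Definition kum2 (p1 q1 p2 q2 : int) : int :=
  (p1 * p2 - q1 * q2) ^+ 2 + 4 * q1 * q2 * (p1 * q2 + p2 * q1).

(** Vieta's formulas for the roots p3 / q3 and p4 / q4 in homogeneous form, valid also for a root at
    infinity; [l] is a common factor of the three coefficients. *)
Definition kummer_rel (l p1 q1 p2 q2 p3 q3 p4 q4 : int) :=
  [/\ l * (q3 * q4) = kum0 p1 q1 p2 q2,
      l * (p3 * q4 + p4 * q3) = kum1 p1 q1 p2 q2 &
      l * (p3 * p4) = kum2 p1 q1 p2 q2].

(** Gauss's lemma: the product of two primitive linear forms is primitive, so a rational multiple of
    it with integral coefficients has an integral factor. *)
Lemma int_of_primitive (l : rat) (p3 q3 p4 q4 : int) :
  coprimez p3 q3 -> coprimez p4 q4 ->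
  l * (q3 * q4)%:~R \is a Num.int -> l * (p3 * q4 + p4 * q3)%:~R \is a Num.int ->
  l * (p3 * p4)%:~R \is a Num.int -> l \is a Num.int.
Proof.
move=> c3 c4 i0 i1 i2; have ii (k : int) : k%:~R \is a @Num.int rat := intr_int _ k.
(* To be used with p3 (p3 q4 + p4 q3) - q3 (p3 p4) = p3^2 q4. *)
have /coprimezP [[u v] /= e3] : coprimez (p3 ^+ 2) q3 by rewrite coprimezXl.
have /coprimezP [[u' v'] /= e3'] : coprimez p3 (q3 ^+ 2) by rewrite coprimezXr.
have /coprimezP [[w z] /= e4] := c4.
have iq4 : l * q4%:~R \is a Num.int.
  have -> : l * q4%:~R = u%:~R * (p3%:~R * (l * (p3 * q4 + p4 * q3)%:~R) -
      q3%:~R * (l * (p3 * p4)%:~R)) + v%:~R * (l * (q3 * q4)%:~R).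
    by rewrite -[in LHS](mul1r q4) -e3; ring.
  by apply: rpredD; apply: rpredM => //; apply: rpredB; apply: rpredM.
have ip4 : l * p4%:~R \is a Num.int.
  have -> : l * p4%:~R = v'%:~R * (q3%:~R * (l * (p3 * q4 + p4 * q3)%:~R) -
      p3%:~R * (l * (q3 * q4)%:~R)) + u'%:~R * (l * (p3 * p4)%:~R).
    by rewrite -[in LHS](mul1r p4) -e3'; ring.
  by apply: rpredD; apply: rpredM => //; apply: rpredB; apply: rpredM.
have -> : l = w%:~R * (l * p4%:~R) + z%:~R * (l * q4%:~R).
  have {}e4 : w%:~R * p4%:~R + z%:~R * q4%:~R = 1 :> rat.
    by rewrite -!rmorphM -rmorphD /= e4.
  transitivity (l * (w%:~R * p4%:~R + z%:~R * q4%:~R)); last by ring.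
  by rewrite e4 mulr1.
by apply: rpredD; apply: rpredM.
Qed.

Lemma kummer_of_rat (l : rat) (p1 q1 p2 q2 p3 q3 p4 q4 : int) :
  coprimez p3 q3 -> coprimez p4 q4 ->
  l * (q3 * q4)%:~R = (kum0 p1 q1 p2 q2)%:~R ->
  l * (p3 * q4 + p4 * q3)%:~R = (kum1 p1 q1 p2 q2)%:~R ->
  l * (p3 * p4)%:~R = (kum2 p1 q1 p2 q2)%:~R ->
  exists k, kummer_rel k p1 q1 p2 q2 p3 q3 p4 q4.
Proof.
move=> c3 c4 e0 e1 e2.
have /intrP [k ek] : l \is a Num.int.
  by apply: (int_of_primitive c3 c4); rewrite ?e0 ?e1 ?e2 intr_int.
exists k; split; apply/eqP; rewrite -(eqr_int rat) rmorphM /= -ek;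
  by apply/eqP; rewrite ?e0 ?e1 ?e2.
Qed.

Lemma numqR (x : rat) : (numq x)%:~R = x * (denq x)%:~R.
Proof. by rewrite -{2}(divq_num_den x) divfK // intr_eq0 denq_eq0. Qed.

Lemma denq_neq0R (x : rat) : (denq x)%:~R != 0 :> rat.
Proof. by rewrite intr_eq0 denq_eq0. Qed.

Lemma kummer_opp l p1 q1 p2 q2 p3 q3 p4 q4 :
  kummer_rel l p1 q1 p2 q2 p3 q3 p4 q4 -> kummer_rel l p1 q1 p2 q2 p4 q4 p3 q3.
Proof.
by case=> e0 e1 e2; split; rewrite -?e0 -?e1 -?e2; ring.
Qed.

Lemma kummer_double (P : curve_point) x1 y1 : pt_opt P = Some (x1, y1) ->
  exists l, kummer_rel l (pnum P) (pden P) (pnum P) (pden P)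
    (pnum (P + P)) (pden (P + P)) (pnum (P - P)) (pden (P - P)).
Proof.
move=> eP; have e1 := affP eP; have d1 := denq_neq0R x1.
rewrite subrr; have := add_tangent eP; cbv zeta.
have y0 := curve_y_neq0 e1.
set l := _ / _ => e3; set x3 := _ - x1 in e3.
have e3' : x3 * (4 * (x1 ^+ 3 + x1 - 1)) = x1 ^+ 4 - 2 * x1 ^+ 2 + 8 * x1 + 1.
  have el : l * (2 * y1) = 3 * x1 ^+ 2 + 1 by rewrite /l divfK // mulf_neq0.
  have -> : x3 * (4 * (x1 ^+ 3 + x1 - 1)) =
      (l * (2 * y1)) ^+ 2 - 8 * x1 * (x1 ^+ 3 + x1 - 1).
    by rewrite -e1 /x3; ring.
  by rewrite el; ring.
have d3 := denq_neq0R x3.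
have [n1 n3] := (numqR x1, numqR x3).
(* As P - P is 1 / 0, the middle relation reads l q3 = [kum1] and imposes this factor. *)
apply: (@kummer_of_rat ((kum1 (pnum P) (pden P) (pnum P) (pden P))%:~R /
   (denq x3)%:~R)); rewrite ?coprime_pnum_pden //.
all: rewrite /kum0 /kum1 /kum2 ?(pnum_aff e3) ?(pden_aff e3).
all: rewrite ?(pnum_aff eP) ?(pden_aff eP) /pnum /pden pt_opt0.
- by rewrite mulr0 subrr expr0n /= mulr0.
- by rewrite mulr0 add0r mul1r divfK.
rewrite mulr1 n3 (mulrC x3) mulrA divfK //.
have -> : (2 * ((numq x1 * numq x1 + denq x1 * denq x1) *
    (numq x1 * denq x1 + numq x1 * denq x1) - 2 * denq x1 ^+ 2 * denq x1 ^+ 2))%:~R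
  = (denq x1)%:~R ^+ 4 * (4 * (x1 ^+ 3 + x1 - 1)) :> rat by ring: n1.
transitivity ((denq x1)%:~R ^+ 4 * (x3 * (4 * (x1 ^+ 3 + x1 - 1)))); first by ring.
by rewrite e3'; ring: n1.
Qed.

Lemma kummer_add (P Q : curve_point) :
  exists l, kummer_rel l (pnum P) (pden P) (pnum Q) (pden Q)
    (pnum (P + Q)) (pden (P + Q)) (pnum (P - Q)) (pden (P - Q)).
Proof.
have [->|/ept_affP [x1 [y1 eP]]] := eqVneq P 0.
  rewrite add0r sub0r pnumN pdenN; exists 1.
  by rewrite /kummer_rel /kum0 /kum1 /kum2 /=; split; ring.
have [->|/ept_affP [x2 [y2 eQ]]] := eqVneq Q 0.
  rewrite addr0 subr0; exists 1.
  by rewrite /kummer_rel /kum0 /kum1 /kum2 /=; split; ring.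
have [e1 e2] := (affP eP, affP eQ).
have [d1 d2] := (denq_neq0R x1, denq_neq0R x2).
have [ex|x12] := eqVneq x1 x2.
  rewrite -ex in eQ; have [l h] := kummer_double eP.
  have [eqQ|->] := same_abscissa eQ eP; first by exists l; rewrite eqQ.
  by exists l; rewrite opprK pnumN pdenN; apply: kummer_opp.
have d0 : x1 - x2 != 0 by rewrite subr_eq0.
have e3 := add_chord eP eQ x12; have e4 := add_chord eP (opp_aff eQ) x12.
move: e3 e4; cbv zeta; set x3 := (X in Some (X, _)); move=> e3.
set x4 := (X in Some (X, _)); move=> e4.
have es : (x3 + x4) * (x1 - x2) ^+ 2 = 2 * ((x1 * x2 + 1) * (x1 + x2) - 2).
  by rewrite /x3 /x4; field: e1 e2.
have ep : (x3 * x4) * (x1 - x2) ^+ 2 = (x1 * x2 - 1) ^+ 2 + 4 * (x1 + x2).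
  by rewrite /x3 /x4; field: e1 e2.
have [d3 d4] := (denq_neq0R x3, denq_neq0R x4).
have [n1 n2] := (numqR x1, numqR x2); have [n3 n4] := (numqR x3, numqR x4).
pose D1 := (denq x1)%:~R : rat; pose D2 := (denq x2)%:~R : rat.
apply: (@kummer_of_rat ((x1 - x2) ^+ 2 * (D1 * D2) ^+ 2 /
     ((denq x3)%:~R * (denq x4)%:~R))); rewrite ?coprime_pnum_pden //.
all: rewrite /kum0 /kum1 /kum2 ?(pnum_aff e3) ?(pden_aff e3) ?(pnum_aff e4) ?(pden_aff e4).
all: rewrite ?(pnum_aff eP) ?(pden_aff eP) ?(pnum_aff eQ) ?(pden_aff eQ).
- by rewrite /D1 /D2; field: n1 n2; rewrite d3 d4.
- have -> : (x1 - x2) ^+ 2 * (D1 * D2) ^+ 2 / ((denq x3)%:~R * (denq x4)%:~R) *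
    (numq x3 * denq x4 + numq x4 * denq x3)%:~R =
    (D1 * D2) ^+ 2 * ((x3 + x4) * (x1 - x2) ^+ 2).
    by field: n3 n4; rewrite d3 d4.
  by rewrite es /D1 /D2; ring: n1 n2.
have -> : (x1 - x2) ^+ 2 * (D1 * D2) ^+ 2 / ((denq x3)%:~R * (denq x4)%:~R) *
    (numq x3 * numq x4)%:~R = (D1 * D2) ^+ 2 * ((x3 * x4) * (x1 - x2) ^+ 2).
  by field: n3 n4; rewrite d3 d4.
by rewrite ep /D1 /D2; ring: n1 n2.
Qed.

Lemma dvdz_le (a b : int) : 0 < b -> (a %| b)%Z -> a <= b.
Proof.
move=> b0; rewrite dvdzE => h; have /dvdn_leq/(_ h) : (0 < `|b|)%N by lia.
by lia.
Qed.

Lemma kummer_pos l P Q : kummer_rel l (pnum P) (pden P) (pnum Q) (pden Q)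
    (pnum (P + Q)) (pden (P + Q)) (pnum (P - Q)) (pden (P - Q)) -> 0 < l.
Proof.
case=> _ _ e2; have := pnum_gt0 (P + Q); have := pnum_gt0 (P - Q).
have := pden_ge0 P; have := pden_ge0 Q; have := pnum_gt0 P; have := pnum_gt0 Q.
move: e2; rewrite /kum2.
move: (pnum P) (pnum Q) (pden P) (pden Q) (pnum (P + Q)) (pnum (P - Q)).
move=> p1 p2 q1 q2 p3 p4 e p10 p20 q10 q20 p30 p40.
have h : 0 < l * (p3 * p4).
  rewrite e (_ : 4 * q1 * q2 = 4 * (q1 * q2)); last by ring.
  have [q0|q0] : q1 * q2 = 0 \/ 0 < q1 * q2 by nia.
    by rewrite q0; nia.
  have : 0 <= (p1 * p2 - q1 * q2) ^+ 2 := sqr_ge0 _.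
  have : 0 < p1 * q2 + p2 * q1 by nia.
  by nia.
by rewrite -(pmulr_lgt0 l (mulr_gt0 p40 p30)).
Qed.

Definition height (P : curve_point) : int := Num.max (pnum P) (pden P).

Lemma height_ge1 P : 1 <= height P.
Proof. by rewrite /height; have := pnum_gt0 P; lia. Qed.

Lemma heightN P : height (- P) = height P.
Proof. by rewrite /height pnumN pdenN. Qed.

(** Since no entry is negative, each product of an entry of one pair by an entry of the other is
    bounded by one of the three symmetric coefficients; no constant is lost. *)
Lemma height_prod_le (p3 q3 p4 q4 M : int) :
  0 <= p3 -> 0 <= q3 -> 0 <= p4 -> 0 <= q4 ->
  q3 * q4 <= M -> p3 * q4 + p4 * q3 <= M -> p3 * p4 <= M ->
  Num.max p3 q3 * Num.max p4 q4 <= M.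
Proof. by move=> *; case: (leP p3 q3); case: (leP p4 q4) => *; nia. Qed.

Lemma sqrB_le (a b H : int) : 0 <= a <= H -> 0 <= b <= H -> (a - b) ^+ 2 <= H ^+ 2.
Proof.
move=> /andP[a0 aH] /andP[b0 bH].
by rewrite -(real_normK (num_real (a - b))) ler_pXn2r ?nnegrE ?normr_ge0 //; lia.
Qed.

(** The letters a, b, c, d stand for p1 p2, p1 q2, q1 p2, q1 q2. *)
Lemma kum_le (a b c d H : int) :
  0 <= a <= H -> 0 <= b <= H -> 0 <= c <= H -> 0 <= d <= H ->
  [/\ (b - c) ^+ 2 <= 12 * H ^+ 2,
      2 * ((a + d) * (b + c) - 2 * d ^+ 2) <= 12 * H ^+ 2 &
      (a - d) ^+ 2 + 4 * d * (b + c) <= 12 * H ^+ 2].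
Proof.
move=> aH bH cH dH.
have sbc := sqrB_le bH cH; have sad := sqrB_le aH dH.
case/andP: aH => a0 aH; case/andP: bH => b0 bH.
case/andP: cH => c0 cH; case/andP: dH => d0 dH.
have s1 : (a + d) * (b + c) <= (2 * H) * (2 * H) by apply: ler_pM; lia.
have s2 : d * (b + c) <= H * (2 * H) by apply: ler_pM; lia.
have s3 : 0 <= d ^+ 2 := sqr_ge0 d.
have s4 : 0 <= H ^+ 2 := sqr_ge0 H.
by move: s3 s4 s1 s2 sbc sad; rewrite !expr2; split; lia.
Qed.

Lemma le_of_pmul (l b M a : int) : 0 < l -> 0 <= b -> l * b = a -> a <= M -> b <= M.
Proof. by move=> l0 b0 <-; apply: le_trans; nia. Qed.

Lemma num_den_height P :
  [/\ 0 < pnum P <= height P & 0 <= pden P <= height P].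
Proof. by rewrite pnum_gt0 pden_ge0 /height; split; lia. Qed.

Lemma height_add_sub P Q :
  height (P + Q) * height (P - Q) <= 12 * (height P * height Q) ^+ 2.
Proof.
have [l h] := kummer_add P Q; have l0 := kummer_pos h; case: h => e0 e1 e2.
have [P3 P4] := (pnum_gt0 (P + Q), pnum_gt0 (P - Q)).
have [Q3 Q4] := (pden_ge0 (P + Q), pden_ge0 (P - Q)).
have bnd (x y : int) : 0 <= x <= height P -> 0 <= y <= height Q ->
    0 <= x * y <= height P * height Q.
  by case/andP=> x0 xH /andP[y0 yH]; rewrite mulr_ge0 ?ler_pM.
have [/andP[/ltW p10 p1H] q1H] := num_den_height P.
have [/andP[/ltW p20 p2H] q2H] := num_den_height Q.
have p1 : 0 <= pnum P <= height P by rewrite p10.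
have p2 : 0 <= pnum Q <= height Q by rewrite p20.
have [k0 k1 k2] := kum_le (bnd _ _ p1 p2) (bnd _ _ p1 q2H) (bnd _ _ q1H p2)
  (bnd _ _ q1H q2H).
apply: height_prod_le; try exact: ltW; try by [].
- apply: (le_of_pmul l0 _ e0); first exact: mulr_ge0.
  by rewrite /kum0 (mulrC (pnum Q)).
- apply: (le_of_pmul l0 _ e1); first by rewrite addr_ge0 ?mulr_ge0 // ltW.
  by move: k1; rewrite /kum1 (mulrC (pnum Q)) exprMn mulrA.
apply: (le_of_pmul l0 _ e2); first by rewrite mulr_ge0 // ltW.
by move: k2; rewrite /kum2 (mulrC (pnum Q)) mulrA.
Qed.

(** What matters is 8 < 3^2: one of P + G and P - G has height at most three times that of P. *)
Lemma height_addG P :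
  height (P + genG) * height (P - genG) <= 8 * height P ^+ 2.
Proof.
have [l h] := kummer_add P genG; have l0 := kummer_pos h; case: h => e0 e1 e2.
have [P3 P4] := (pnum_gt0 (P + genG), pnum_gt0 (P - genG)).
have [Q3 Q4] := (pden_ge0 (P + genG), pden_ge0 (P - genG)).
have [/andP[/ltW p0 pH] /andP[q0 qH]] := num_den_height P.
move: e0 e1 e2; rewrite /kum0 /kum1 /kum2.
have -> : pnum genG = 1 by [].
have -> : pden genG = 1 by [].
have s1 : pnum P * pnum P <= height P * height P by apply: ler_pM.
have s2 : pnum P * pden P <= height P * height P by apply: ler_pM.
have s3 : pden P * pden P <= height P * height P by apply: ler_pM.
have s1' : 0 <= pnum P * pnum P by apply: mulr_ge0.
have s2' : 0 <= pnum P * pden P by apply: mulr_ge0.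
have s3' : 0 <= pden P * pden P by apply: mulr_ge0.
rewrite !expr2 => e0 e1 e2; apply: height_prod_le; try exact: ltW; try by [].
- apply: (le_of_pmul l0 _ e0); first exact: mulr_ge0.
  by lia.
- apply: (le_of_pmul l0 _ e1); first by rewrite addr_ge0 ?mulr_ge0 // ltW.
  by lia.
apply: (le_of_pmul l0 _ e2); first by rewrite mulr_ge0 // ltW.
by lia.
Qed.

(** F / K is the abscissa of 2 P when that of P is p / q. The two combinations are Bezout relations
    between these quartic forms; 124 = 4 * 31, and -31 is the discriminant of X^3 + X - 1. *)
Lemma coprime_forms_dvd (p q l F K : int) : coprimez p q ->
  (l %| F)%Z -> (l %| K)%Z ->
  F = (p ^+ 2 - q ^+ 2) ^+ 2 + 8 * p * q ^+ 3 ->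
  K = 4 * q * (p ^+ 3 + p * q ^+ 2 - q ^+ 3) -> (l %| 124)%Z.
Proof.
move=> c lF lK eF eK.
have lp : (l %| 124 * p ^+ 7)%Z.
  rewrite (_ : _ * _ = (124 * p ^+ 3 + 4 * p ^+ 2 * q + 100 * p * q ^+ 2 - 108 * q ^+ 3) * F
    + (- p ^+ 3 + 37 * p ^+ 2 * q - 218 * p * q ^+ 2 - 27 * q ^+ 3) * K).
    by rewrite rpredD // dvdz_mull.
  by rewrite eF eK; ring.
have lq : (l %| 124 * q ^+ 7)%Z.
  rewrite (_ : _ * _ = (12 * p ^+ 2 * q + 16 * q ^+ 3) * F
    - (3 * p ^+ 3 - 5 * p * q ^+ 2 + 27 * q ^+ 3) * K).
    by rewrite rpredB // dvdz_mull.
  by rewrite eF eK; ring.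
have /coprimezP [[u v] /= e] : coprimez (p ^+ 7) (q ^+ 7).
  by rewrite coprimezXl // coprimezXr.
have : (l %| u * (124 * p ^+ 7) + v * (124 * q ^+ 7))%Z.
  by rewrite rpredD // dvdz_mull.
rewrite (_ : u * _ + _ = 124) //.
by transitivity (124 * (u * p ^+ 7 + v * q ^+ 7)); [|rewrite e]; ring.
Qed.

(** 248 = 2 * 124: the factor 124 accounts for cancellation in the duplication formula, the factor 2
    for comparing its numerator with max(p, q)^4. *)
Lemma height_double P : height P ^+ 4 <= 248 * height (P + P).
Proof.
have [l h] := kummer_add P P; have l0 := kummer_pos h; case: h => _ e1 e2.
have [P1 Q1] := (pnum_gt0 P, pden_ge0 P).
have [P3 Q3] := (pnum_gt0 (P + P), pden_ge0 (P + P)).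
move: e1 e2; rewrite subrr /kum1 /kum2.
have -> : pnum 0 = 1 by []. have -> : pden 0 = 0 by [].
move=> e1 e2.
have l124 : (l %| 124)%Z.
  apply: (coprime_forms_dvd (coprime_pnum_pden P) _ _ (erefl _) (erefl _)).
    apply/dvdzP; exists (pnum (P + P)).
    by transitivity (l * (pnum (P + P) * 1)); [rewrite e2|]; ring.
  apply/dvdzP; exists (pden (P + P)).
  transitivity (l * (pnum (P + P) * 0 + 1 * pden (P + P))); last by ring.
  by rewrite e1; ring.
have {l124} l124 : l <= 124 by exact: dvdz_le.
have h1 : pnum (P + P) <= height (P + P) by rewrite /height; lia.
have h2 : l * pnum (P + P) = (pnum P ^+ 2 - pden P ^+ 2) ^+ 2 + 8 * pnum P * pden P ^+ 3.
  by transitivity (l * (pnum (P + P) * 1)); [|rewrite e2]; ring.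
have h3 : l * pnum (P + P) <= 124 * height (P + P).
  by apply: ler_pM => //; exact: ltW.
have [E|/ept_affP [x [y eP]]] := eqVneq P 0.
  by rewrite E addr0.
(* The cubic takes a square value, hence a nonnegative one; in the case p <= q this will give q <= 2
   p. *)
have fx : 0 <= pnum P ^+ 3 + pnum P * pden P ^+ 2 - pden P ^+ 3.
  rewrite -(ler0z rat) (_ : _%:~R = y ^+ 2 * (pden P)%:~R ^+ 3).
    by rewrite mulr_ge0 ?sqr_ge0 // exprn_ge0 // ler0z pden_ge0.
  rewrite (affP eP) (pnum_aff eP) (pden_aff eP); have n := numqR x.
  by ring: n.
suff : height P ^+ 4 <= 2 * (l * pnum (P + P)) by lia.
rewrite h2 /height; move: P1 Q1 fx; clear.
move: (pnum P) (pden P) => p q p0 q0 fx.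
case: (leP p q) => pq.
  have q2 : 0 <= q ^+ 2 := sqr_ge0 q.
  have h : 0 <= q ^+ 2 * (2 * p - q).
    have : p * p ^+ 2 <= p * q ^+ 2 by rewrite ler_pM2l // ler_pXn2r ?nnegrE ?(ltW p0).
    by move: fx; rewrite -exprS (_ : q ^+ 2 * _ = 2 * (p * q ^+ 2) - q ^+ 3); [lia|ring].
  have q0' : 0 < q by lia.
  have {}h : q <= 2 * p by move: h; rewrite pmulr_rge0 ?exprn_gt0 //; lia.
  have : 0 <= (p ^+ 2 - q ^+ 2) ^+ 2 := sqr_ge0 _.
  have : q ^+ 3 * q <= q ^+ 3 * (2 * p) by rewrite ler_pM2l ?exprn_gt0.
  have : 0 <= q ^+ 3 * (2 * p) by rewrite mulr_ge0 ?exprn_ge0 //; lia.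
  rewrite -exprSr (_ : 8 * p * q ^+ 3 = 4 * (q ^+ 3 * (2 * p))); last by ring.
  by lia.
have pq0 : 0 <= p * q by rewrite mulr_ge0 ?(ltW p0).
rewrite -subr_ge0; case: (leP (2 * q) p) => h.
  rewrite (_ : _ - _ = p ^+ 2 * ((p - 2 * q) * (p + 2 * q)) + 2 * q ^+ 4 +
      16 * (p * q) * q ^+ 2); last by ring.
  by rewrite !addr_ge0 ?mulr_ge0 ?sqr_ge0 ?exprn_ge0 //; lia.
rewrite (_ : _ - _ = p ^+ 4 + 2 * q ^+ 4 + 4 * (p * q) * (q * (4 * q - p))); last by ring.
by rewrite !addr_ge0 ?mulr_ge0 ?exprn_ge0 //; lia.
Qed.

(** Let q and s be the denominators of x and y. The equation in lowest terms makes q^3 and s^2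
    divide each other, and q^3 = s^2 gives q = (s / q)^2. *)
Lemma lowest_terms (x y : rat) : y ^+ 2 = x ^+ 3 + x - 1 ->
  exists d : int, [/\ 0 < d, denq x = d ^+ 2 & denq y = d ^+ 3].
Proof.
move=> e; have [q0 s0] := (denq_gt0 x, denq_gt0 y).
have [nx ny] := (numqR x, numqR y).
have eI : numq y ^+ 2 * denq x ^+ 3 = denq y ^+ 2 *
    (numq x ^+ 3 + numq x * denq x ^+ 2 - denq x ^+ 3).
  by apply/eqP; rewrite -(eqr_int rat); apply/eqP; ring: nx ny e.
have cx : coprimez (denq x) (numq x) by rewrite coprimez_sym; apply: coprime_num_den.
have cy : coprimez (denq y) (numq y) by rewrite coprimez_sym; apply: coprime_num_den.
have d1 : (denq y ^+ 2 %| denq x ^+ 3)%Z.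
  have : (denq y ^+ 2 %| numq y ^+ 2 * denq x ^+ 3)%Z by rewrite eI dvdz_mulr.
  by rewrite Gauss_dvdzr // coprimezXl // coprimezXr.
have d2 : (denq x ^+ 3 %| denq y ^+ 2)%Z.
  have : (denq x ^+ 3 %| denq y ^+ 2 *
      (numq x ^+ 3 + numq x * denq x ^+ 2 - denq x ^+ 3))%Z by rewrite -eI dvdz_mull.
  rewrite Gauss_dvdzl //; apply: coprimezXl.
  rewrite (_ : _ - _ = (numq x * denq x - denq x ^+ 2) * denq x + numq x ^+ 3).
    by rewrite /coprimez gcdzMDl; apply: coprimezXr.
  by ring.
have qs : denq x ^+ 3 = denq y ^+ 2.
  apply/eqP; rewrite eq_le !dvdz_le // exprn_gt0 //.
have /dvdzP [d ed] : (denq x %| denq y)%Z.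
  rewrite dvdzE -(@dvdn_pexp2r _ _ 2) // -!abszX -dvdzE -qs.
  by rewrite exprSr dvdz_mulr.
have ex : denq x = d ^+ 2.
  by apply: (mulIf (expf_neq0 2 (lt0r_neq0 q0))); rewrite -exprS qs ed; ring.
exists d; split=> //; last by rewrite ed ex; ring.
by rewrite -(pmulr_lgt0 _ q0) -ed.
Qed.

(** The d of [lowest_terms], recovered as d^3 / d^2. The value 0 at infinity, divisible by every
    integer, says that infinity reduces to itself modulo everything. *)
Definition rden (P : curve_point) : int :=
  if pt_opt P is Some (x, y) then (denq y %/ denq x)%Z else 0.

Lemma rden_sqr P : pden P = rden P ^+ 2.
Proof.
rewrite /pden /rden; case E: (pt_opt P) => [[x y]|] //.
have [d [d0 -> ->]] := lowest_terms (affP E).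
have dn : d ^+ 2 != 0 by rewrite sqrf_eq0 gt_eqF.
by rewrite exprS mulzK.
Qed.

Lemma rden_ge0 P : 0 <= rden P.
Proof. by rewrite /rden; case: (pt_opt P) => [[x y]|] //; rewrite divz_ge0. Qed.

Lemma rden_gt0 P : P != 0 -> 0 < rden P.
Proof.
by move=> P0; have := pden_gt0 P0; rewrite rden_sqr; have := rden_ge0 P; nia.
Qed.

Lemma rdenN P : rden (- P) = rden P.
Proof.
have := pdenN P; rewrite !rden_sqr; have := rden_ge0 P; have := rden_ge0 (- P).
by nia.
Qed.

(* The two values q3/p3 and q4/p4 are the roots of a quadratic whose
   coefficients, once divided by [D ^+ 2], are integral at D. *)
Lemma dvd_root_of_kummer (D p3 q3 p4 q4 l r s t : int) :
  coprimez p3 q3 -> coprimez D r -> l * (p3 * p4) = r ->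
  l * (p3 * q4 + p4 * q3) = D ^+ 2 * s -> l * (q3 * q4) = D ^+ 4 * t ->
  (D ^+ 2 %| q3)%Z.
Proof.
move=> c3 cr e2 e1 e0.
have [D0|D0] := eqVneq D 0.
  move: cr; rewrite D0 /coprimez gcd0z => /eqP r1.
  move: e1 e0; rewrite D0 expr0n /= !mul0r.
  have l0 : l != 0 by apply/eqP => l0; move: r1; rewrite -e2 l0 mul0r.
  have p0 : p4 != 0 by apply/eqP => p0; move: r1; rewrite -e2 p0 !mulr0.
  have p30 : p3 != 0 by apply/eqP => p0'; move: r1; rewrite -e2 p0' mul0r mulr0.
  move/eqP; rewrite mulf_eq0 (negPf l0) /= => /eqP e1.
  move/eqP; rewrite mulf_eq0 (negPf l0) /= mulf_eq0 => /orP[/eqP->//|/eqP q40].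
  move/eqP: e1; rewrite q40 mulr0 add0r mulf_eq0 (negPf p0) /= => /eqP ->.
  by [].
have cD : coprimez (D ^+ 2) (l * p4).
  apply: coprimezXl; apply: coprimez_dvdr cr; rewrite -e2 -dvdzE.
  by apply/dvdzP; exists p3; ring.
have quad : l * p4 * q3 ^+ 2 = D ^+ 2 * (s * q3 - D ^+ 2 * t * p3).
  transitivity (q3 * (l * (p3 * q4 + p4 * q3)) - p3 * (l * (q3 * q4))); first by ring.
  by rewrite e1 e0; ring.
(* This is a root of l p4 W^2 - s W + t p3. Its denominator divides both the leading coefficient and
   D^2, which are coprime. *)
pose w : rat := q3%:~R / (D ^+ 2)%:~R.
have D2 : (D ^+ 2)%:~R != 0 :> rat by rewrite intr_eq0 expf_neq0.
have nw := numqR w; have m0 := denq_neq0R w.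
have e3 : q3 * denq w = D ^+ 2 * numq w.
  have hw : q3%:~R = w * (D ^+ 2)%:~R by rewrite /w divfK.
  move: nw hw; move: (w) => v nw hw.
  by apply/eqP; rewrite -(eqr_int rat); apply/eqP; ring: nw hw.
have cw : coprimez (denq w) (numq w) by rewrite coprimez_sym; apply: coprime_num_den.
have m1 : (denq w %| D ^+ 2)%Z.
  by rewrite -(Gauss_dvdzl _ cw) -e3 dvdz_mull.
have m2 : (denq w %| l * p4)%Z.
  rewrite -(@Gauss_dvdzl _ (l * p4) (numq w ^+ 2)) ?coprimezXr //.
  have -> : l * p4 * numq w ^+ 2 = denq w * (s * numq w - denq w * (t * p3)).
    apply: (mulfI (expf_neq0 4 D0)).
    transitivity (l * p4 * (D ^+ 2 * numq w) ^+ 2); first by ring.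
    rewrite -e3; transitivity (l * p4 * q3 ^+ 2 * denq w ^+ 2); first by ring.
    rewrite quad.
    transitivity (D ^+ 2 * denq w * (s * (q3 * denq w) - D ^+ 2 * denq w * t * p3)).
      by ring.
    by rewrite e3; ring.
  exact: dvdz_mulr.
have : (denq w %| 1)%Z.
  by have := dvdz_gcd (denq w) (D ^+ 2) (l * p4); rewrite (eqP cD) m1 m2.
move=> /(dvdz_le ltr01) m3; have m4 := denq_gt0 w.
have {m3 m4} m1' : denq w = 1 by lia.
by apply/dvdzP; exists (numq w); rewrite mulrC -e3 m1' mulr1.
Qed.

(** The divisibility means reduction to infinity modulo D, and such points form a subgroup. Arguing
    on the quadratic of x(P + Q) and x(P - Q) avoids reducing the curve and allows composite D. *)
Lemma dvd_rden_add (D : int) P Q : (D %| rden P)%Z -> (D %| rden Q)%Z ->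
  (D %| rden (P + Q))%Z.
Proof.
move=> /dvdzP[a ea] /dvdzP[b eb].
have [l [e0 e1 e2]] := kummer_add P Q.
have cP := coprime_pnum_pden P; have cQ := coprime_pnum_pden Q.
(* Modulo D only the square of [pnum P * pnum Q] remains, which is prime to D. *)
have cr : coprimez D (kum2 (pnum P) (pden P) (pnum Q) (pden Q)).
  have -> : kum2 (pnum P) (pden P) (pnum Q) (pden Q) = (pnum P * pnum Q) ^+ 2 +
      D * (D * (a ^+ 2 * (pden Q * (4 * (pnum P * pden Q + pnum Q * pden P)) +
        a ^+ 2 * (D ^+ 2 * pden Q ^+ 2) - 2 * pnum P * pnum Q * pden Q))).
    by rewrite /kum2 (rden_sqr P) ea; ring.
  rewrite addrC mulrC /coprimez gcdzMDl; apply: coprimezXr; rewrite coprimezMr.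
  have cD S c : coprimez (pnum S) (pden S) -> rden S = c * D -> coprimez D (pnum S).
    move=> cS eS; rewrite coprimez_sym; apply: coprimez_dvdr cS; rewrite -dvdzE.
    by apply/dvdzP; exists (c ^+ 2 * D); rewrite rden_sqr eS; ring.
  by rewrite (cD _ _ cP ea) (cD _ _ cQ eb).
have : (D ^+ 2 %| pden (P + Q))%Z.
  apply: (@dvd_root_of_kummer D (pnum (P + Q)) (pden (P + Q)) (pnum (P - Q))
    (pden (P - Q)) l _ (2 * ((pnum P * pnum Q + pden P * pden Q) *
      (pnum P * b ^+ 2 + pnum Q * a ^+ 2) - 2 * a ^+ 4 * b ^+ 4 * D ^+ 6))
    ((pnum P * b ^+ 2 - pnum Q * a ^+ 2) ^+ 2) _ cr e2).
  - exact: coprime_pnum_pden.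
  - by rewrite e1 /kum1 !rden_sqr ea eb; ring.
  by rewrite e0 /kum0 !rden_sqr ea eb; ring.
by rewrite rden_sqr !dvdzE !abszX dvdn_pexp2r.
Qed.

Lemma dvd_rden_mulz (D : int) P (k : int) : (D %| rden P)%Z -> (D %| rden (P *~ k))%Z.
Proof.
move=> dP; have pos (n : nat) : (D %| rden (P *+ n))%Z.
  by elim: n => [|n IH]; [rewrite dvdz0|rewrite mulrS dvd_rden_add].
by case: k => n; [exact: pos|rewrite NegzE mulrNz rdenN; exact: pos].
Qed.

(** Bezout's relation between m and n, used inside the subgroup of points whose denominator is
    divisible by the left-hand gcd. *)
Lemma gcd_rden_dvd P (m n : int) :
  (gcdz (rden (P *~ m)) (rden (P *~ n)) %| rden (P *~ gcdz m n))%Z.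
Proof.
have [u [v <-]] := Bezoutz m n.
rewrite mulrzDr (mulrC u) (mulrC v) !mulrzA; apply: dvd_rden_add; apply: dvd_rden_mulz.
  exact: dvdz_gcdl.
exact: dvdz_gcdr.
Qed.

(** * Descent in the cubic ring *)

(* A triple (u, v, w) stands for u + v alpha + w alpha^2, alpha^3 + alpha = 1. *)
Definition cmul (A : comPzRingType) (p q : A * A * A) : A * A * A :=
  let: (u, v, w) := p in let: (u', v', w') := q in
  let c3 := v * w' + w * v' in let c4 := w * w' in
  (u * u' + c3, u * v' + v * u' - c3 + c4, u * w' + v * v' + w * u' - c4).

Definition cnorm (A : comPzRingType) (p : A * A * A) : A :=
  let: (u, v, w) := p in
  u * (u - w) ^+ 2 + u * v ^+ 2 - 3 * u * v * w + v * w ^+ 2 + v ^+ 3 + w ^+ 3.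

(** The product of the two other conjugates, that is, the norm times the inverse. *)
Definition cadj (A : comPzRingType) (p : A * A * A) : A * A * A :=
  let: (u, v, w) := p in
  ((u - w) ^+ 2 - v * (w - v), w * (w - v) - v * (u - w), v ^+ 2 - w * (u - w)).

Section CubicRing.
Variable A : comPzRingType.
Implicit Types p q r : A * A * A.

Lemma cmulC p q : cmul p q = cmul q p.
Proof. by case: p q => [[u v] w] [[u' v'] w'] /=; congr (_, _, _); ring. Qed.

Lemma cmulA p q r : cmul p (cmul q r) = cmul (cmul p q) r.
Proof.
by case: p q r => [[u v] w] [[u' v'] w'] [[a b] c] /=; congr (_, _, _); ring.
Qed.

Lemma cmulACA p q r s : cmul (cmul p q) (cmul r s) = cmul (cmul p r) (cmul q s).
Proof. by rewrite -!cmulA (cmulA q) (cmulC q r) -cmulA. Qed.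

Lemma cmul1 p : cmul (1, 0, 0) p = p.
Proof. by case: p => [[u v] w] /=; congr (_, _, _); ring. Qed.

Lemma cnormM p q : cnorm (cmul p q) = cnorm p * cnorm q.
Proof. by case: p q => [[u v] w] [[u' v'] w'] /=; ring. Qed.

Lemma cmul_adj p : cmul p (cadj p) = (cnorm p, 0, 0).
Proof. by case: p => [[u v] w] /=; congr (_, _, _); ring. Qed.

Lemma cmul_scalar (k : A) p : cmul (k, 0, 0) p = (k * p.1.1, k * p.1.2, k * p.2).
Proof. by case: p => [[u v] w] /=; congr (_, _, _); ring. Qed.

Lemma cnorm_scalar (k : A) : cnorm (k, 0, 0) = k ^+ 3.
Proof. by rewrite /=; ring. Qed.
End CubicRing.

Definition cmap (A B : comPzRingType) (f : A -> B) (p : A * A * A) : B * B * B :=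
  (f p.1.1, f p.1.2, f p.2).

Lemma cnorm_map (A B : comPzRingType) (f : {rmorphism A -> B}) p :
  cnorm (cmap f p) = f (cnorm p).
Proof.
by case: p => [[u v] w]; rewrite /=; ring.
Qed.

Lemma cmul_map (A B : comPzRingType) (f : {rmorphism A -> B}) p q :
  cmul (cmap f p) (cmap f q) = cmap f (cmul p q).
Proof.
by case: p q => [[u v] w] [[u' v'] w']; rewrite /= /cmap /=;
  congr (_, _, _); ring.
Qed.

(* X^3 + X - 1 is irreducible modulo 2, so the norm form is anisotropic over
   the field with two elements. *)
Lemma cnorm_even (u v w : int) : (2 %| cnorm (u, v, w))%Z ->
  [/\ (2 %| u)%Z, (2 %| v)%Z & (2 %| w)%Z].
Proof.
have dE (z : int) : (2 %| z)%Z = (z%:~R == 0 :> 'F_2).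
  have c : 2%N \in [pchar 'F_2] by exact: pchar_Fp.
  exact: dvdz_pcharf c z.
rewrite !dE -(cnorm_map intr (u, v, w)) /cmap /=.
move: (u%:~R) (v%:~R) (w%:~R); clear => u v w.
have F2 (z : 'F_2) : z = 0 \/ z = 1.
  by case: z => [[|[|m]] lt_m] //; [left|right]; apply: val_inj.
by case: (F2 u) => ->; case: (F2 v) => ->; case: (F2 w) => ->.
Qed.

(** Infinite descent: a zero norm is even, so all the coordinates are even and can be halved. *)
Lemma cnorm_int_eq0 (p : int * int * int) : cnorm p = 0 -> p = (0, 0, 0).
Proof.
case: p => [[u v] w].
have [n] := ubnP (`|u| + `|v| + `|w|)%N; elim: n u v w => // n IH u v w hn e.
have [] := @cnorm_even u v w; first by rewrite e dvdz0.
move=> /dvdzP[u' eu] /dvdzP[v' ev] /dvdzP[w' ew].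
have [z|nz] : (`|u| + `|v| + `|w| = 0)%N \/ (0 < `|u| + `|v| + `|w|)%N by lia.
  by congr (_, _, _); lia.
have [u0 v0 w0] : (u', v', w') = (0, 0, 0) :> (int * int * int).
  apply: IH; first by lia.
  apply: (mulfI (_ : 8 != 0 :> int)) => //; rewrite mulr0 -[RHS]e eu ev ew /=.
  by ring.
by rewrite eu ev ew u0 v0 w0.
Qed.

(* On the cube [-1, 1]^3 the norm form stays below 8 except near the corners
   +-(1, 1, -1), where shifting the first coordinate by 2 helps. *)
Lemma cnorm_cube_ge0 (F : realFieldType) (u v w : F) :
  0 <= u <= 1 -> -1 <= v <= 1 -> -1 <= w <= 1 ->
  `|cnorm (u, v, w)| < 8 \/ `|cnorm (u - 2, v, w)| < 8.
Proof.
case/andP=> u0 u1 /andP[v0 v1] /andP[w0 w1].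
have v2 : v ^+ 2 <= 1 by nra. have w2 : w ^+ 2 <= 1 by nra.
have v20 : 0 <= v ^+ 2 := sqr_ge0 v. have w20 : 0 <= w ^+ 2 := sqr_ge0 w.
have v3 : -1 <= v ^+ 3 <= 1 by apply/andP; split; rewrite exprS; nra.
have w3 : -1 <= w ^+ 3 <= 1 by apply/andP; split; rewrite exprS; nra.
have vw2 : -1 <= v * w ^+ 2 <= 1 by apply/andP; split; nra.
have vw : -1 <= v * w <= 1 by apply/andP; split; nra.
have uv2 : 0 <= u * v ^+ 2 <= 1 by apply/andP; split; nra.
case/andP: v3 => v3 v3'; case/andP: w3 => w3 w3'; case/andP: vw2 => vw2 vw2'.
case/andP: vw => vw vw'; case/andP: uv2 => uv2 uv2'.
have uw0 : 0 <= u * (u - w) ^+ 2 by rewrite mulr_ge0 ?sqr_ge0.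
have uvw : -1 <= u * (v * w) <= 1 by apply/andP; split; nra.
case/andP: uvw => uvw uvw'.
have uw1 : 0 <= w -> u * (u - w) ^+ 2 <= 1 * 1 ^+ 2.
  move=> w_ge0; apply: ler_pM; rewrite ?sqr_ge0 // -(real_normK (num_real (u - w))).
  by rewrite ler_pXn2r ?nnegrE ?normr_ge0 // ler_norml; apply/andP; split; lra.
rewrite !ltr_norml /cnorm.
have e1 : 3 * u * v * w = 3 * (u * (v * w)) by ring.
have e2 : 3 * (u - 2) * v * w = 3 * ((u - 2) * (v * w)) by ring.
have [v_le0|v_gt0] := leP v 0.
  left; have [w_ge0|w_lt0] := leP 0 w.
    have h : u * (u - w) ^+ 2 <= 1 * 1 ^+ 2 by exact: uw1.
    have : v ^+ 3 <= 0 by rewrite exprS mulr_le0_ge0.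
    have : v * w ^+ 2 <= 0 by rewrite mulr_le0_ge0.
    by move=> *; apply/andP; rewrite e1; split; lra.
  have : 0 <= u * (v * w) by rewrite mulr_ge0 // mulr_le0 // ltW.
  have : u * (u - w) ^+ 2 <= 1 * 2 ^+ 2.
    by apply: ler_pM; rewrite ?sqr_ge0 // ler_pXn2r ?nnegrE //; lra.
  have : v ^+ 3 <= 0 by rewrite exprS mulr_le0_ge0.
  have : v * w ^+ 2 <= 0 by rewrite mulr_le0_ge0.
  by move=> *; apply/andP; rewrite e1; split; lra.
have [w_ge0|w_lt0] := leP 0 w.
  left; have : 0 <= u * (v * w) by rewrite mulr_ge0 // mulr_ge0 // ltW.
  have h : u * (u - w) ^+ 2 <= 1 * 1 ^+ 2 by exact: uw1.
  by move=> *; apply/andP; rewrite e1; split; lra.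
have w3n : w ^+ 3 <= 0 by rewrite exprS mulr_le0_ge0 // ltW.
have [us|ub] := leP u (3 / 4).
  left; have : u * (u - w) ^+ 2 <= 3 / 4 * (7 / 4) ^+ 2.
    apply: ler_pM; rewrite ?sqr_ge0 //.
    by rewrite ler_pXn2r ?nnegrE //; lra.
  have : u * v ^+ 2 <= 3 / 4 * 1 by apply: ler_pM.
  have : u * (v * - w) <= 3 / 4 * (1 * 1).
    by apply: ler_pM => //; rewrite ?mulr_ge0 ?ler_pM //; lra.
  have : w ^+ 2 * (1 + w) <= 1 / 4.
    have h : - w * (1 + w) <= 1 / 4 by have := sqr_ge0 (2 * w + 1); nra.
    rewrite (_ : w ^+ 2 * (1 + w) = - w * (- w * (1 + w))); last by ring.
    by nra.
  have : v * w ^+ 2 <= 1 * w ^+ 2 by apply: ler_pM => //; lra.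
  rewrite (_ : w ^+ 2 * (1 + w) = w ^+ 2 + w ^+ 3); last by ring.
  move=> *; apply/andP; rewrite e1; split; lra.
right; have h1 : (2 - u) * (u - 2 - w) ^+ 2 <= 5 / 4 * (5 / 4) ^+ 2.
  apply: ler_pM; rewrite ?sqr_ge0 //; try lra.
  by rewrite -sqrrN ler_pXn2r ?nnegrE //; lra.
have h2 : (2 - u) * v ^+ 2 <= 5 / 4 * 1 by apply: ler_pM => //; lra.
have vwn : 0 <= v * - w by rewrite mulr_ge0 //; lra.
have h3 : 0 <= (2 - u) * (v * - w) <= 5 / 4 * 1.
  by rewrite mulr_ge0 //=; [apply: ler_pM => //|]; lra.
have h4 : 0 <= (2 - u) * (u - 2 - w) ^+ 2 by rewrite mulr_ge0 ?sqr_ge0 //; lra.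
have h5 : 0 <= (2 - u) * v ^+ 2 by rewrite mulr_ge0 //; lra.
case/andP: h3 => h3 h3'.
have v3p : 0 <= v ^+ 3 by rewrite exprn_ge0 // ltW.
have vw2p : 0 <= v * w ^+ 2 by rewrite mulr_ge0 // ltW.
have -> : (u - 2) * (u - 2 - w) ^+ 2 = - ((2 - u) * (u - 2 - w) ^+ 2) by ring.
have -> : (u - 2) * v ^+ 2 = - ((2 - u) * v ^+ 2) by ring.
have -> : 3 * (u - 2) * v * w = 3 * ((2 - u) * (v * - w)) by ring.
by apply/andP; split; lra.
Qed.

Definition csub (A : comPzRingType) (p q : A * A * A) : A * A * A :=
  (p.1.1 - q.1.1, p.1.2 - q.1.2, p.2 - q.2).

Lemma cmulBr (A : comPzRingType) (p q r : A * A * A) :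
  cmul p (csub q r) = csub (cmul p q) (cmul p r).
Proof.
case: p q r => [[u v] w] [[u' v'] w'] [[a b] c]; rewrite /csub /=.
by congr (_, _, _); ring.
Qed.

(** The coordinates are doubled differences with a lattice point: 8 = 2^3 stands for norm 1, and
    subtracting 2 s moves that lattice point by s. *)
Lemma cnorm_cube (F : realFieldType) (u v w : F) :
  -1 <= u <= 1 -> -1 <= v <= 1 -> -1 <= w <= 1 ->
  exists s : int, `|cnorm (u - 2 * s%:~R, v, w)| < 8.
Proof.
move=> /andP[u0 u1] hv hw; have [u_ge0|u_lt0] := leP 0 u.
  have [||] := @cnorm_cube_ge0 F u v w _ hv hw; first by rewrite u_ge0.
    by exists 0; rewrite mulr0 subr0.
  by exists 1; rewrite mulr1.
have hv' : -1 <= - v <= 1 by case/andP: hv => *; apply/andP; split; lra.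
have hw' : -1 <= - w <= 1 by case/andP: hw => *; apply/andP; split; lra.
have [|h|h] := @cnorm_cube_ge0 F (- u) (- v) (- w) _ hv' hw'.
- by apply/andP; split; lra.
- exists 0; rewrite mulr0 subr0 -normrN (_ : - _ = cnorm (- u, - v, - w)) //.
  by rewrite /=; ring.
exists (-1); rewrite -normrN (_ : - _ = cnorm (- u - 2, - v, - w)) //.
by rewrite /=; ring.
Qed.

Lemma nearest_int (x : rat) : exists n : int, -1 <= 2 * (x - n%:~R) <= 1.
Proof.
exists (Num.floor (x + 1 / 2)).
have := floor_le_tmp (x + 1 / 2); have := lt_succ_floor (x + 1 / 2).
rewrite rmorphD /=; set n := (_%:~R : rat) => h1 h2.
by apply/andP; split; lra.
Qed.

Lemma cnorm_nearest (x : rat * rat * rat) :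
  exists m : int * int * int, `|cnorm (csub x (cmap intr m))| < 1.
Proof.
case: x => [[u v] w].
have [i hi] := nearest_int u; have [j hj] := nearest_int v.
have [k hk] := nearest_int w; have [s hs] := cnorm_cube hi hj hk.
exists (i + s, j, k); rewrite -(ltr_pM2l (_ : 0 < 8 :> rat)) //.
rewrite -{1}(ger0_norm (_ : 0 <= 8 :> rat)) // -normrM mulr1.
apply: le_lt_trans hs; rewrite le_eqVlt; apply/orP; left; apply/eqP.
by congr `|_|; rewrite /csub /cmap /=; ring.
Qed.

Lemma cubic_euclid (p q : int * int * int) : cnorm q != 0 ->
  exists m : int * int * int, `|cnorm (csub p (cmul q m))| < `|cnorm q|.
Proof.
move=> q0; pose qr := cmap (intr : int -> rat) q; pose pr := cmap (intr : int -> rat) p.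
have nq : cnorm qr = (cnorm q)%:~R by exact: cnorm_map.
have nq0 : cnorm qr != 0 by rewrite nq intr_eq0.
pose x := cmul (((cnorm qr)^-1, 0, 0)) (cmul (cadj qr) pr).
have ex : cmul qr x = pr.
  rewrite /x cmulA (cmulC qr) -!cmulA (cmulA qr) cmul_adj cmulA.
  by rewrite (_ : cmul _ (cnorm qr, 0, 0) = (1, 0, 0)) ?cmul1 //=;
    congr (_, _, _); field.
have [m hm] := cnorm_nearest x; exists m.
rewrite -(ltr_int rat) !intr_norm -nq -cnorm_map.
have -> : cmap intr (csub p (cmul q m)) = cmul qr (csub x (cmap (intr : int -> rat) m)).
  rewrite cmulBr ex cmul_map /csub /cmap /pr /=.
  by rewrite !rmorphB.
by rewrite cnormM normrM gtr_pMr ?normr_gt0.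
Qed.

Definition ceval (t : int) (p : int * int * int) : int :=
  p.1.1 + p.1.2 * t + p.2 * t ^+ 2.

Lemma cevalM t p q : ceval t (cmul p q) = ceval t p * ceval t q -
  (t ^+ 3 + t - 1) * (p.1.2 * q.2 + p.2 * q.1.2 + p.2 * q.2 * t).
Proof. by case: p q => [[u v] w] [[u' v'] w']; rewrite /ceval /=; ring. Qed.

Lemma cevalB t p q : ceval t (csub p q) = ceval t p - ceval t q.
Proof. by rewrite /ceval /csub /=; ring. Qed.

(* [ceval t] reduces to a ring morphism from Z[alpha] to Z/b, with alpha sent to
   the root t; its kernel is generated by an element of minimal norm. *)
Lemma ceval_ideal_principal (b t : int) : b != 0 -> (b %| t ^+ 3 + t - 1)%Z ->
  exists g : int * int * int, [/\ (b %| ceval t g)%Z, cnorm g != 0 &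
    forall p, (b %| ceval t p)%Z -> exists m, p = cmul g m].
Proof.
move=> b0 bt.
pose good n := exists g : int * int * int,
  [/\ (b %| ceval t g)%Z, cnorm g != 0 & `|cnorm g|%N = n].
have : exists n, good n.
  pose g : int * int * int := (b, 0, 0); exists `|cnorm g|%N, g; split=> //.
    by rewrite /ceval /= !mul0r !addr0 dvdzz.
  by rewrite cnorm_scalar expf_neq0.
case=> n0; elim/ltn_ind: n0 => n IH [g [bg g0 gn]].
have [[m [mn gm]]|min] := pselect (exists m, (m < n)%N /\ good m).
  exact: IH gm.
exists g; split=> // p bp; have [m hm] := cubic_euclid p g0; exists m.
have bs : (b %| ceval t (csub p (cmul g m)))%Z.
  rewrite cevalB cevalM rpredB // rpredB //; first exact: dvdz_mulr.
  exact: dvdz_mulr.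
have /eqP : cnorm (csub p (cmul g m)) = 0.
  apply/eqP/negP => /negP n0; case: min; exists `|cnorm (csub p (cmul g m))|%N.
  by split; [rewrite -gn -ltz_nat !abszE|exists (csub p (cmul g m))].
move=> /eqP /cnorm_int_eq0; case: (p) (cmul g m) => [[u v] w] [[u' v'] w'].
by rewrite /csub /= => -[] /subr0_eq -> /subr0_eq -> /subr0_eq ->.
Qed.

(** In the basis 1, alpha, alpha^2 the elements b, alpha - t and alpha^2 - t^2 have determinant b.
    All three are multiples of g, so b is the determinant of the cofactors times that of the
    multiplication by g, which is its norm. *)
Lemma cnorm_principal_dvd (b t : int) (g : int * int * int) :
  (forall p, (b %| ceval t p)%Z -> exists m, p = cmul g m) ->
  (cnorm g %| b)%Z.
Proof.
move=> gen.
have [[[u1 v1] w1] e1] : exists m, (b, 0, 0) = cmul g m.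
  by apply: gen; rewrite /ceval /= !mul0r !addr0 dvdzz.
have [[[u2 v2] w2] e2] : exists m, (- t, 1, 0) = cmul g m.
  by apply: gen; rewrite /ceval /= (_ : _ + _ = 0) ?dvdz0 //; ring.
have [[[u3 v3] w3] e3] : exists m, (- t ^+ 2, 0, 1) = cmul g m.
  by apply: gen; rewrite /ceval /= (_ : _ + _ = 0) ?dvdz0 //; ring.
apply/dvdzP; exists (u1 * (v2 * w3 - v3 * w2) - v1 * (u2 * w3 - u3 * w2) +
  w1 * (u2 * v3 - u3 * v2)).
pose det (p q r : int * int * int) := p.1.1 * (q.1.2 * r.2 - r.1.2 * q.2) -
  p.1.2 * (q.1.1 * r.2 - r.1.1 * q.2) + p.2 * (q.1.1 * r.1.2 - r.1.1 * q.1.2).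
transitivity (det (b, 0, 0) (- t, 1, 0) (- t ^+ 2, 0, 1)); first by rewrite /det /=; ring.
by rewrite e1 e2 e3 /det; case: (g) => [[u v] w] /=; ring.
Qed.

(** The element a - d^2 alpha has norm b^2, so dividing by it amounts to multiplying by its adjoint
    and then dividing by b^2. *)
Lemma dvd_ceval_mul (a b d t : int) p : b ^+ 2 = a ^+ 3 + a * d ^+ 4 - d ^+ 6 ->
  b != 0 -> (b ^+ 2 %| t * d ^+ 2 - a)%Z -> (b ^+ 2 %| t ^+ 3 + t - 1)%Z ->
  (b ^+ 2 %| ceval t p)%Z -> exists m, p = cmul (a, - d ^+ 2, 0) m.
Proof.
move=> e b0 /dvdzP[r er] /dvdzP[s et] /dvdzP[c ec].
have ea : a = t * d ^+ 2 - r * b ^+ 2 by rewrite -er; ring.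
have nx : cnorm (a, - d ^+ 2, 0) = b ^+ 2 by rewrite e /=; ring.
have adjE : cadj (a, - d ^+ 2, 0) = (a ^+ 2 + d ^+ 4, a * d ^+ 2, d ^+ 4).
  by rewrite /=; congr (_, _, _); ring.
have [m em] : exists m : int * int * int,
    cmul (cadj (a, - d ^+ 2, 0)) p = cmul (b ^+ 2, 0, 0) m.
  (* Modulo b^2 the adjoint is d^4 (t^2 + 1 + t alpha + alpha^2), and the second factor is the
     cofactor of t - alpha in t^3 + t - 1. *)
  have [m1 [m2 [h1 h2]]] : exists m1 m2 : int,
      a ^+ 2 + d ^+ 4 = d ^+ 4 * (t ^+ 2 + 1) + b ^+ 2 * m1
      /\ a * d ^+ 2 = d ^+ 4 * t + b ^+ 2 * m2.
    exists (- 2 * t * d ^+ 2 * r + r ^+ 2 * b ^+ 2), (- r * d ^+ 2).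
    by rewrite ea; split; ring.
  rewrite adjE h1 h2.
  have {}ec : p.1.1 = c * b ^+ 2 - p.1.2 * t - p.2 * t ^+ 2.
    by rewrite -ec /ceval; ring.
  case: p ec => [[u v] w] /= ->.
  exists (d ^+ 4 * ((t ^+ 2 + 1) * c - v * s - w * t * s) +
      (c * b ^+ 2 - v * t - w * t ^+ 2) * m1 + w * m2,
    d ^+ 4 * (t * c - w * s) + (c * b ^+ 2 - v * t - w * t ^+ 2) * m2 + v * m1 - w * m2,
    d ^+ 4 * c + m2 * v + m1 * w).
  have lin (k x y : int) : x - y = k * (t ^+ 3 + t - 1 - s * b ^+ 2) -> x = y.
    by move=> h; apply/subr0_eq; rewrite h et subrr mulr0.
  congr (_, _, _).
  - by apply: (lin (- d ^+ 4 * (v + w * t))); ring.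
  - by apply: (lin (- d ^+ 4 * w)); ring.
  by ring.
exists m; move: nx; set x := (a, - d ^+ 2, 0) in em * => nx.
have : cmul (b ^+ 2, 0, 0) p = cmul (b ^+ 2, 0, 0) (cmul x m).
  by rewrite -[in LHS]nx -cmul_adj -cmulA em !cmulA (cmulC x).
rewrite !cmul_scalar; case: (p) (cmul x m) => [[u v] w] [[u' v'] w'] /=.
by case=> /(mulfI (expf_neq0 2 b0))-> /(mulfI (expf_neq0 2 b0))->
  /(mulfI (expf_neq0 2 b0))->.
Qed.

(** For the abscissa a / d^2, the ideal of a - d^2 alpha is the square of I = (b, alpha - t), and g
    generates I. Only the divisibility of g^2 is checked directly: then N(g)^2 = b^2 N(c), and since
    N(g) divides b the cofactor c has norm 1. *)
Lemma abscissa_sqr_unit (a b d : int) :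
  b ^+ 2 = a ^+ 3 + a * d ^+ 4 - d ^+ 6 -> coprimez a d -> b != 0 ->
  exists g c : int * int * int, cnorm c = 1 /\ cmul g g = cmul (a, - d ^+ 2, 0) c.
Proof.
move=> e cad b0.
have cbd : coprimez (b ^+ 2) (d ^+ 2).
  apply: coprimezXr; rewrite coprimez_sym.
  rewrite e (_ : _ - _ = (a * d ^+ 3 - d ^+ 5) * d + a ^+ 3); last by ring.
  by rewrite /coprimez gcdzMDl; apply: coprimezXr; rewrite coprimez_sym.
have /coprimezP [[k l] /= kl] := cbd.
(* As l inverts d^2 modulo b^2, t represents a / d^2. *)
pose t := a * l.
have h1 : (b ^+ 2 %| t * d ^+ 2 - a)%Z.
  apply/dvdzP; exists (- a * k); rewrite /t.
  have -> : a * l * d ^+ 2 - a = a * (l * d ^+ 2) - a by ring.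
  have -> : l * d ^+ 2 = 1 - k * b ^+ 2 by rewrite -kl; ring.
  by ring.
have h2 : (b ^+ 2 %| t ^+ 3 + t - 1)%Z.
  rewrite -(@Gauss_dvdzl _ (t ^+ 3 + t - 1) (d ^+ 6)); last first.
    by have := coprimezXr 3 cbd; rewrite -exprM.
  have /dvdzP [r er] := h1.
  have etd : t * d ^+ 2 = a + r * b ^+ 2 by rewrite -er; ring.
  apply/dvdzP; exists (1 + 3 * a ^+ 2 * r + 3 * a * r ^+ 2 * b ^+ 2 +
    r ^+ 3 * b ^+ 4 + r * d ^+ 4).
  transitivity ((t * d ^+ 2) ^+ 3 + (t * d ^+ 2) * d ^+ 4 - d ^+ 6); first by ring.
  rewrite etd; transitivity (a ^+ 3 + a * d ^+ 4 - d ^+ 6 + b ^+ 2 * (3 * a ^+ 2 * r +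
    3 * a * r ^+ 2 * b ^+ 2 + r ^+ 3 * b ^+ 4 + r * d ^+ 4)); first by ring.
  by rewrite -e; ring.
have h2' : (b %| t ^+ 3 + t - 1)%Z by apply: dvdz_trans h2; rewrite expr2 dvdz_mulr.
have [g [bg g0 gen]] := ceval_ideal_principal b0 h2'.
have gb := cnorm_principal_dvd gen.
have bgg : (b ^+ 2 %| ceval t (cmul g g))%Z.
  rewrite cevalM rpredB //; last exact: dvdz_mulr.
  by rewrite -expr2 !dvdzE !abszX dvdn_pexp2r.
have [c ec] := dvd_ceval_mul e b0 h1 h2 bgg.
exists g, c; split=> //.
have en : cnorm g ^+ 2 = b ^+ 2 * cnorm c.
  rewrite expr2 -cnormM ec cnormM; congr (_ * _).
  by rewrite e /=; ring.
have c0 : 0 < cnorm c.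
  have : 0 < b ^+ 2 * cnorm c by rewrite -en exprn_even_gt0.
  by rewrite pmulr_rgt0 // exprn_even_gt0.
have : cnorm g ^+ 2 <= b ^+ 2.
  apply: dvdz_le; first by rewrite exprn_even_gt0.
  by rewrite !dvdzE !abszX dvdn_pexp2r.
rewrite en -{2}(mulr1 (b ^+ 2)) ler_pM2l ?exprn_even_gt0 //; lia.
Qed.

(** * The units of norm 1 *)

Lemma cubic_surj (R : rcfType) (c : R) : 0 <= c -> exists x, x ^+ 3 + x = c.
Proof.
move=> c0; pose p : {poly R} := 'X ^+ 3 + 'X - c%:P.
have [||x _ /rootP px] := @poly_ivt R p 0 c; rewrite ?c0 //.
  by rewrite /p !hornerE; apply/andP; split; [lra|rewrite addrK exprn_ge0].
by exists x; apply/subr0_eq; rewrite -px /p !hornerE.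
Qed.

Lemma cubic_root_bounds (F : realFieldType) (rho : F) : rho ^+ 3 + rho = 1 ->
  2 / 3 < rho < 7 / 10.
Proof.
move=> e; apply/andP; split; rewrite ltNge; apply/negP => h.
  have : rho ^+ 3 <= (2 / 3) ^+ 3.
    have [r0|r0] := leP 0 rho; first by rewrite ler_pXn2r ?nnegrE //; lra.
    by apply: (@le_trans _ _ 0); [rewrite exprS mulr_le0_ge0 ?sqr_ge0 ?ltW|lra].
  by lra.
have : (7 / 10) ^+ 3 <= rho ^+ 3 by rewrite ler_pXn2r ?nnegrE //; lra.
by lra.
Qed.

Section Units.
Variables (F : archiRealFieldType) (rho : F).
Hypothesis rhoE : rho ^+ 3 + rho = 1.

Let rho_lo : 2 / 3 < rho. Proof. by case/andP: (cubic_root_bounds rhoE). Qed.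
Let rho_hi : rho < 7 / 10. Proof. by case/andP: (cubic_root_bounds rhoE). Qed.

Definition cplace (p : int * int * int) : F :=
  p.1.1%:~R + p.1.2%:~R * rho + p.2%:~R * rho ^+ 2.

Let rho3 : rho ^+ 3 = 1 - rho. Proof. by rewrite -rhoE; ring. Qed.

Lemma cplaceM p q : cplace (cmul p q) = cplace p * cplace q.
Proof.
by case: p q => [[u v] w] [[u' v'] w']; rewrite /cplace /=; ring: rho3.
Qed.

(* The norm is the product of the real place and of the squared modulus of the
   complex one, here written as a sum of two squares. *)
Lemma cnorm_place (u v w : int) : (cnorm (u, v, w))%:~R = cplace (u, v, w) *
  ((u%:~R - v%:~R * rho / 2 - w%:~R * (1 + rho ^+ 2 / 2)) ^+ 2 +
   (1 + 3 / 4 * rho ^+ 2) * (v%:~R - w%:~R * rho) ^+ 2).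
Proof. by rewrite /cplace /=; field: rho3. Qed.

Definition unit_class (c : int * int * int) : Prop :=
  exists r, c = cmul r r \/ c = cmul (0, 1, 0) (cmul r r).

Lemma alphaV : cmul (0, 1, 0) (1, 0, 1) = (1, 0, 0) :> (int * int * int).
Proof. by []. Qed.

Lemma unit_class_alpha c : unit_class (cmul (0, 1, 0) c) -> unit_class c.
Proof.
have c1 : c = cmul (1, 0, 1) (cmul (0, 1, 0) c) by rewrite cmulA (cmulC (1, 0, 1)) cmul1.
case=> r [e|e]; last by exists r; left; rewrite c1 e cmulA (cmulC (1, 0, 1)) cmul1.
exists (cmul (1, 0, 1) r); right.
rewrite [LHS]c1 e; transitivity (cmul (cmul (cmul (0, 1, 0) (1, 0, 1)) (1, 0, 1)) (cmul r r)).
  by rewrite alphaV cmul1.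
by rewrite cmulACA !cmulA.
Qed.

Lemma unit_class_inv c c' : cmul c c' = (1, 0, 0) -> unit_class c -> unit_class c'.
Proof.
move=> cc [r [e|e]]; exists (cmul c' r).
  left; rewrite cmulACA -e cmulC cmulA cc cmul1 //.
by right; rewrite cmulACA (cmulC (cmul c' c')) cmulA -e cmulA cc cmul1.
Qed.

(** As 1 + rho^2 = 1 / rho, this interval is a fundamental domain for multiplication by alpha. The
    norm being 1, the complex place has modulus at most 1, which leaves few coordinates to
    examine. *)
Lemma unit_small c : cnorm c = 1 -> 1 <= cplace c -> cplace c < 1 + rho ^+ 2 ->
  c = (1, 0, 0).
Proof.
case: c => [[u v] w] n1 x1 x2.
have := cnorm_place u v w; rewrite n1 mulr1z.
move: x1 x2; rewrite /cplace /=.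
set x := (_ + _ + _); set re := _ - _ - _; set im := v%:~R - _.
move=> x1 x2 xq.
have r2l : 4 / 9 < rho ^+ 2 by have := rho_lo; nra.
have r2h : rho ^+ 2 < 49 / 100 by have := rho_lo; have := rho_hi; nra.
have q1 : re ^+ 2 + (1 + 3 / 4 * rho ^+ 2) * im ^+ 2 <= 1.
  rewrite leNgt; apply/negP => h; move: xq; apply/eqP; rewrite lt_eqF //.
  by have := mulr_gt0 (lt_le_trans ltr01 x1) (ltr01 : 0 < 1 :> F); nra.
have im0 := sqr_ge0 im; have re0 := sqr_ge0 re.
have imb : - (9 / 10) < im < 9 / 10.
  by rewrite -ltr_norml -(ltr_pXn2r (n := 2)) ?nnegrE // real_normK ?num_real //; nra.
have reb : -1 <= re <= 1.
  by rewrite -ler_norml -(ler_pXn2r (n := 2)) ?nnegrE // real_normK ?num_real //; nra.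
case/andP: imb => im1 im2; case/andP: reb => re1 re2.
(* This difference isolates w up to a small multiple of [im]; then [im] bounds v, and the real place
   bounds u. *)
have xre : x - re = w%:~R * (1 + 3 * rho ^+ 2) + 3 / 2 * rho * im.
  by rewrite /x /re /im; field.
have ri : - (95 / 100) < 3 / 2 * rho * im < 95 / 100.
  by apply/andP; split; have := rho_lo; have := rho_hi; nra.
case/andP: ri => ri1 ri2.
have wE : w = 0 \/ w = 1.
  have wl2 : (w < 2)%R.
    rewrite ltNge; apply/negP => w2.
    have w2' : 2 <= w%:~R :> F by rewrite (ler_int F 2).
    have : 2 * (7 / 3) <= w%:~R * (1 + 3 * rho ^+ 2) by apply: ler_pM => //; lra.
    by lra.
  have wg1 : (-1 < w)%R.
    rewrite ltNge; apply/negP => w2.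
    have w2' : w%:~R <= -1 :> F by rewrite (ler_int F _ (-1)).
    have : 1 * (7 / 3) <= - w%:~R * (1 + 3 * rho ^+ 2) by apply: ler_pM => //; lra.
    by lra.
  by clear -wl2 wg1; lia.
have intP (z : int) (r s : F) : r < z%:~R -> z%:~R < s -> forall k l : int,
    k%:~R <= r -> s <= l%:~R -> k < z < l.
  move=> h1 h2 k l hk hl; apply/andP; split; rewrite -(ltr_int F).
    exact: le_lt_trans h1.
  exact: lt_le_trans hl.
move: rho_lo rho_hi => rl rh; move: x1 x2 im1 im2 re1 re2; rewrite /x /re /im.
case: wE => ->.
  rewrite !mul0r !subr0 !addr0 => x1 x2 im1 im2 re1 re2.
  have vE : v = 0.
    suff h : -1 < v < 1 by clear -h; lia.
    by apply: (intP _ _ _ im1 im2); rewrite ?mulrNz ?mulr1z; lra.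
  move: x1 x2; rewrite vE mul0r addr0 => x1 x2.
  have uE : u = 1.
    suff h : 0 < u < 2 by clear -h; lia.
    by apply: (intP _ (1 / 2) (3 / 2)); rewrite ?mulr0z; lra.
  by rewrite uE.
rewrite !mul1r => x1 x2 im1 im2 re1 re2.
have vE : v = 0 \/ v = 1.
  suff h : -1 < v < 2 by clear -h; lia.
  by apply: (intP _ (- (9 / 10)) (17 / 10)); rewrite ?mulrNz ?mulr1z; lra.
case: vE x1 x2 re1 re2 => ->; rewrite ?mul0r ?mul1r ?addr0 => x1 x2 re1 re2.
  suff h : 0 < u < 1 by clear -h; lia.
  by apply: (intP _ (1 / 2) 1); rewrite ?mulr0z ?mulr1z; lra.
have : -1 < u < 1.
  by apply: (intP _ (- (9 / 10)) 1); rewrite ?mulrNz ?mulr1z; lra.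
move=> uE; have {}uE : u = 0 by clear -uE; lia.
by exfalso; move: re1; rewrite uE; lra.
Qed.

(** Repeated multiplication by alpha lowers a real place above 1 into [1, 1 / rho), where only the
    unit 1 remains; a place below 1 is treated through the inverse. Such units are thus powers of
    alpha, and only the parity of the exponent matters. *)
Lemma unit_class_norm1 c : cnorm c = 1 -> unit_class c.
Proof.
have rho_pos : 0 < rho by have := rho_lo; lra.
have rho_mul : rho * (1 + rho ^+ 2) = 1 by ring: rho3.
have big n d : cnorm d = 1 -> 1 <= cplace d -> rho ^+ n.+1 * cplace d < 1 -> unit_class d.
  elim: n d => [|n IH] d nd d1 dn.
    rewrite (unit_small nd d1); first by exists (1, 0, 0); left; rewrite cmul1.
    rewrite -(ltr_pM2l rho_pos); move: dn; rewrite expr1.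
    by rewrite rho_mul.
  have [small|large] := ltP (cplace d) (1 + rho ^+ 2).
    by rewrite (unit_small nd d1 small); exists (1, 0, 0); left; rewrite cmul1.
  have ea : cplace (0, 1, 0) = rho by rewrite /cplace /= !mulr0z !mulr1z; ring.
  apply: unit_class_alpha; apply: IH; rewrite ?cnormM ?nd ?cplaceM ?ea //.
    have : rho * (1 + rho ^+ 2) <= rho * cplace d by rewrite ler_pM2l.
    by rewrite rho_mul.
  by rewrite mulrA -exprSr.
(* With N > |x|, rho^2 <= 1/2 and N <= 2^N bound the product by 1 for the exponent 2 N; one more
   factor rho makes this strict. *)
have bound (x : F) : exists n, rho ^+ n.+1 * x < 1.
  pose N := Num.bound `|x|; exists N.*2; have xN : x < N%:R.
    by apply: le_lt_trans (ler_norm x) _; exact: archi_boundP (normr_ge0 x).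
  have h2 : rho ^+ N.*2 <= (1 / 2) ^+ N.
    rewrite -mul2n exprM ler_pXn2r ?nnegrE ?sqr_ge0 //.
    by have := rho_lo; have := rho_hi; nra.
  have h3 : (1 / 2) ^+ N * N%:R <= 1 :> F.
    rewrite div1r exprVn mulrC ler_pdivrMr ?exprn_gt0 // mul1r -natrX ler_nat.
    exact/ltnW/ltn_expl.
  have h4 : rho ^+ N.*2 * x <= 1.
    apply: le_trans h3; apply: (@le_trans _ _ (rho ^+ N.*2 * N%:R)).
      by rewrite ler_pM2l ?exprn_gt0 // ltW.
    by rewrite ler_wpM2r.
  by rewrite exprS -mulrA; have := rho_hi; nra.
move=> n1; have [x1|x1] := leP 1 (cplace c).
  by have [n hn] := bound (cplace c); apply: big hn.
have cadj1 : cmul c (cadj c) = (1, 0, 0) by rewrite cmul_adj n1.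
apply: (@unit_class_inv (cadj c)); first by rewrite cmulC.
have pa : cplace c * cplace (cadj c) = 1.
  by rewrite -cplaceM cadj1 /cplace /= !mulr0z mulr1z; ring.
have c0 : 0 < cplace c.
  have := n1; case: (c) => [[u v] w] n1'; have := cnorm_place u v w.
  rewrite n1' mulr1z ltNge => e; apply/negP => c0; move/eqP: e; apply/negP.
  rewrite gt_eqF //; apply: le_lt_trans ltr01; rewrite mulr_le0_ge0 //.
  by rewrite addr_ge0 ?sqr_ge0 // mulr_ge0 ?sqr_ge0 // addr_ge0 // mulr_ge0 ?sqr_ge0.
have na : cnorm (cadj c) = 1.
  by have := cnormM c (cadj c); rewrite cadj1 n1 mul1r => <-.
have [n hn] := bound (cplace (cadj c)); apply: big hn => //.
by rewrite -(ler_pM2l c0) pa mulr1 ltW.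
Qed.
End Units.

(** * Halving points and the descent *)

Lemma cmul_inv (F : fieldType) (p : F * F * F) : cnorm p != 0 ->
  exists q, cmul p q = (1, 0, 0).
Proof.
move=> n0; exists (cmul ((cnorm p)^-1, 0, 0) (cadj p)).
rewrite cmulA (cmulC p) -cmulA cmul_adj /=.
by congr (_, _, _); field.
Qed.

(* Writing x - alpha = (r + s alpha + t alpha^2)^2, the half of P is
   (s / t, 1 / t). *)
Lemma halve (P : curve_point) x y q : pt_opt P = Some (x, y) ->
  cmul q q = (x, -1, 0) -> exists Q, P = Q + Q.
Proof.
case: q => [[r s] t] eP [e0 e1 e2].
have t0 : t != 0.
  apply/eqP => t0; move: e1 e2; rewrite t0 => e1 e2.
  have s0 : s = 0.
    by apply/eqP; rewrite -sqrf_eq0; apply/eqP; rewrite -[RHS]e2; ring.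
  move: e1; rewrite s0 => /eqP; apply/negP.
  by rewrite (_ : _ - _ + _ = 0) //; ring.
have [e es] : exists e, s = e * t by exists (s / t); rewrite divfK.
have er : r = t * (1 - e ^+ 2) / 2.
  apply: (mulfI (_ : 2 * t != 0)); first by rewrite mulf_neq0.
  apply/subr0_eq; by rewrite -[RHS]e2 es; field.
have et : t ^+ 2 * (e ^+ 3 + e - 1) = 1.
  by apply: oppr_inj; rewrite -[RHS]e1 er es; field.
have [Q eQ] : exists Q, pt_opt Q = Some (e, t^-1).
  apply: aff_exists; apply: (mulfI (expf_neq0 2 t0)).
  by rewrite et exprVn mulfV // expf_neq0.
have := add_tangent eQ; cbv zeta; rewrite (_ : _ - e = x).
  move=> /(same_abscissa eP) [->|->]; first by exists Q.
  by exists (- Q); rewrite opprD.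
rewrite -e0 er es.
have -> : (3 * e ^+ 2 + 1) / (2 / t) = t * (3 * e ^+ 2 + 1) / 2 by field.
transitivity (t ^+ 2 * (3 * e ^+ 2 + 1) ^+ 2 / 4 - 2 * e * (t ^+ 2 * (e ^+ 3 + e - 1))).
  by rewrite et; field.
by field.
Qed.

(** Let L be the value at alpha of the line through P and T. The three intersections have abscissas
    x, 1 and x3, and alpha is a root of the cubic, so L^2 = (x3 - alpha) (x - alpha) (1 - alpha). As
    1 - alpha = alpha^3 and x - alpha = alpha q^2, the element x3 - alpha is the square of L /
    (alpha^2 q). *)
Lemma chord_square (P T : curve_point) x y y' q : pt_opt P = Some (x, y) ->
  pt_opt T = Some (1, y') -> x != 1 -> (x, -1, 0) = cmul (0, 1, 0) (cmul q q) ->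
  exists Q, P + T = Q + Q.
Proof.
move=> eP eT x1 exq; have [e1 e2] := (affP eP, affP eT).
have := add_chord eP eT x1; cbv zeta.
set l := _ / _; set x3 := _ - 1; move=> e3.
have x10 : x - 1 != 0 by rewrite subr_eq0.
have [q' qq'] : exists q', cmul q q' = (1, 0, 0).
  apply: cmul_inv; apply/eqP => q0.
  have h : cnorm (x, -1, 0) = 0 by rewrite exq !cnormM q0 !mulr0.
  have := cubic_no_rat_root x; rewrite (_ : _ - 1 = cnorm (x, -1, 0)); last first.
    by rewrite /=; ring.
  by rewrite h eqxx.
pose a : rat * rat * rat := (0, 1, 0).
pose V : rat * rat * rat := (1, 0, 1).
have aV : cmul a V = (1, 0, 0) by rewrite /a /V /=; congr (_, _, _); ring.
pose L : rat * rat * rat := (y' - l, l, 0).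
apply: (halve (q := cmul L (cmul (cmul V V) q')) e3).
have yy' : y' ^+ 2 = 1 by rewrite e2; ring.
have line : cmul L L = cmul (x3, -1, 0) (cmul (x, -1, 0) (1, -1, 0)).
  have el : l * (x - 1) = y - y' by rewrite /l divfK.
  have el2 : 2 * y' * l = x ^+ 2 + x + 2 - l ^+ 2 * (x - 1).
    apply: (mulIf x10); transitivity (2 * y' * (l * (x - 1))); first by ring.
    rewrite el; transitivity ((x ^+ 2 + x + 2) * (x - 1) - (l * (x - 1)) ^+ 2).
      by rewrite el; ring: e1 yy'.
    by ring.
  rewrite /L /x3 /=; congr (_, _, _).
  - apply/subr0_eq; transitivity (y' ^+ 2 - 1 - (2 * y' * l - (x ^+ 2 + x + 2 -
      l ^+ 2 * (x - 1)))); first by ring.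
    by rewrite yy' el2; ring.
  - apply/subr0_eq; transitivity (2 * y' * l - (x ^+ 2 + x + 2 - l ^+ 2 * (x - 1))).
      by ring.
    by rewrite el2; ring.
  by ring.
have a3 : (1, -1, 0) = cmul (0, 1, 0) (cmul (0, 1, 0) (0, 1, 0)) :> (rat * rat * rat).
  by rewrite /=; congr (_, _, _); ring.
pose n := cmul (cmul a a) q; pose W := cmul (cmul V V) q'.
have nn : cmul (x, -1, 0) (1, -1, 0) = cmul n n.
  by rewrite exq a3 -/a /n cmulACA (cmulACA (cmul a a) q) -[RHS]cmulA (cmulC (cmul q q)).
have nW : cmul n W = (1, 0, 0).
  by rewrite /n /W cmulACA qq' (cmulACA a a) aV !cmul1.
by rewrite cmulACA line nn -cmulA cmulACA nW cmul1 cmulC cmul1.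
Qed.

(** Otherwise the cube of [height P] would be at most K <= 800 < 10^3. The values in use are 248 and
    3 * 248 = 744. *)
Lemma height_ge10_lt (P Q : curve_point) (K : int) : K <= 800 -> 10 <= height P ->
  height Q ^+ 4 <= K * height P -> height Q < height P.
Proof.
move=> hK hP h; rewrite ltNge; apply/negP => PQ; have h1 := height_ge1 Q.
have h4 : height P ^+ 4 <= height Q ^+ 4.
  by rewrite ler_pXn2r ?nnegrE //; lia.
have h3 : 10 ^+ 3 * height P <= height P ^+ 4.
  by rewrite (exprSr (height P)) ler_pM2r ?ler_pXn2r ?nnegrE //; lia.
have : K * height P <= 800 * height P by rewrite ler_pM2r; lia.
by move: h h3 h4; clear -hP; lia.
Qed.

(** Height below 10 means a numerator at most 9 over d^2 with d at most 3. The only abscissas found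
    are 1 and 2, those of G and 2 G. The equation is arranged so that no natural numbers are
    subtracted. *)
Lemma small_height_search (a d b : nat) : (0 < a < 10)%N -> (0 < d < 4)%N ->
  (b ^ 2 + d ^ 6 = a ^ 3 + a * d ^ 4)%N -> (a = d ^ 2 \/ a = 2 * d ^ 2)%N.
Proof.
move=> /andP[a0 ha] /andP[d0 hd] e.
have hb : (b < 40)%N.
  rewrite ltnNge; apply/negP => b40.
  have : (40 ^ 2 <= b ^ 2)%N by rewrite leq_exp2r.
  have : (a ^ 3 <= 9 ^ 3)%N by rewrite leq_exp2r.
  have : (a * d ^ 4 <= 9 * 3 ^ 4)%N by rewrite leq_mul ?leq_exp2r.
  by lia.
have : all (fun a => all (fun d => all (fun b =>
    (b ^ 2 + d ^ 6 == a ^ 3 + a * d ^ 4)%N ==> ((a == d ^ 2) || (a == 2 * d ^ 2))%N)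
  (iota 0 40)) (iota 1 3)) (iota 1 9) by vm_compute.
move=> /allP/(_ a); rewrite mem_iota a0 ha => /(_ isT).
move=> /allP/(_ d); rewrite mem_iota d0 hd => /(_ isT).
move=> /allP/(_ b); rewrite mem_iota hb => /(_ isT).
by move/implyP/(_ (introT eqP e))/orP => [] /eqP ->; [left|right].
Qed.

Lemma aff_coords (P : curve_point) x y : pt_opt P = Some (x, y) ->
  exists b : int, [/\ b ^+ 2 = pnum P ^+ 3 + pnum P * rden P ^+ 4 - rden P ^+ 6,
    coprimez (pnum P) (rden P), b != 0,
    x = (pnum P)%:~R / (rden P)%:~R ^+ 2 & y = b%:~R / (rden P)%:~R ^+ 3].
Proof.
move=> eP; have e := affP eP; have y0 := curve_y_neq0 e.
have P0 : P != 0 by apply/ept_affP; exists x, y.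
have d0 := rden_gt0 P0; have [d [d0' ex ey]] := lowest_terms e.
have ed : rden P = d.
  by rewrite /rden eP ex ey exprS mulzK // expf_neq0 // gt_eqF.
have dn : d%:~R != 0 :> rat by rewrite intr_eq0 gt_eqF.
have [nx ny] := (numqR x, numqR y).
rewrite (pnum_aff eP) ed; exists (numq y).
have xE : x = (numq x)%:~R / d%:~R ^+ 2 by rewrite nx ex rmorphXn /= mulfK // expf_neq0.
have yE : y = (numq y)%:~R / d%:~R ^+ 3 by rewrite ny ey rmorphXn /= mulfK // expf_neq0.
split=> //.
- apply/eqP; rewrite -(eqr_int rat); apply/eqP.
  move: nx ny; rewrite ex ey => nx ny; ring: nx ny e.
- have := coprime_num_den x; rewrite -/(coprimez _ _) ex => h.
  by apply: coprimez_dvdr h; rewrite -dvdzE expr2 dvdz_mulr.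
by rewrite numq_eq0.
Qed.

(** The relation g^2 = (a - d^2 alpha) c is carried from the ring to its field, where d and the
    square part of the unit c are inverted. [R] supplies the real root of X^3 + X - 1 on which the
    study of units relies. *)
Lemma abscissa_class (R : realType) (P : curve_point) x y : pt_opt P = Some (x, y) ->
  exists q, cmul q q = (x, -1, 0) \/ (x, -1, 0) = cmul (0, 1, 0) (cmul q q).
Proof.
move=> eP; have P0 : P != 0 by apply/ept_affP; exists x, y.
have [b [e cop b0 xE _]] := aff_coords eP.
have d0 := rden_gt0 P0.
have [g [c [nc gg]]] := abscissa_sqr_unit e cop b0.
have [rho rhoE] := @cubic_surj R 1 ler01.
have [r cr] := unit_class_norm1 rhoE nc.
pose ir := cmap (intr : int -> rat).
have irM p q : ir (cmul p q) = cmul (ir p) (ir q) by rewrite /ir cmul_map.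
pose D : rat := ((rden P)%:~R)^-1.
have Dn : (rden P)%:~R != 0 :> rat by rewrite intr_eq0 gt_eqF.
have xi : ir (pnum P, - rden P ^+ 2, 0) = cmul (D ^- 2, 0, 0) (x, -1, 0).
  rewrite cmul_scalar /ir /cmap /= xE /D; congr (_, _, _); last by rewrite mulr0.
    by field.
  by rewrite rmorphN rmorphXn /=; field.
have D0 : D != 0 by rewrite invr_neq0.
have D2 : cmul (cmul (D, 0, 0) (D, 0, 0)) (D ^- 2, 0, 0) = (1, 0, 0).
  by rewrite /=; congr (_, _, _); field.
have x0 : (x, -1, 0) = cmul (cmul (D, 0, 0) (D, 0, 0)) (ir (pnum P, - rden P ^+ 2, 0)).
  by rewrite xi cmulA D2 cmul1.
have nir p : cnorm (ir p) = (cnorm p)%:~R by rewrite /ir cnorm_map.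
have [r' rr'] : exists r', cmul (ir r) r' = (1, 0, 0).
  apply: cmul_inv; rewrite nir intr_eq0; apply/eqP => r0; move: nc.
  by case: cr => ->; rewrite !cnormM r0 !mulr0.
have {}gg := congr1 ir gg; rewrite !irM in gg.
pose a : rat * rat * rat := (0, 1, 0); pose V : rat * rat * rat := (1, 0, 1).
have aV : cmul a V = (1, 0, 0) by rewrite /a /V /=; congr (_, _, _); ring.
case: cr => ec; rewrite ec !irM in gg.
  exists (cmul (D, 0, 0) (cmul (ir g) r')); left.
  rewrite x0 cmulACA; congr cmul.
  by rewrite cmulACA gg -cmulA cmulACA rr' cmul1 cmulC cmul1.
exists (cmul (D, 0, 0) (cmul (ir g) (cmul V r'))); right.
rewrite -/a x0 cmulACA [RHS]cmulA (cmulC a) -[RHS]cmulA; congr cmul.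
rewrite (cmulACA (ir g)) gg (_ : ir (0, 1, 0) = a) //.
move: (ir (pnum P, _, _)) => X; set R0 := ir r; set w := cmul V r'.
have kw : cmul (cmul a R0) w = (1, 0, 0) by rewrite /w cmulACA aV rr' cmul1.
rewrite -(cmulA X) (cmulA a X) (cmulC a X) -(cmulA X).
rewrite (cmulA a (cmul a _)) (cmulA a a) (cmulACA a a) cmulACA kw.
by rewrite cmul1 cmulC cmul1.
Qed.

Lemma dbl_genG : pt_opt (genG + genG) = Some (2, -3).
Proof.
have := @add_tangent genG 1 1 (erefl _); cbv zeta => ->.
by congr (Some (_, _)); field.
Qed.

Lemma small_height_point (P : curve_point) x y : pt_opt P = Some (x, y) -> height P < 10 ->
  exists n : int, P = genG *~ n.
Proof.
move=> eP hP; have P0 : P != 0 by apply/ept_affP; exists x, y.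
have [b [e cop b0 xE _]] := aff_coords eP.
have d0 := rden_gt0 P0; have a0 := pnum_gt0 P.
have dn : (rden P)%:~R != 0 :> rat by rewrite intr_eq0 gt_eqF.
have ha : pnum P < 10 by move: hP; rewrite /height; lia.
have hd : rden P < 4.
  have : rden P ^+ 2 < 10 by rewrite -rden_sqr; move: hP; rewrite /height; lia.
  by rewrite ltNge => h; rewrite ltNge; apply: contra h => h; nia.
have [A eA] : exists A : nat, pnum P = A by exists `|pnum P|%N; lia.
have [D eD] : exists D : nat, rden P = D by exists `|rden P|%N; lia.
have eN : (`|b| ^ 2 + D ^ 6 = A ^ 3 + A * D ^ 4)%N.
  have : (`|b|%N : int) ^+ 2 = b ^+ 2 by rewrite abszE real_normK ?num_real.
  by rewrite e eA eD; move: (`|b|%N) => B; clear; lia.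
have PX : (D ^ 2)%N = (D : int) ^+ 2 :> int by clear; lia.
have kind k yk (Q : curve_point) : pt_opt Q = Some (k, yk) -> x = k -> P = Q \/ P = - Q.
  by move=> eQ ek; rewrite ek in eP; apply: same_abscissa eP eQ.
have := small_height_search (b := `|b|%N) (a := A) (d := D).
case=> //; try lia.
- move=> h; have x1 : x = 1.
    rewrite xE eA eD h; rewrite eD in dn.
    by rewrite PX rmorphXn /= mulfV // expf_neq0.
  case: (kind _ _ _ (erefl : pt_opt genG = Some (1, 1)) x1) => ->.
    by exists 1.
  by exists (-1); rewrite mulrN1z.
move=> h; have x2 : x = 2.
  rewrite xE eA eD h; rewrite eD in dn.
  by rewrite PoszM rmorphM /= PX rmorphXn /= mulfK // expf_neq0.
case: (kind _ _ _ dbl_genG x2) => ->; first by exists 2.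
by exists (- 2); rewrite mulrNz.
Qed.

Lemma descent_step (R : realType) (P : curve_point) x y : pt_opt P = Some (x, y) ->
  10 <= height P ->
  (exists n : int, P = genG *~ n) \/
  exists Q, height Q < height P /\ exists k : int, P = Q + Q + genG *~ k.
Proof.
move=> eP hP; have [q [qq|qq]] := abscissa_class R eP.
  have [Q PQ] := halve eP qq; right; exists Q; split; last by exists 0; rewrite addr0.
  by apply: (@height_ge10_lt P Q 248) => //; rewrite PQ; apply: height_double.
have [x1|x1] := eqVneq x 1.
  rewrite x1 in eP; left.
  case: (same_abscissa eP (erefl : pt_opt genG = Some (1, 1))) => ->.
    by exists 1.
  by exists (-1); rewrite mulrN1z.
right.
have step (T : curve_point) y' k : pt_opt T = Some (1, y') -> T = genG *~ k ->
    height (P + T) <= 3 * height P ->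
    exists Q, height Q < height P /\ exists k : int, P = Q + Q + genG *~ k.
  move=> eT Tk hT; have [Q PQ] := chord_square eP eT x1 qq.
  exists Q; split; last by exists (- k); rewrite -PQ mulrNz -Tk addrK.
  apply: (@height_ge10_lt P Q 744) => //.
  by have := height_double Q; rewrite -PQ; lia.
have := height_addG P.
have [h1|h1] := leP (height (P + genG)) (3 * height P).
  by move=> _; apply: (step genG 1 1).
have [h2|h2] := leP (height (P - genG)) (3 * height P).
  by move=> _; apply: (step (- genG) (-1) (-1)); rewrite ?mulrN1z.
(* If both heights exceeded three times that of P, their product would exceed the bound with
   constant 8. *)
by have := height_ge1 P; clear -h1 h2; nia.
Qed.

Lemma mordell_weil (R : realType) (P : curve_point) : exists n : int, P = genG *~ n.
Proof.
have [m] := ubnP `|height P|%N; elim: m P => // m IH P hm.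
have [->|/ept_affP [x [y eP]]] := eqVneq P 0; first by exists 0.
have [h|h] := ltP (height P) 10; first exact: small_height_point eP h.
have [//|[Q [QP [k ->]]]] := descent_step R eP h.
have [|n ->] := IH Q; first by have := height_ge1 Q; lia.
by exists (n + n + k); rewrite !mulrzDr.
Qed.

(** * Heights of multiples *)

Lemma dvdz_denq (x : rat) (p q : int) : coprimez q p -> x * q%:~R = p%:~R ->
  (q %| denq x)%Z.
Proof.
move=> c e; rewrite -(@Gauss_dvdzr _ p) //.
rewrite (_ : p * denq x = numq x * q) ?dvdz_mull //.
apply/eqP; rewrite -(eqr_int rat) !intrM -e; apply/eqP.
by rewrite numqR; ring.
Qed.

Definition almost_quadratic (R : realType) (C : R) (h : int -> R) : Prop :=
  forall m n, `|h (m + n) + h (m - n) - 2 * h m - 2 * h n| <= C.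

(** The error E vanishes at 0 and 1 and its second differences are bounded by C. Summing twice costs
    a factor k^2, and the induction carries E together with its first difference. *)
Lemma almost_quadratic_mul (R : realType) (C : R) h (n : int) (k : nat) :
  almost_quadratic C h -> h 0 = 0 ->
  `|h (n * k%:Z) - k%:R ^+ 2 * h n| <= C * k%:R ^+ 2.
Proof.
move=> hq h0; have C0 : 0 <= C := le_trans (normr_ge0 _) (hq 0 0).
pose E (k : nat) := h (n * k%:Z) - k%:R ^+ 2 * h n.
rewrite -/(E k); suff [] : `|E k| <= C * k%:R ^+ 2 /\ `|E k.+1 - E k| <= C * k%:R by [].
elim: k => [|k [IH1 IH2]].
  have e0 : E 0 = 0 by rewrite /E mulr0 h0 expr0n /= mul0r subrr.
  have e1 : E 1 = 0 by rewrite /E mulr1 expr1n mul1r subrr.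
  by rewrite e0 e1 subrr normr0 expr0n /= mulr0.
split.
  have -> : E k.+1 = E k + (E k.+1 - E k) by ring.
  apply: le_trans (ler_normD _ _) _; apply: le_trans (lerD IH1 IH2) _.
  have : 0 <= k%:R :> R by [].
  by rewrite -natr1; nra.
have -> : E k.+2 - E k.+1 = (E k.+1 - E k) +
    (h (n * k.+1%:Z + n) + h (n * k.+1%:Z - n) - 2 * h (n * k.+1%:Z) - 2 * h n).
  rewrite /E (_ : n * k.+1%:Z + n = n * k.+2%:Z); last by lia.
  rewrite (_ : n * k.+1%:Z - n = n * k%:Z); last by lia.
  by rewrite -!natr1; ring.
apply: le_trans (ler_normD _ _) _; apply: le_trans (lerD IH2 (hq _ _)) _.
by rewrite -natr1; lra.
Qed.

(** Both sides are compared with h(m n), which takes the place of a canonical height. *)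
Lemma almost_quadratic_cmp (R : realType) (C : R) h (m n : nat) :
  almost_quadratic C h -> h 0 = 0 ->
  m%:R ^+ 2 * h n%:Z <= n%:R ^+ 2 * h m%:Z + C * (m%:R ^+ 2 + n%:R ^+ 2).
Proof.
move=> hq h0; have := almost_quadratic_mul n%:Z m hq h0.
have := almost_quadratic_mul m%:Z n hq h0; rewrite (mulrC n%:Z).
by rewrite !ler_norml => /andP[_ h1] /andP[h2 _]; lra.
Qed.

Definition mulG (n : int) : curve_point := genG *~ n.

Lemma mulGD m n : mulG (m + n) = mulG m + mulG n.
Proof. exact: mulrzDr. Qed.

Lemma mulGN n : mulG (- n) = - mulG n.
Proof. exact: mulrNz. Qed.

Lemma mulGB m n : mulG (m - n) = mulG m - mulG n.
Proof. by rewrite mulGD mulGN. Qed.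

Lemma mulG_double (k n : int) : n = k + k -> mulG n = mulG k + mulG k.
Proof. by move=> ->; exact: mulGD. Qed.

Lemma ln_add_lt (R : realType) (a b c : R) : 0 < a -> 0 < b -> a * b < c ->
  ln a + ln b < ln c.
Proof.
move=> a0 b0 abc; rewrite -lnM ?posrE // ltr_ln ?posrE ?mulr_gt0 //.
exact: lt_trans (mulr_gt0 a0 b0) abc.
Qed.

Section LogHeight.
Variable R : realType.

Definition loght (n : int) : R := ln (height (mulG n))%:~R.

Let hpos n : 0 < (height (mulG n))%:~R :> R.
Proof. by rewrite ltr0z; have := height_ge1 (mulG n); lia. Qed.

Lemma loght_ge0 n : 0 <= loght n.
Proof. by apply: ln_ge0; rewrite (ler_int R 1) height_ge1. Qed.

Lemma loght0 : loght 0 = 0.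
Proof. by rewrite /loght /height /=; exact: ln1. Qed.

Lemma loghtN n : loght (- n) = loght n.
Proof. by rewrite /loght mulGN heightN. Qed.

Lemma loght_upper m n :
  loght (m + n) + loght (m - n) <= 2 * loght m + 2 * loght n + ln 12.
Proof.
rewrite /loght -lnM ?posrE //.
have -> : 2 * ln (height (mulG m))%:~R + 2 * ln (height (mulG n))%:~R + ln 12 =
    ln (12 * ((height (mulG m))%:~R * (height (mulG n))%:~R) ^+ 2) :> R.
  rewrite lnM ?posrE ?exprn_gt0 ?mulr_gt0 // lnXn ?mulr_gt0 // lnM ?posrE //.
  by rewrite -mulr_natl; ring.
rewrite ler_ln ?posrE ?mulr_gt0 ?exprn_gt0 ?mulr_gt0 //.
have h := height_add_sub (mulG m) (mulG n).
rewrite -mulGD -mulGB -(ler_int R) in h.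
by apply: le_trans (le_trans _ h) _; rewrite le_eqVlt; apply/orP; left; apply/eqP; ring.
Qed.

Lemma loght_double n : 4 * loght n - ln 248 <= loght (n + n).
Proof.
have p248 : 0 < 248 :> R by rewrite ltr0n.
have [h1 h2] := (hpos n, hpos (n + n)).
rewrite lerBlDl /loght -lnM ?posrE ?p248 ?h2 //.
rewrite (_ : 4 * _ = ln ((height (mulG n))%:~R ^+ 4)); last first.
  by rewrite lnXn // mulr_natl.
rewrite ler_ln ?posrE ?(mulr_gt0 p248 h2) ?(exprn_gt0 _ h1) //.
have h := height_double (mulG n); rewrite -mulGD -(ler_int R) in h.
by apply: le_trans (le_trans _ h) _; rewrite le_eqVlt; apply/orP; left; apply/eqP; ring.
Qed.

Definition par_const : R := ln 12 + ln 248.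

(** The lower bound is the upper one applied to m + n and m - n, whose sum and difference are 2 m
    and 2 n, combined with the estimate for doubling. *)
Lemma loght_almost_quadratic : almost_quadratic par_const loght.
Proof.
move=> m n; have l12 : 0 <= ln 12 :> R by apply: ln_ge0; lra.
have l248 : 0 <= ln 248 :> R by apply: ln_ge0; lra.
have h1 := loght_upper m n; have h2 := loght_upper (m + n) (m - n).
have h3 := loght_double m; have h4 := loght_double n.
move: h2; rewrite (_ : m + n + (m - n) = m + m); last by ring.
rewrite (_ : m + n - (m - n) = n + n); last by ring.
by move=> h2; rewrite ler_norml /par_const; apply/andP; split; lra.
Qed.

Lemma loght_cmp (m n : nat) : m%:R ^+ 2 * loght n <= n%:R ^+ 2 * loght m +
  par_const * (m%:R ^+ 2 + n%:R ^+ 2).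
Proof. exact: almost_quadratic_cmp loght_almost_quadratic loght0. Qed.

Lemma height_4G : 36 <= height (mulG 4).
Proof.
have e : pt_opt (mulG 4) = pt_opt (genG + genG + (genG + genG)).
  by rewrite (@mulG_double 2 4 erefl) (@mulG_double 1 2 erefl).
have := add_tangent dbl_genG; cbv zeta; rewrite -e => e4.
move: e4; set x := _ - 2; set y := _ - -3 => e4.
have ex : x * 36 = 25 by rewrite /x; field.
have := dvdz_denq (isT : coprimez 36 25) ex.
move=> /(dvdz_le (denq_gt0 x)) h; rewrite /height (pden_aff e4).
by clear -h; lia.
Qed.

(** 2977 = 12 * 248 + 1 is the first integer whose logarithm exceeds [par_const]: at 8 G the height
    outweighs the error term. *)
Lemma height_8G : 2977 <= height (mulG 8).
Proof.
have h := height_double (mulG 4); rewrite -(@mulG_double 4 8 erefl) in h.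
have key (u v : int) : 36 <= u -> u ^+ 4 <= 248 * v -> 2977 <= v.
  move=> u36; rewrite (_ : u ^+ 4 = (u * u) * (u * u)); last by ring.
  have : 1000 <= u * u by nia.
  by move: (u * u); clear; nia.
exact: (key _ _ height_4G h).
Qed.

Lemma loght_8G : par_const < loght 8.
Proof.
have p12 : 0 < 12 :> R by rewrite ltr0n. have p248 : 0 < 248 :> R by rewrite ltr0n.
have h8 := height_8G; rewrite -(ler_int R) in h8.
apply: (ln_add_lt p12 p248); apply: lt_le_trans h8.
rewrite (_ : 2977%:~R = 12 * 248 + 1); last by ring.
by rewrite ltrDl.
Qed.

(** With k = |n|, comparing n with 8 gives k^2 (h(8) - C) <= 64 (h(n) + C), and h(8) - C is
    positive. *)
Lemma loght_unbounded (B : R) :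
  exists N : nat, forall n : int, (N <= `|n|)%N -> B <= loght n.
Proof.
have d0 : 0 < loght 8 - par_const by rewrite subr_gt0 loght_8G.
have c0 : 0 <= par_const := le_trans (normr_ge0 _) (loght_almost_quadratic 0 0).
pose X := (64 * `|B| + 64 * par_const) / (loght 8 - par_const).
have X0 : 0 <= X.
  by apply: divr_ge0; [apply: addr_ge0; apply: mulr_ge0|exact: ltW].
exists (Num.bound X).+1 => n hn.
have := loght_cmp `|n|%N 8; move: (loght 8%N) d0 @X X0 hn => l8 d0 X X0 hn.
have -> : loght `|n|%N = loght n.
  by case: (leP 0 n) => ?; [rewrite gez0_abs|rewrite ltz0_abs // loghtN].
set k : R := (`|n|%N)%:R => h.
have kX : X <= k.
  apply: ltW; apply: lt_le_trans (archi_boundP X0) _; rewrite ler_nat.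
  exact: ltnW.
have k1 : 1 <= k by rewrite /k (ler_nat R 1); lia.
have kk : k <= k ^+ 2 by rewrite expr2 -{1}(mulr1 k) ler_wpM2l // (le_trans ler01).
have : X * (l8 - par_const) <= k ^+ 2 * (l8 - par_const).
  by rewrite ler_pM2r //; exact: le_trans kX kk.
rewrite /X divfK ?gt_eqF //.
have := ler_norm B; move: h; lra.
Qed.

End LogHeight.

(** If n G were zero, arbitrarily large indices would give the point at infinity, of logarithmic
    height 0. *)
Lemma mulG_neq0 (R : realType) n : n != 0 -> mulG n != 0.
Proof.
move=> n0; apply/eqP => e; have [N hN] := loght_unbounded (1 : R).
have e2 : mulG (n * N%:Z) = 0 by rewrite /mulG mulrzA -/(mulG n) e mul0rz.
have := hN (n * N%:Z); rewrite /loght e2 -/(mulG 0) -/(loght R 0) loght0 => h.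
have : (1 : R) <= 0 by apply: h; rewrite abszM absz_nat leq_pmull // absz_gt0.
by rewrite ler10.
Qed.

(** * Linear relations between ninth powers *)

Lemma coprimez_inv (b d : int) (n : nat) : coprimez b d ->
  exists u v, u * b ^+ n = 1 + v * d.
Proof.
move=> c; have /coprimezP [[u v] /= e] := coprimezXl n c.
by exists u, (- v); rewrite -e; ring.
Qed.

(** Turns a congruence modulo d into a divisibility by a power of d: y will be a multiple of d, and
    x a multiple of the quantity already known to be divisible. *)
Lemma dvdz_add_pow (m x y z w : int) (n : nat) : z = x + y -> (m %| x * w)%Z ->
  (m %| y ^+ n * w)%Z -> (m %| z ^+ n * w)%Z.
Proof.
move=> -> mx my; rewrite -[(x + y) ^+ n](subrK (y ^+ n)) mulrDl rpredD //.
by rewrite subrXX addrK mulrAC dvdz_mulr.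
Qed.

(* [cp] and [cm] are the total coefficients of the terms of index N and -N, so
   the hypothesis says that the N-part of the relation has a denominator
   dividing [L ^+ 27]. *)
Lemma collision_dvd (a b d L cp cm : int) :
  coprimez a d -> coprimez b d -> d != 0 -> (cp != 0) || (cm != 0) ->
  `|cp| <= 8 -> `|cm| <= 8 ->
  (d ^+ 27 %| (cp * (a * d + b) ^+ 9 + cm * (a * d - b) ^+ 9) * L ^+ 27)%Z ->
  exists K : int, [/\ K != 0, `|K| <= 144 & (d ^+ 26 %| K ^+ 26 * L ^+ 27)%Z].
Proof.
move=> cad cbd d0 cn0 hcp hcm.
(* For equal coefficients the odd powers of b cancel and a * d factors out: one power of d is lost,
   and modulo d the cofactor is 18 cp b^8. *)
have [ecm|nz] := eqVneq cp cm.
  have c0 : cp != 0 by move: cn0; rewrite -ecm orbb.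
  pose Z := 84 * b ^+ 6 * a ^+ 2 * d + 126 * b ^+ 4 * a ^+ 4 * d ^+ 3 +
    36 * b ^+ 2 * a ^+ 6 * d ^+ 5 + a ^+ 8 * d ^+ 7.
  rewrite -ecm (_ : _ * L ^+ 27 =
      (2 * cp * (9 * b ^+ 8 + Z * d) * L ^+ 27) * a * d); last by rewrite /Z; ring.
  rewrite (exprSr d 26) dvdz_mul2r //.
  have c26 : coprimez (d ^+ 26) a by apply: coprimezXl; rewrite coprimez_sym.
  rewrite Gauss_dvdzl // => h.
  have [u [v uv]] := coprimez_inv 8 cbd.
  exists (18 * cp); split; first by rewrite mulf_neq0.
    by clear -hcp; lia.
  apply: (@dvdz_add_pow _ (2 * cp * (9 * b ^+ 8 + Z * d) * u)
     (- (2 * cp * (Z * u + 9 * v)) * d)).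
  - transitivity (18 * cp * (u * b ^+ 8) - 18 * cp * v * d); last by ring.
    by rewrite uv; ring.
  - by rewrite mulrAC dvdz_mulr.
  by rewrite exprMn mulrAC dvdz_mull.
(* For distinct coefficients only (cp - cm) b^9 remains modulo d and no power is lost; the exponent
   is lowered to 26 at the end to match the other case. *)
move=> h; exists (cp - cm); split; first by rewrite subr_eq0.
  by clear -hcp hcm; lia.
have [u [v uv]] := coprimez_inv 9 cbd.
pose W := cp * (a * d + b) ^+ 9 + cm * (a * d - b) ^+ 9.
have [z ez] : exists z, W = (cp - cm) * b ^+ 9 + z * d.
  exists ((cp + cm) * (9 * b ^+ 8 * a + 84 * b ^+ 6 * a ^+ 3 * d ^+ 2 +
      126 * b ^+ 4 * a ^+ 5 * d ^+ 4 + 36 * b ^+ 2 * a ^+ 7 * d ^+ 6 + a ^+ 9 * d ^+ 8) +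
    (cp - cm) * (36 * b ^+ 7 * a ^+ 2 * d + 126 * b ^+ 5 * a ^+ 4 * d ^+ 3 +
      84 * b ^+ 3 * a ^+ 6 * d ^+ 5 + 9 * b * a ^+ 8 * d ^+ 7)).
  by rewrite /W; ring.
have h27 : (d ^+ 27 %| (cp - cm) ^+ 27 * L ^+ 27)%Z.
  apply: (@dvdz_add_pow _ (W * u) (- (z * u + (cp - cm) * v) * d)).
  - rewrite ez; transitivity ((cp - cm) * (u * b ^+ 9) - (cp - cm) * v * d); last by ring.
    by rewrite uv; ring.
  - by rewrite mulrAC dvdz_mulr.
  by rewrite exprMn mulrAC dvdz_mull.
rewrite -exprMn !dvdzE !abszX dvdn_pexp2r // -!dvdzE in h27.
rewrite (exprS L) (mulrCA _ L) -exprMn dvdz_mull //.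
by rewrite !dvdzE !abszX dvdn_pexp2r.
Qed.

(** Once d and L are divided by their gcd they are coprime, so apart from K only the gcd can absorb
    powers of d. *)
Lemma dvd_pow_gcd (d K L : nat) : (0 < d)%N -> (d ^ 26 %| K ^ 26 * L ^ 27)%N ->
  (d ^ 26 %| K ^ 26 * gcdn d L ^ 27)%N.
Proof.
move=> d0 h; move eM: (gcdn d L) => M.
have M0 : (0 < M)%N by rewrite -eM gcdn_gt0 d0.
have [d' ed] := dvdnP (dvdn_gcdl d L); have [L' eL] := dvdnP (dvdn_gcdr d L).
rewrite eM in ed eL.
have cop : coprime d' L'.
  have : gcdn (d' * M) (L' * M) = M by rewrite -ed -eL.
  by rewrite -muln_gcdl -{2}(mul1n M) => /eqP; rewrite eqn_pmul2r.
move: h; rewrite ed eL; move: M M0 d' L' cop {eM ed eL d0 d L} => M M0 d L cop.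
rewrite !expnMn (_ : (K ^ 26 * (L ^ 27 * M ^ 27) = L ^ 27 * (K ^ 26 * M) * M ^ 26)%N).
  rewrite dvdn_pmul2r ?expn_gt0 ?M0 // Gauss_dvdr ?coprimeXl ?coprimeXr // => h.
  by rewrite (expnS M 26) mulnA dvdn_mul.
by rewrite (expnS M 26); ring.
Qed.

Lemma gcdn_lcmr (d a b : nat) : gcdn d (lcmn a b) = lcmn (gcdn d a) (gcdn d b).
Proof. exact: (@Order.DistrLatticeTheory.meetUr _ natdvd d a b). Qed.

Lemma gcdn_biglcm_dvd (I : finType) (P : pred I) (f : I -> nat) (d M : nat) :
  (forall i, P i -> gcdn d (f i) %| M)%N ->
  (gcdn d (\big[lcmn/1%N]_(i | P i) f i) %| M)%N.
Proof.
move=> h; elim/big_rec: _ => [|i x Pi hx]; first by rewrite gcdn1 dvd1n.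
by rewrite gcdn_lcmr dvdn_lcm h.
Qed.

Lemma gcdnM_dvd (d a b : nat) : (gcdn d (a * b) %| gcdn d a * gcdn d b)%N.
Proof.
rewrite muln_gcdr dvdn_gcd dvdn_mull ?dvdn_gcdl //=.
by rewrite muln_gcdl dvdn_gcd dvdn_gcdr andbT dvdn_mulr ?dvdn_gcdl.
Qed.

Lemma gcdn_prod_dvd (I : finType) (P : pred I) (f : I -> nat) (d : nat) :
  (gcdn d (\prod_(i | P i) f i) %| \prod_(i | P i) gcdn d (f i))%N.
Proof.
elim/big_rec2: _ => [|i x y Pi hx]; first by rewrite gcdn1.
by apply: dvdn_trans (gcdnM_dvd _ _ _) _; rewrite dvdn_mul.
Qed.

Definition absum (P : curve_point) : rat := if pt_opt P is Some (x, y) then x + y else 0.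

Lemma absum_coords (P : curve_point) : P != 0 -> exists b : int,
  [/\ coprimez b (rden P),
    absum P = (pnum P * rden P + b)%:~R / (rden P)%:~R ^+ 3 &
    absum (- P) = (pnum P * rden P - b)%:~R / (rden P)%:~R ^+ 3].
Proof.
move=> P0; have /ept_affP [x [y eP]] := P0.
have [b [e c b0 ex ey]] := aff_coords eP; exists b.
have dn : (rden P)%:~R != 0 :> rat by rewrite intr_eq0 gt_eqF ?rden_gt0.
rewrite /absum (opp_aff eP) eP ex ey; split; [|by field|by field].
suff : coprimez (b ^+ 2) (rden P) by rewrite coprimez_pexpl.
rewrite e coprimez_sym.
rewrite (_ : _ - _ = (pnum P * rden P ^+ 3 - rden P ^+ 5) * rden P + pnum P ^+ 3).
  by rewrite /coprimez gcdzMDl; apply: coprimezXr; rewrite coprimez_sym.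
by ring.
Qed.

Lemma coprime_pnum_rden P : coprimez (pnum P) (rden P).
Proof.
have := coprime_pnum_pden P; rewrite rden_sqr => h.
by apply: coprimez_dvdr h; rewrite -dvdzE expr2 dvdz_mulr.
Qed.

Lemma absum_pow_int (P : curve_point) (L : int) : P != 0 -> (rden P %| L)%Z ->
  L%:~R ^+ 27 * absum P ^+ 9 \is a Num.int.
Proof.
move=> P0 /dvdzP[q ->]; have [b [_ -> _]] := absum_coords P0.
have dn : (rden P)%:~R != 0 :> rat by rewrite intr_eq0 gt_eqF ?rden_gt0.
rewrite (_ : _ * _ = (q ^+ 27 * (pnum P * rden P + b) ^+ 9)%:~R); last by field.
exact: intr_int.
Qed.

(** * The denominator of the term of largest index *)

Section Collision.
Variables (R : realType) (I : finType) (c k : I -> int) (N : nat).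
Hypothesis k_neq0 : forall i, k i != 0.
Hypothesis k_le : forall i, (`|k i| <= N)%N.
Hypothesis N_gt0 : (0 < N)%N.
Hypothesis relation : \sum_i (c i)%:~R * absum (mulG (k i)) ^+ 9 = 0.

Definition cplus : int := \sum_(i | k i == N) c i.
Definition cminus : int := \sum_(i | k i == - N%:Z) c i.
Definition lower i := (`|k i| < N)%N.
Definition half i := (2 * gcdn N `|k i| == N)%N.
Definition rdenn i : nat := `|rden (mulG (k i))|%N.

(** Terms whose index has gcd N / 2 with N all share with the denominator of N G a divisor of the
    denominator at N / 2, so an lcm counts this contribution once. The other gcds are at most N / 3,
    small enough for a plain product. *)
Definition common_den : nat := (\big[lcmn/1]_(i | lower i && half i) rdenn i *
  \prod_(i | lower i && ~~ half i) rdenn i)%N.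

Lemma relation_split :
  cplus%:~R * absum (mulG N) ^+ 9 + cminus%:~R * absum (mulG (- N%:Z)) ^+ 9 =
  - \sum_(i | lower i) (c i)%:~R * absum (mulG (k i)) ^+ 9.
Proof.
apply/eqP; rewrite -addr_eq0; apply/eqP; rewrite -[RHS]relation.
rewrite [RHS](bigID (fun i => k i == N)) /= -addrA; congr (_ + _).
  by rewrite /cplus rmorph_sum mulr_suml; apply: eq_bigr => i /eqP ->.
rewrite [RHS](bigID (fun i => k i == - N%:Z)) /=; congr (_ + _).
  rewrite /cminus rmorph_sum mulr_suml; apply: eq_big => i.
    by case: eqP => [->|]; rewrite ?andbF // andbT; move: N_gt0; lia.
  by move=> /eqP ->.
by apply: eq_bigl => i; rewrite /lower; have := k_le i; move: (k i) N_gt0; lia.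
Qed.

Lemma rdenn_common_den i : lower i -> (rdenn i %| common_den)%N.
Proof.
move=> li; rewrite /common_den; have [hi|hi] := boolP (half i).
  by rewrite dvdn_mulr // (biglcmn_sup i) // li.
by rewrite dvdn_mull // (bigD1 i) ?li //= dvdn_mulr.
Qed.

Lemma collision_den : (forall i, `|c i| <= 2) -> (#|I| <= 4)%N ->
  (cplus != 0) || (cminus != 0) ->
  exists K : nat, [/\ (0 < K)%N, (K <= 144)%N &
    (`|rden (mulG N)| ^ 26 %| K ^ 26 * common_den ^ 27)%N].
Proof.
move=> hc hI nz.
have bnd (p : pred I) : `|\sum_(i | p i) c i| <= 8.
  apply: le_trans (ler_norm_sum _ _ _) _.
  apply: (@le_trans _ _ (\sum_(i | p i) 2)); first exact: ler_sum.
  rewrite big_const iter_addr addr0; have := max_card p; lia.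
have N0 : mulG N != 0 by apply: (mulG_neq0 R); lia.
have [b [cb e1 e2]] := absum_coords N0.
have dn0 : rden (mulG N) != 0 by rewrite gt_eqF ?rden_gt0.
have dn : (rden (mulG N))%:~R != 0 :> rat by rewrite intr_eq0.
have : (rden (mulG N) ^+ 27 %| (cplus * (pnum (mulG N) * rden (mulG N) + b) ^+ 9 +
    cminus * (pnum (mulG N) * rden (mulG N) - b) ^+ 9) * (common_den : int) ^+ 27)%Z.
  have : (common_den : int)%:~R ^+ 27 *
      (\sum_(i | lower i) (c i)%:~R * absum (mulG (k i)) ^+ 9) \is a @Num.int rat.
    rewrite mulr_sumr rpred_sum // => i li; rewrite mulrCA rpredM ?intr_int //.
    apply: absum_pow_int; last by rewrite dvdzE rdenn_common_den.
    exact: mulG_neq0 R _ (k_neq0 i).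
  case/intrP => z ez; apply/dvdzP; exists (- z).
  have := relation_split; rewrite mulGN e1 e2 => es.
  apply/eqP; rewrite -(eqr_int rat); apply/eqP.
  transitivity ((rden (mulG N))%:~R ^+ 27 * ((common_den : int)%:~R ^+ 27 *
    - \sum_(i | lower i) (c i)%:~R * absum (mulG (k i)) ^+ 9)).
    by rewrite -es; field.
  by rewrite mulrN ez; ring.
case/(collision_dvd (coprime_pnum_rden _) cb dn0 nz (bnd _) (bnd _)) => K [K0 K1 h].
exists `|K|%N; split; [by rewrite absz_gt0|by lia|].
by move: h; rewrite dvdzE abszM !abszX.
Qed.
End Collision.

Lemma ln_prod_le (R : realType) (I : finType) (P : pred I) (f : I -> nat) (B : R) :
  (forall i, P i -> (0 < f i)%N /\ ln (f i)%:R <= B) -> 0 <= B -> (#|I| <= 4)%N ->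
  (0 < \prod_(i | P i) f i)%N /\ ln (\prod_(i | P i) f i)%:R <= 4 * B.
Proof.
move=> h B0 hI.
have [p0 hp] : (0 < \prod_(i | P i) f i)%N /\
    ln (\prod_(i | P i) f i)%:R <= \sum_(i | P i) B.
  elim/big_rec2: _ => [|i x y Pi [y0 hy]]; first by rewrite ln1.
  have [f0 hf] := h i Pi; rewrite muln_gt0 f0 y0; split=> //.
  by rewrite natrM lnM ?posrE ?ltr0n // lerD.
split=> //; apply: le_trans hp _; rewrite big_const iter_addr addr0 -[B *+ _]mulr_natl.
by rewrite ler_wpM2r // ler_nat (leq_trans (max_card _)).
Qed.

Section LogDen.
Variable R : realType.
Let h := loght R.
Let C := par_const R.

Lemma par_const_ge0 : 0 <= C.
Proof. exact: le_trans (normr_ge0 _) (loght_almost_quadratic R 0 0). Qed.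

Lemma loght_div (s g N : nat) : (0 < N)%N -> (0 < s)%N -> (s * g <= N)%N ->
  h g <= h N / s%:R ^+ 2 + 2 * C.
Proof.
move=> N0 s0 sg; have := loght_cmp R N g; rewrite -/h -/C => hc.
have Nr : 0 < N%:R :> R by rewrite ltr0n.
have sr : 0 < s%:R :> R by rewrite ltr0n.
have gs : g%:R <= N%:R / s%:R :> R by rewrite ler_pdivlMr // -natrM mulnC ler_nat.
have gs2 : g%:R ^+ 2 <= (N%:R / s%:R) ^+ 2 :> R.
  by rewrite ler_pXn2r ?nnegrE // divr_ge0.
have gN2 : g%:R ^+ 2 <= N%:R ^+ 2 :> R.
  by rewrite ler_pXn2r ?nnegrE // ler_nat (leq_trans _ sg) // leq_pmull.
have h0 : 0 <= h N := loght_ge0 R N; have C0 := par_const_ge0.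
rewrite -(ler_pM2l (exprn_gt0 2 Nr)); apply: le_trans hc _.
have : g%:R ^+ 2 * h N <= (N%:R / s%:R) ^+ 2 * h N by rewrite ler_wpM2r.
have : C * g%:R ^+ 2 <= C * N%:R ^+ 2 by rewrite ler_wpM2l.
rewrite (_ : N%:R ^+ 2 * (h N / s%:R ^+ 2 + 2 * C) =
  (N%:R / s%:R) ^+ 2 * h N + 2 * (C * N%:R ^+ 2)); last by field; rewrite gt_eqF.
by rewrite mulrDr; lra.
Qed.

Lemma ln_rden (n : int) : n != 0 -> ln (`|rden (mulG n)|%N)%:R <= h n / 2.
Proof.
move=> n0; have P0 := mulG_neq0 R n0; have d0 := rden_gt0 P0.
have dr : 0 < (`|rden (mulG n)|%N)%:R :> R by rewrite ltr0n absz_gt0 gt_eqF.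
rewrite ler_pdivlMr // mulr_natr -lnXn // ler_ln ?posrE ?exprn_gt0 //; last first.
  by rewrite ltr0z; have := height_ge1 (mulG n); lia.
rewrite -natrX (_ : _%:R = (pden (mulG n))%:~R).
  by rewrite ler_int /height le_max lexx orbT.
rewrite rden_sqr -[in RHS](gez0_abs (ltW d0)).
by rewrite rmorphXn /= natrX.
Qed.

Variables (I : finType) (c k : I -> int) (N : nat).
Hypothesis k_neq0 : forall i, k i != 0.
Hypothesis k_le : forall i, (`|k i| <= N)%N.
Hypothesis N_gt0 : (0 < N)%N.
Hypothesis relation : \sum_i (c i)%:~R * absum (mulG (k i)) ^+ 9 = 0.
Hypothesis c_le2 : forall i, `|c i| <= 2.
Hypothesis cardI : (#|I| <= 4)%N.
Hypothesis nontrivial : (cplus c k N != 0) || (cminus c k N != 0).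

Let d : nat := `|rden (mulG N)|%N.

Lemma gcdn_rdenn i : (gcdn d (rdenn k i) %| `|rden (mulG (gcdn N `|k i|)%N)|)%N.
Proof.
have := gcd_rden_dvd genG N (k i).
by rewrite /gcdz !dvdzE /= -/(mulG _) -/(mulG _).
Qed.

(** A proper divisor of N other than N / 2 is at most N / 3. *)
Lemma lower_gcd i : lower k N i -> ~~ half k N i -> (3 * gcdn N `|k i| <= N)%N.
Proof.
rewrite /lower /half => lt nh.
have kp : (0 < `|k i|)%N by rewrite absz_gt0.
have gk : (gcdn N `|k i| <= `|k i|)%N by rewrite dvdn_leq ?dvdn_gcdr.
have [q eq] := dvdnP (dvdn_gcdl N `|k i|).
have gN := leq_ltn_trans gk lt.
move: eq nh gN; move: (gcdn _ _) => g eq nh gN; rewrite eq leq_mul2r.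
have [q3|q3] := leqP 3 q; first by rewrite orbT.
have [g0|g0] := posnP g; first by [].

by move: eq nh gN; case: q q3 => [|[|[|q]]] // _; clear -g0; lia.
Qed.

(** The gcd M of d with the common denominator satisfies ln M <= (1/8 + 4/18) h(N) + 5 C. Here 1/8
    and 1/18 are halves of 1/2^2 and 1/3^2, as [rden] is the square root of a denominator. The final
    inequality is doubled. *)
Lemma log_den_bound :
  52 * ln d%:R <= 52 * ln 144 + 27 * (25 / 36 * h N + 10 * C).
Proof.
have Nz : (N : int) != 0 by lia.
have d0 : (0 < d)%N by rewrite absz_gt0 gt_eqF // rden_gt0 // (mulG_neq0 R Nz).
have [K [K0 K144 hK]] :=
  collision_den R k_neq0 k_le N_gt0 relation c_le2 cardI nontrivial.
have := dvd_pow_gcd d0 hK; set M := gcdn d _ => dM.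
have M0 : (0 < M)%N by rewrite gcdn_gt0 d0.
have C0 := par_const_ge0; have hN0 : 0 <= h N := loght_ge0 R N.
(* For odd N no gcd equals N / 2, and the lcm is empty. *)
pose Dh := if odd N then 1%N else `|rden (mulG N./2)|%N.
have Dh0 : (0 < Dh)%N.
  rewrite /Dh; case: ifP => // oN; rewrite absz_gt0 gt_eqF // rden_gt0 //.
  by apply: (mulG_neq0 R); move: N_gt0 oN; clear; lia.
have lnDh : ln Dh%:R <= h N / 8 + C.
  rewrite /Dh; case: ifP => oN.
    by rewrite ln1 addr_ge0 // divr_ge0.
  apply: le_trans (ln_rden _) _; first by move: N_gt0 oN; clear; lia.
  have := @loght_div 2 N./2 N N_gt0 isT; rewrite -/h => /(_ _)/le_trans hd.
  have : h N./2 <= h N / 2 ^+ 2 + 2 * C.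
    by apply: hd => //; move: N_gt0 oN; clear; lia.
  by lra.
pose f i := gcdn d (rdenn k i).
have fP i : lower k N i && ~~ half k N i -> (0 < f i)%N /\ ln (f i)%:R <= h N / 18 + C.
  case/andP=> li nhi; have f0 : (0 < f i)%N by rewrite gcdn_gt0 d0.
  split=> //; set g := gcdn N `|k i|.
  have g0 : (0 < g)%N by rewrite gcdn_gt0 N_gt0.
  have gz : (g : int) != 0 by lia.
  have rg : (0 < `|rden (mulG g)|)%N.
    by rewrite absz_gt0 gt_eqF // rden_gt0 // (mulG_neq0 R gz).
  apply: (@le_trans _ _ (ln (`|rden (mulG g)|%N)%:R)).
    by rewrite ler_ln ?posrE ?ltr0n // ler_nat dvdn_leq // gcdn_rdenn.
  apply: le_trans (ln_rden gz) _.
  have := @loght_div 3 g N N_gt0 isT (lower_gcd li nhi); rewrite -/h -/C.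
  by lra.
have [p0 hp] := ln_prod_le fP (addr_ge0 (divr_ge0 hN0 (ler0n _ 18)) C0) cardI.
have MD : (M %| Dh * \prod_(i | lower k N i && ~~ half k N i) f i)%N.
  apply: dvdn_trans (gcdnM_dvd _ _ _) _; apply: dvdn_mul; last exact: gcdn_prod_dvd.
  apply: gcdn_biglcm_dvd => i /andP[_ /eqP hi].
  apply: dvdn_trans (gcdn_rdenn i) _; rewrite /Dh.
  have [oN gN] : odd N = false /\ gcdn N `|k i| = N./2.
    by move: hi; move: (gcdn _ _) => g hi; clear -hi; lia.
  by rewrite oN gN.
have lnM' : ln M%:R <= h N / 8 + C + 4 * (h N / 18 + C).
  apply: (@le_trans _ _ (ln (Dh * \prod_(i | lower k N i && ~~ half k N i) f i)%N%:R)).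
    by rewrite ler_ln ?posrE ?ltr0n ?muln_gt0 ?Dh0 // ler_nat dvdn_leq // muln_gt0 Dh0.
  by rewrite natrM lnM ?posrE ?ltr0n // lerD.
have : 26 * ln d%:R <= 26 * ln K%:R + 27 * ln M%:R :> R.
  have dr : 0 < d%:R :> R by rewrite ltr0n.
  have Kr : 0 < K%:R :> R by rewrite ltr0n.
  have Mr : 0 < M%:R :> R by rewrite ltr0n.
  have le_pow : d%:R ^+ 26 <= K%:R ^+ 26 * M%:R ^+ 27 :> R.
    by rewrite -!natrX -natrM ler_nat dvdn_leq // muln_gt0 !expn_gt0 K0 M0.
  have e1 : ln (d%:R ^+ 26) = 26 * ln d%:R :> R by rewrite (lnXn 26 dr) mulr_natl.
  have e2 : ln (K%:R ^+ 26 * M%:R ^+ 27) = 26 * ln K%:R + 27 * ln M%:R :> R.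
    by rewrite lnM ?posrE ?exprn_gt0 // (lnXn 26 Kr) (lnXn 27 Mr) !mulr_natl.
  by rewrite -e1 -e2 ler_ln ?posrE ?mulr_gt0 ?exprn_gt0.
have : ln K%:R <= ln 144 :> R by rewrite ler_ln ?posrE ?ltr0n // (ler_nat R _ 144).
by move: lnM'; lra.
Qed.
End LogDen.

(** * The size of the abscissa of the term of largest index *)

Definition absc (P : curve_point) : rat := if pt_opt P is Some (x, y) then x else 0.

Lemma abscN P : absc (- P) = absc P.
Proof. by rewrite /absc /=; case: (pt_opt P) => [[]|]. Qed.

(** In the application a and b are the abscissas of P and Q, and t is that of P - Q; the hypothesis
    says that x(P + Q) x(P - Q) is at most t times the sum of these two. The estimates give (9/16) a
    <= 5 t, and 80/9 < 9. *)
Lemma min_bound (F : realFieldType) (a b t : F) : 2 <= a -> a <= b ->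
  (a * b - 1) ^+ 2 + 4 * (a + b) <= t * (2 * ((a * b + 1) * (a + b) - 2)) ->
  a <= 9 * t.
Proof.
move=> a2 ab key.
have a0 : 0 < a by lra. have b0 : 0 < b by lra.
have p4 : 2 * 2 <= a * b by apply: ler_pM => //; lra.
have p0 : 0 < a * b by rewrite mulr_gt0.
rewrite leNgt; apply/negP => ta.
have h5 : (3 / 4 * (a * b)) ^+ 2 <= (a * b - 1) ^+ 2.
  by rewrite ler_pXn2r ?nnegrE //; lra.
have t0 : 0 < t.
  rewrite ltNge; apply/negP => t0; move: key; apply/negP; rewrite -ltNge.
  apply: (@le_lt_trans _ _ 0).
    rewrite mulr_le0_ge0 // mulr_ge0 // subr_ge0.
    by apply: le_trans (_ : 1 * 2 <= _); [lra|apply: ler_pM => //; lra].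
  by have := sqr_ge0 (a * b - 1); lra.
have h3 : (a * b + 1) * (a + b) <= (5 / 4 * (a * b)) * (2 * b).
  by apply: ler_pM; lra.
have h4 : t * (2 * ((a * b + 1) * (a + b) - 2)) <= t * (5 * (a * b) * b).
  by rewrite ler_pM2l //; lra.
have h6 : (a * b) * b * (9 / 16 * a) <= (a * b) * b * (5 * t).
  by move: key h5 h4; lra.
by move: h6; rewrite ler_pM2l ?mulr_gt0 //; lra.
Qed.

(** Near infinity x^(-1/2) measures the distance to infinity in the group, so this is a form of the
    triangle inequality. It is obtained by bounding x(P - Q) below by the product over the sum of
    x(P + Q) and x(P - Q). *)
Lemma absc_sub (P Q : curve_point) : absc P != absc Q -> 2 <= absc P -> 2 <= absc Q ->
  Num.min (absc P) (absc Q) <= 9 * absc (P - Q).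
Proof.
move=> x12 h1 h2; move: x12 (h1) (h2); rewrite /absc.
case eP: (pt_opt P) => [[x1 y1]|]; last by rewrite /absc eP in h1.
case eQ: (pt_opt Q) => [[x2 y2]|]; last by rewrite /absc eQ in h2.
move=> x12 {}h1 {}h2; have [e1 e2] := (affP eP, affP eQ).
have e3 := add_chord eP eQ x12; have e4 := add_chord eP (opp_aff eQ) x12.
move: e3 e4; cbv zeta; set x3 := (X in Some (X, _)); move=> e3.
set x4 := (X in Some (X, _)); move=> e4; rewrite e4.
have d0 : x1 - x2 != 0 by rewrite subr_eq0.
have es : (x3 + x4) * (x1 - x2) ^+ 2 = 2 * ((x1 * x2 + 1) * (x1 + x2) - 2).
  by rewrite /x3 /x4; field: e1 e2.
have ep : (x3 * x4) * (x1 - x2) ^+ 2 = (x1 * x2 - 1) ^+ 2 + 4 * (x1 + x2).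
  by rewrite /x3 /x4; field: e1 e2.
have x3p := curve_x_gt0 (affP e3); have x4p := curve_x_gt0 (affP e4).
move: x3 x4 es ep x3p x4p {e3 e4} => x3 x4 es ep x3p x4p.
have d2 : 0 < (x1 - x2) ^+ 2 by rewrite exprn_even_gt0.
have key : (x1 * x2 - 1) ^+ 2 + 4 * (x1 + x2) <=
    x4 * (2 * ((x1 * x2 + 1) * (x1 + x2) - 2)).
  rewrite -es -ep (_ : x4 * _ = x3 * x4 * (x1 - x2) ^+ 2 + x4 ^+ 2 * (x1 - x2) ^+ 2).
    by rewrite lerDl mulr_ge0 ?sqr_ge0.
  by ring.
case: (leP x1 x2) => h; first exact: min_bound key.
apply: (min_bound h2 (ltW h)).
by move: key; rewrite (mulrC x2) (addrC x2).
Qed.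

(** Separating odd and even powers of y gives c1 - c2 times U, of order y^9, plus c1 + c2 times V,
    of order x y^8. When c1 = c2 only V survives, whence the exponent 13 = 1 + 8 * 3/2. *)
Lemma main_term_ge (F : realFieldType) (x y c1 c2 : F) :
  y ^+ 2 = x ^+ 3 + x - 1 -> 100 ^+ 4 <= x -> `|c1| <= 8 -> `|c2| <= 8 ->
  (1 <= `|c1 - c2|) \/ (c1 = c2 /\ 1 <= `|c1|) ->
  x ^+ 13 <= `|c1 * (x + y) ^+ 9 + c2 * (x - y) ^+ 9|.
Proof.
wlog y0 : y c1 c2 / 0 <= y => [hw|].
  have [y0|y0] := leP 0 y; first exact: hw.
  move=> ey hx h1 h2 h; rewrite addrC.
  have := hw (- y) c2 c1; rewrite opprK; apply; rewrite ?sqrrN ?oppr_ge0 ?(ltW y0) //.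
  by case: h => [h|[h h']]; [left; rewrite distrC|right; rewrite -h].
move=> ey hx h1 h2 h.
have x1 : 1 <= x by apply: le_trans hx; rewrite expr_ge1 // ler1n.
have x0 : 0 < x by apply: lt_le_trans x1.
have y2 : x ^+ 3 <= y ^+ 2 by rewrite ey; lra.
have yx : 100 ^+ 2 * x <= y.
  rewrite -(@ler_pXn2r _ 2) ?nnegrE //; last by rewrite mulr_ge0 ?exprn_ge0 ?(ltW x0).
  apply: le_trans y2; rewrite (_ : (100 ^+ 2 * x) ^+ 2 = 100 ^+ 4 * x ^+ 2); last by ring.
  by rewrite (exprS x 2) ler_wpM2r // sqr_ge0.
have xy : 5000 * x <= y.
  by apply: le_trans yx; rewrite ler_wpM2r ?(ltW x0) //; lra.
have y8 : x ^+ 12 <= y ^+ 8.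
  rewrite (_ : x ^+ 12 = (x ^+ 3) ^+ 4); last by ring.
  rewrite (_ : y ^+ 8 = (y ^+ 2) ^+ 4); last by ring.
  by rewrite ler_pXn2r ?nnegrE ?sqr_ge0 // exprn_ge0 // ltW.
have xyle : x <= y by lra.
have y80 : 0 <= y ^+ 8 by rewrite exprn_ge0.
pose U := y ^+ 9 + 36 * (y ^+ 7 * x ^+ 2) + 126 * (y ^+ 5 * x ^+ 4) +
  84 * (y ^+ 3 * x ^+ 6) + 9 * (y * x ^+ 8).
pose V := 9 * (x * y ^+ 8) + 84 * (x ^+ 3 * y ^+ 6) + 126 * (x ^+ 5 * y ^+ 4) +
  36 * (x ^+ 7 * y ^+ 2) + x ^+ 9.
have UV : c1 * (x + y) ^+ 9 + c2 * (x - y) ^+ 9 = (c1 - c2) * U + (c1 + c2) * V.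
  by rewrite /U /V; ring.
have pos i j : 0 <= x ^+ i * y ^+ j by rewrite mulr_ge0 // exprn_ge0 // ltW.
have V_ge : x * y ^+ 8 <= V / 9.
  by have := pos 3 6; have := pos 5 4; have := pos 7 2; have := pos 9 0;
    rewrite /V expr0 mulr1; lra.
have U_ge : y ^+ 9 <= U.
  by have := pos 2 7; have := pos 4 5; have := pos 6 3; have := pos 8 1;
    rewrite /U expr1 !(mulrC (y ^+ _) (x ^+ _)) (mulrC y (x ^+ _)); lra.
have mono i : (i.+1 <= 8)%N -> x ^+ (8 - i).+1 * y ^+ i <= x * y ^+ 8.
  move=> hi; rewrite exprS -mulrA ler_wpM2l ?(ltW x0) //.
  rewrite -{2}(subnK (ltnW hi)) exprD ler_wpM2r ?exprn_ge0 //.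
  by rewrite lerXn2r ?nnegrE ?(ltW x0).
have V_le : V <= 256 * (x * y ^+ 8).
  by have := mono 6 isT; have := mono 4 isT; have := mono 2 isT; have := mono 0 isT;
    rewrite /V expr0 mulr1; lra.
have x13 : x ^+ 13 <= x * y ^+ 8 by rewrite exprS ler_wpM2l // ltW.
apply: le_trans x13 _; rewrite UV; have V0 : 0 <= V by have := pos 1 8; rewrite expr1; lra.
case: h => [he|[<- hc]]; last first.
  rewrite subrr mul0r add0r normrM (ger0_norm V0) (_ : c1 + c1 = 2 * c1); last by ring.
  rewrite normrM (ger0_norm (ler0n _ 2)).
  apply: (@le_trans _ _ (1 * V)); first by have := pos 1 8; rewrite expr1; lra.
  by rewrite ler_wpM2r //; lra.
have U0 : 0 <= U by apply: le_trans U_ge; rewrite exprn_ge0.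
apply: le_trans (lerB_normD _ _); rewrite !normrM (ger0_norm U0) (ger0_norm V0).
have s16 : `|c1 + c2| <= 16 by apply: le_trans (ler_normD _ _) _; lra.
have hU : 1 * U <= `|c1 - c2| * U by rewrite ler_wpM2r.
have hV : `|c1 + c2| * V <= 16 * V by rewrite ler_wpM2r.
have y9 : 5000 * (x * y ^+ 8) <= y ^+ 9 by rewrite (exprS y 8) mulrA ler_wpM2r.
by have := pos 1 8; rewrite expr1; lra.
Qed.

Lemma absum_sqr_le (P : curve_point) :
  absum P ^+ 2 <= 6 * Num.max 1 (absc P) ^+ 3.
Proof.
rewrite /absum /absc; case eP: (pt_opt P) => [[x y]|]; last first.
  by rewrite expr0n mulr_ge0 // exprn_ge0 // le_max ler01.
have e := affP eP; have x0 := curve_x_gt0 e; move: e x0; clear.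
set M := Num.max 1 x => e x0.
have M1 : 1 <= M by rewrite le_max lexx.
have xM : x <= M by rewrite le_max lexx orbT.
have M0 : 0 <= M by lra.
have h0 : 0 <= (x - y) ^+ 2 := sqr_ge0 _.
have h1 : x ^+ 3 <= M ^+ 3 by rewrite ler_pXn2r ?nnegrE // ltW.
have h2 : x ^+ 2 <= M ^+ 2 by rewrite ler_pXn2r ?nnegrE // ltW.
have h3 : M ^+ 2 <= M ^+ 3 by rewrite (exprS M 2) ler_peMl // sqr_ge0.
have h4 : M <= M ^+ 2 by rewrite expr2 ler_peMl.
have -> : (x + y) ^+ 2 = 2 * x ^+ 2 + 2 * y ^+ 2 - (x - y) ^+ 2 by ring.
by rewrite e; lra.
Qed.

Lemma absc_neq (R : realType) (m n : int) : m != n -> m != - n ->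
  absc (mulG m) = absc (mulG n) -> m = 0 \/ n = 0.
Proof.
move=> mn mn'; have [->|m0] := eqVneq m 0; first by left.
have [->|n0] := eqVneq n 0; first by right.
have /ept_affP [x [y eP]] := mulG_neq0 R m0.
have /ept_affP [x' [y' eQ]] := mulG_neq0 R n0.
rewrite /absc eP eQ => xx'; rewrite -xx' in eQ.
have [e|e] := same_abscissa eP eQ.
  have := mulG_neq0 R (_ : m - n != 0); rewrite subr_eq0 mn mulGB e subrr eqxx.
  by move/(_ isT).
have := mulG_neq0 R (_ : m + n != 0); rewrite addr_eq0 mn' mulGD e addNr eqxx.
by move/(_ isT).
Qed.

(** Phrased with squares because x + y has the order of x^(3/2). *)
Lemma pow9_small (F : realFieldType) (A M X : F) : 0 <= X -> 0 <= M ->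
  A ^+ 2 <= 6 * M ^+ 3 -> 16 ^+ 2 * 6 ^+ 9 * M ^+ 27 <= X ^+ 26 ->
  `|A ^+ 9| <= X ^+ 13 / 16.
Proof.
move=> X0 M0 AM h; have p16 : 0 < 16 :> F by rewrite ltr0n.
have X13 : 0 <= X ^+ 13 by exact: exprn_ge0.
rewrite -(@ler_pXn2r _ 2) ?nnegrE ?normr_ge0 //; last by rewrite divr_ge0 // ltW.
rewrite real_normK ?num_real // -exprM (mulnC 9) exprM.
apply: (@le_trans _ _ ((6 * M ^+ 3) ^+ 9)).
  by rewrite ler_pXn2r ?nnegrE ?sqr_ge0 // mulr_ge0 // exprn_ge0.
rewrite exprMn_comm; last exact: mulrC.
rewrite -exprM expr_div_n -exprM ler_pdivlMr ?exprn_gt0 // mulrC mulrA.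
exact: h.
Qed.

Lemma norm_sum_le_half (F : realFieldType) (I : finType) (P : pred I) (c : I -> int)
    (A : I -> F) (t : F) : 0 <= t -> (forall i, `|c i| <= 2) -> (#|I| <= 4)%N ->
  (forall i, P i -> `|A i| <= t / 16) -> `|\sum_(i | P i) (c i)%:~R * A i| <= t / 2.
Proof.
move=> t0 hc hI hA; apply: le_trans (ler_norm_sum _ _ _) _.
apply: (@le_trans _ _ (\sum_(i | P i) t / 8)).
  apply: ler_sum => i Pi; rewrite normrM (_ : t / 8 = 2 * (t / 16)); last by field.
  by apply: ler_pM; rewrite ?normr_ge0 ?hA // -intr_norm (ler_int F _ 2).
rewrite big_const iter_addr addr0 -[_ *+ _]mulr_natl.
rewrite (_ : t / 2 = 4%:R * (t / 8)); last by field.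
by rewrite ler_wpM2r ?divr_ge0 // ler_nat (leq_trans (max_card _)).
Qed.

Lemma half_lt_self (F : realFieldType) (t u : F) : 0 < t -> t <= u -> u <= t / 2 -> False.
Proof. by lra. Qed.

Section LogAbsc.
Variables (R : realType) (I : finType) (c k : I -> int) (N : nat).
Hypothesis k_neq0 : forall i, k i != 0.
Hypothesis k_le : forall i, (`|k i| <= N)%N.
Hypothesis N_gt0 : (0 < N)%N.
Hypothesis relation : \sum_i (c i)%:~R * absum (mulG (k i)) ^+ 9 = 0.
Hypothesis c_le2 : forall i, `|c i| <= 2.
Hypothesis cardI : (#|I| <= 4)%N.
Hypothesis nontrivial : (cplus c k N != 0) || (cminus c k N != 0).

Let X := absc (mulG N).

(** Otherwise every lower term is at most x^13 / 16, and four of them with coefficients at most 2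
    add up to at most x^13 / 2, below the main term. [K] is known only through its products, so that
    the numeral 16^2 * 6^9 stays folded. *)
Lemma large_lower_term (K : rat) :
  (forall t, K * t = 16 ^+ 2 * 6 ^+ 9 * t) -> 100 ^+ 4 <= X ->
  exists2 i, lower k N i & X ^+ 26 <= K * Num.max 1 (absc (mulG (k i))) ^+ 27.
Proof.
move=> eK hX; apply: contrapT => hno.
have X0 : 0 <= X by apply: le_trans hX; apply: exprn_ge0; exact: ler0n.
move: hX.
have small i : lower k N i -> `|absum (mulG (k i)) ^+ 9| <= X ^+ 13 / 16.
  move=> li; apply: pow9_small X0 _ (absum_sqr_le _) _; first by rewrite le_max ler01.
  by rewrite -eK leNgt; apply/negP => /ltW h; apply: hno; exists i.
have N0 : mulG N != 0 by apply: (mulG_neq0 R); lia.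
have /ept_affP [x [y eP]] := N0.
have x13 : 0 < x ^+ 13 by apply: exprn_gt0; exact: curve_x_gt0 (affP eP).
have bnd (p : pred I) : `|\sum_(i | p i) c i| <= 8.
  apply: le_trans (ler_norm_sum _ _ _) _.
  apply: (@le_trans _ _ (\sum_(i | p i) 2)); first exact: ler_sum.
  rewrite big_const iter_addr addr0; have := max_card p; lia.
have hbR (z : int) : `|z| <= 8 -> `|z%:~R| <= 8 :> rat.
  by rewrite -intr_norm (ler_int rat _ 8).
have h1R (z : int) : z != 0 -> 1 <= `|z%:~R| :> rat.
  by move=> z0; rewrite -intr_norm (ler_int rat 1) -gtz0_ge1 normr_gt0.
have := relation_split k_le N_gt0 relation.
have -> : absum (mulG N) = x + y by rewrite /absum eP.
have -> : absum (mulG (- N%:Z)) = x - y by rewrite /absum mulGN (opp_aff eP).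
move=> es; have XE : X = x by rewrite /X /absc eP.
have low : 100 ^+ 4 <= X -> x ^+ 13 <= `|(cplus c k N)%:~R * (x + y) ^+ 9 +
    (cminus c k N)%:~R * (x - y) ^+ 9|.
  move=> hX; rewrite XE in hX; apply: (main_term_ge (affP eP) hX
    (hbR (cplus c k N) (bnd _)) (hbR (cminus c k N) (bnd _))).
  have [e|ne] := eqVneq (cplus c k N) (cminus c k N); [right|left].
    by split; [rewrite e|apply: h1R; move: nontrivial; rewrite -e orbb].
  by rewrite -rmorphB; apply: h1R; rewrite subr_eq0.
have up : `|\sum_(i | lower k N i) (c i)%:~R * absum (mulG (k i)) ^+ 9| <= x ^+ 13 / 2.
  apply: norm_sum_le_half c_le2 cardI _; last by move=> i li; rewrite -XE; exact: small.
  exact: ltW x13.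
by move=> /low {}low; apply: half_lt_self x13 low _; rewrite es normrN.
Qed.
End LogAbsc.

Section Core.
Variable R : realType.
Let h := loght R.
Let C := par_const R.
Let xr (n : int) : R := ratr (absc (mulG n)).

Lemma absc_gt0 n : n != 0 -> 0 < absc (mulG n).
Proof.
by move=> /(mulG_neq0 R) /ept_affP [x [y eP]]; rewrite /absc eP (curve_x_gt0 (affP eP)).
Qed.

Lemma absc_frac n : n != 0 ->
  absc (mulG n) * (pden (mulG n))%:~R = (pnum (mulG n))%:~R.
Proof.
move=> /(mulG_neq0 R) /ept_affP [x [y eP]].
by rewrite /absc eP (pnum_aff eP) (pden_aff eP) numqR.
Qed.

Lemma xr_frac n : n != 0 ->
  xr n * (pden (mulG n))%:~R = (pnum (mulG n))%:~R.
Proof.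
move=> /absc_frac /(congr1 (fun t : rat => ratr t : R)).
by rewrite rmorphM /= !ratr_int.
Qed.

Lemma xr_gt0 n : n != 0 -> 0 < xr n.
Proof. by move=> n0; rewrite /xr ltr0q absc_gt0. Qed.

Lemma ln_xr_le n : n != 0 -> ln (xr n) <= h n.
Proof.
move=> n0; have x0 := xr_gt0 n0; have d0 := pden_gt0 (mulG_neq0 R n0).
have hp : 0 < (height (mulG n))%:~R :> R by rewrite ltr0z; have := height_ge1 (mulG n); lia.
rewrite ler_ln ?posrE //; apply: (@le_trans _ _ (pnum (mulG n))%:~R).
  rewrite -xr_frac // ler_peMr ?(ltW x0) //.
  by rewrite (ler_int R 1) -gtz0_ge1.
by rewrite ler_int /height le_max lexx.
Qed.

Lemma loght_le_den n : n != 0 ->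
  h n <= 2 * ln (`|rden (mulG n)|%N)%:R + ln (Num.max 1 (xr n)).
Proof.
move=> n0; have x0 := xr_gt0 n0; have d0 := rden_gt0 (mulG_neq0 R n0).
have dr : 0 < (`|rden (mulG n)|%N)%:R :> R by rewrite ltr0n absz_gt0 gt_eqF.
have m0 : 0 < Num.max 1 (xr n) by rewrite lt_max ltr01.
have hp : 0 < (height (mulG n))%:~R :> R by rewrite ltr0z; have := height_ge1 (mulG n); lia.
rewrite mulr_natl -(lnXn 2 dr) -lnM ?posrE ?exprn_gt0 // ler_ln ?posrE ?mulr_gt0 ?exprn_gt0 //.
have -> : (`|rden (mulG n)|%N)%:R ^+ 2 = (pden (mulG n))%:~R :> R.
  by rewrite rden_sqr -[in RHS](gez0_abs (ltW d0)) rmorphXn /=.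
have q0 : 0 < (pden (mulG n))%:~R :> R by rewrite ltr0z pden_gt0 // (mulG_neq0 R n0).
rewrite /height; case: (leP (pnum (mulG n)) (pden (mulG n))) => _.
  by rewrite -{1}[(pden _)%:~R]mulr1 ler_pM2l // le_max lexx.
by rewrite -xr_frac // mulrC ler_pM2l // le_max lexx orbT.
Qed.

Lemma ln_xr_half (g N : nat) : (0 < g)%N -> (2 * g <= N)%N ->
  ln (xr g) <= h N / 4 + 2 * C.
Proof.
move=> g0 gN; apply: (le_trans (ln_xr_le _)); first by lia.
have := @loght_div R 2 g N _ isT gN; rewrite -/h -/C => /(_ _)/le_trans; apply; first by lia.
by lra.
Qed.

Lemma ln_xr_min (K N : nat) : (0 < K)%N -> (K < N)%N -> 2 <= xr K -> 2 <= xr N ->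
  ln (Num.min (xr N) (xr K)) <= ln 9 + (h N / 4 + 2 * C).
Proof.
move=> K0 KN hK hN; have x9 : 0 < 9 :> R by rewrite ltr0n.
have xN0 : 0 < xr N by apply: lt_le_trans hN; rewrite ltr0n.
have xK0 : 0 < xr K by apply: lt_le_trans hK; rewrite ltr0n.
have l9 : 0 <= ln 9 :> R by apply: ln_ge0; rewrite (ler_nat R 1).
have [small|large] := leqP (2 * K) N.
  apply: (@le_trans _ _ (ln (xr K))).
    by rewrite ler_ln ?posrE ?lt_min ?xN0 ?xK0 // ge_min lexx orbT.
  by have := ln_xr_half K0 small; lra.
have h2 (n : int) : 2 <= xr n -> 2 <= absc (mulG n).
  by rewrite /xr -(ler_rat R) ratr_nat.
have ne : absc (mulG N) != absc (mulG K).
  have nK : (N : int) != K by clear -KN; lia.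
  have nK' : (N : int) != - K%:Z by clear -KN; lia.
  apply/eqP => e; have [e'|e'] := absc_neq R nK nK' e; case: e' => e';
    by move: K0 KN; rewrite e' // ltn0.
have := absc_sub ne (h2 _ hN) (h2 _ hK); rewrite -mulGB.
rewrite (_ : N%:Z - K%:Z = (N - K)%N); last by lia.
rewrite -(ler_rat R) rmorphM /= ratr_nat => hmin.
have D0 : (0 < N - K)%N by lia.
have Dz : ((N - K)%N : int) != 0 by lia.
have xD0 : 0 < xr (N - K)%N := xr_gt0 Dz.
have hmin' : Num.min (xr N) (xr K) <= 9 * xr (N - K)%N.
  apply: le_trans hmin; rewrite /xr; case: (leP (absc _)) => hh.
    by rewrite ge_min lexx.
  by rewrite ge_min lexx orbT.
have hD : ln (xr (N - K)%N) <= h N / 4 + 2 * C.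
  by apply: (ln_xr_half D0); move: large; clear; lia.
apply: (@le_trans _ _ (ln (9 * xr (N - K)%N))).
  by rewrite ler_ln ?posrE ?lt_min ?xN0 ?xK0 ?(mulr_gt0 x9 xD0).
by rewrite lnM ?posrE ?x9 ?xD0 // lerD2l.
Qed.
End Core.

(** * Bounding the index of a collision *)

Lemma two_le_100_pow4 (F : realFieldType) : 2 <= 100 ^+ 4 :> F.
Proof.
apply: (@le_trans _ _ 100); first by rewrite (ler_nat F 2).
by apply: ler_eXnr; rewrite // (ler_nat F 1).
Qed.

Lemma pow_const_exists (F : realFieldType) :
  exists2 K : F, 0 < K & forall t, K * t = 16 ^+ 2 * 6 ^+ 9 * t.
Proof.
by exists (16 ^+ 2 * 6 ^+ 9) => //; rewrite mulr_gt0 ?exprn_gt0 ?ltr0n.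
Qed.

Definition collision (I : finType) (c k : I -> int) (N : nat) : Prop :=
  [/\ forall i, k i != 0, forall i, (`|k i| <= N)%N, (0 < N)%N,
      \sum_i (c i)%:~R * absum (mulG (k i)) ^+ 9 = 0 &
      [/\ forall i, `|c i| <= 2, (#|I| <= 4)%N &
          (cplus c k N != 0) || (cminus c k N != 0)]].

Lemma large_lower_term_real (R : realType) : exists X0 K2 : R,
  [/\ 2 <= X0, 0 < K2 & forall (I : finType) (c k : I -> int) (N : nat),
    collision c k N -> X0 <= ratr (absc (mulG N)) ->
    exists2 i, lower k N i & ratr (absc (mulG N)) ^+ 26 <=
      K2 * (ratr (Num.max 1 (absc (mulG (k i))))) ^+ 27].
Proof.
have [K K0 eK] : exists2 K : rat, 0 < K & forall t, K * t = 16 ^+ 2 * 6 ^+ 9 * t.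
  exact: pow_const_exists.
exists (ratr (100 ^+ 4)), (ratr K); split; [|by rewrite ltr0q|].
  by rewrite -(ratr_nat R 2) ler_rat; exact: two_le_100_pow4.
move=> I c k N [k0 kN N0 rel [c2 cI nt]]; rewrite ler_rat => hX.
have [i li hi] := large_lower_term R kN N0 rel c2 cI nt eK hX.
move: hi; clear eK hX; rewrite -(ler_rat R) rmorphXn rmorphM rmorphXn => hi.
by exists i.
Qed.

Section Final.
Variable R : realType.
Let h := loght R.
Let C := par_const R.
Let xr (n : int) : R := ratr (absc (mulG n)).
Variables X0 K2 : R.
Hypothesis X0_ge2 : 2 <= X0.
Hypothesis K2_gt0 : 0 < K2.
Hypothesis largeP : forall (I : finType) (c k : I -> int) (N : nat),
  collision c k N -> X0 <= xr N ->
  exists2 i, lower k N i &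
    xr N ^+ 26 <= K2 * (ratr (Num.max 1 (absc (mulG (k i))))) ^+ 27.

(** Together with [denC], collects the error terms that do not grow with N. *)
Definition abscC : R := 26 * ln X0 + `|ln K2| + 27 * (ln 9 + ln 2 + 2 * C).
Definition denC : R := 52 * ln 144 + 270 * C.

Variables (I : finType) (c k : I -> int) (N : nat).
Hypothesis coll : collision c k N.

Lemma xr_abs n : xr (`|n|%N : int) = xr n.
Proof.
by rewrite /xr; case: (leP 0 n) => ?; [rewrite gez0_abs|rewrite ltz0_abs // mulGN abscN].
Qed.

(** Beyond [X0] some lower index k satisfies 26 ln x(N G) <= 27 ln x(k G) up to a constant. The
    smaller of the two logarithms is at most h(N) / 4 up to constants, whence 27/4. *)
Lemma log_absc_bound : 26 * ln (Num.max 1 (xr N)) <= 27 / 4 * h N + abscC.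
Proof.
have C0 : 0 <= C := par_const_ge0 R; have h0 : 0 <= h N := loght_ge0 R N.
have l9 : 0 <= ln 9 :> R by apply: ln_ge0; rewrite (ler_nat R 1).
have l2 : 0 <= ln 2 :> R by apply: ln_ge0; rewrite (ler_nat R 1).
have x0 : 0 <= ln X0.
  by apply: ln_ge0; apply: le_trans X0_ge2; rewrite (ler_nat R 1).
have k2 := ler_norm (ln K2); have k20 := normr_ge0 (ln K2).
have [small|large] := ltP (xr N) X0.
  have : ln (Num.max 1 (xr N)) <= ln X0.
    have X0p : 0 < X0 by apply: lt_le_trans X0_ge2; rewrite ltr0n.
    rewrite ler_ln ?posrE ?lt_max ?ltr01 ?X0p // ge_max (ltW small) andbT.
    by apply: le_trans X0_ge2; rewrite (ler_nat R 1).
  by rewrite /abscC; lra.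
have [i li] := largeP coll large; set M : R := ratr _ => hM.
have [k_neq0 _ _ _ _] := coll.
have N2 : 2 <= xr N := le_trans X0_ge2 large.
have N0 : 0 < xr N by apply: lt_le_trans N2; rewrite ltr0n.
have N1 : 1 <= xr N by apply: le_trans N2; rewrite (ler_nat R 1).
have M1 : 1 <= M by rewrite /M -(rmorph1 (@ratr R)) ler_rat le_max lexx.
have M0 : 0 < M := lt_le_trans ltr01 M1.
have lM0 : 0 <= ln M := ln_ge0 M1.
have lnle : 26 * ln (xr N) <= ln K2 + 27 * ln M.
  have p27 : 0 < M ^+ 27 := exprn_gt0 27 M0.
  have e1 : ln (xr N ^+ 26) = 26 * ln (xr N) by rewrite (lnXn 26 N0) mulr_natl.
  have e2 : ln (K2 * M ^+ 27) = ln K2 + 27 * ln M.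
    by rewrite lnM ?posrE ?K2_gt0 ?p27 // (lnXn 27 M0) mulr_natl.
  by rewrite -e1 -e2 ler_ln ?posrE ?(exprn_gt0 26 N0) ?(mulr_gt0 K2_gt0 p27).
have -> : Num.max 1 (xr N) = xr N by apply/max_idPr.
suff : 26 * ln (xr N) <= 27 / 4 * h N + `|ln K2| + 27 * (ln 9 + ln 2 + 2 * C).
  by rewrite /abscC; lra.
have ME : M = Num.max 1 (xr (k i)).
  rewrite /M /xr; case: (leP 1 (absc (mulG (k i)))) => hh.
    by apply/esym/max_idPr; rewrite -(rmorph1 (@ratr R)) ler_rat.
  by rewrite rmorph1; apply/esym/max_idPl; rewrite -(rmorph1 (@ratr R)) ler_rat ltW.
have [xs|xl] := leP (xr (k i)) 2.
  have : ln M <= ln 2.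
    by rewrite ler_ln ?posrE // ME ge_max xs andbT (ler_nat R 1).
  by lra.
have MK : M = xr (`|k i|%N : int).
  by rewrite xr_abs ME; apply/max_idPr; apply: le_trans (ltW xl); rewrite (ler_nat R 1).
have K0 : (0 < `|k i|)%N by rewrite absz_gt0.
have xK : 2 <= xr (`|k i|%N : int) by rewrite xr_abs ltW.
have := ln_xr_min K0 li xK N2; rewrite -/(xr N) -/(xr `|k i|%N) -MK -/h -/C.
have [_|_] := leP (xr N) M; last by lra.
have : 0 <= ln (xr N) := ln_ge0 N1.
by lra.
Qed.

(** 26 h(N) is at most (27 * 25/36 + 27/4) h(N) = 51/2 h(N) plus constants; the remaining h(N) / 2
    explains the factor 2. *)
Lemma collision_loght_le : h N <= 2 * (abscC + denC).
Proof.
have [k_neq0 k_le N_gt0 relation [c_le2 cardI nontrivial]] := coll.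
have Nz : (N : int) != 0 by move: N_gt0; clear; lia.
have := log_den_bound R k_neq0 k_le N_gt0 relation c_le2 cardI nontrivial.
have := log_absc_bound; have := loght_le_den R Nz.
by rewrite -/h -/C -/(xr N) /denC; lra.
Qed.
End Final.

Lemma no_large_collision (R : realType) : exists N0 : nat,
  forall (I : finType) (c k : I -> int) (N : nat),
  (N0 <= N)%N -> (forall i, k i != 0) -> (forall i, (`|k i| <= N)%N) ->
  \sum_i (c i)%:~R * absum (mulG (k i)) ^+ 9 = 0 -> (forall i, `|c i| <= 2) ->
  (#|I| <= 4)%N -> cplus c k N = 0 /\ cminus c k N = 0.
Proof.
have [X0 [K2 [X02 K20 hX]]] := large_lower_term_real R.
have [N0 hN0] := loght_unbounded (2 * (abscC X0 K2 + denC R) + 1 : R).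
exists N0.+1 => I c k N N0N k0 kN rel c2 cI.
have [nt|] := boolP ((cplus c k N != 0) || (cminus c k N != 0)).
  have Npos : (0 < N)%N by apply: leq_trans N0N.
  have up := collision_loght_le X02 K20 hX (And5 k0 kN Npos rel (And3 c2 cI nt)).
  by have := le_trans (hN0 N (ltnW N0N)) up; rewrite gerDl ler10.
by rewrite negb_or !negbK => /andP[/eqP -> /eqP ->].
Qed.

(** * Injectivity *)

(** A line of slope -1 meets the real curve only once. In the sum t and the squared difference u of
    two distinct abscissas, eliminating the ordinates yields a positive polynomial that would have
    to vanish. *)
Lemma curve_sum_inj (F : realFieldType) (x y x' y' : F) :
  y ^+ 2 = x ^+ 3 + x - 1 -> y' ^+ 2 = x' ^+ 3 + x' - 1 -> x + y = x' + y' ->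
  x = x' /\ y = y'.
Proof.
move=> e e' s; have [xx'|xx'] := eqVneq x x'.
  by move: s; rewrite xx' => /addrI.
have d0 : x - x' != 0 by rewrite subr_eq0.
pose q := x ^+ 2 + x * x' + x' ^+ 2 + 1.
have yd : y - y' = - (x - x').
  by apply/subr0_eq; transitivity (x + y - (x' + y')); [ring|rewrite s subrr].
have ys : y + y' = - q.
  apply: (mulfI d0); transitivity (- ((y - y') * (y + y'))); first by rewrite yd; ring.
  by rewrite -subr_sqr e e' /q; ring.
pose t := x + x'; pose u := (x - x') ^+ 2.
have key : 0 < u * u + 16 * ((3 / 4 * t ^+ 2 + 1) ^+ 2 - t ^+ 3 / 2 - 2 * t + 4)
    + u * (6 * (t - 2) ^+ 2).
  have u0 : 0 <= u := sqr_ge0 _.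
  have h1 : 0 < (3 / 4 * t ^+ 2 + 1) ^+ 2 - t ^+ 3 / 2 - 2 * t + 4.
    have -> : (3 / 4 * t ^+ 2 + 1) ^+ 2 - t ^+ 3 / 2 - 2 * t + 4 =
       1 / 2 * (t ^+ 2 - t / 2) ^+ 2 + 1 / 16 * t ^+ 4 + 3 / 8 * t ^+ 2 +
        (t - 1) ^+ 2 + 4 by field.
    have := sqr_ge0 (t ^+ 2 - t / 2); have := sqr_ge0 (t - 1); have := sqr_ge0 t.
    have : 0 <= t ^+ 4 by rewrite exprn_even_ge0.
    by lra.
  have : 0 <= u * u by rewrite mulr_ge0.
  have : 0 <= u * (6 * (t - 2) ^+ 2) by rewrite mulr_ge0 // mulr_ge0 // sqr_ge0.
  by lra.
exfalso; move: key; apply/negP; rewrite -leNgt.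
have -> : u * u + 16 * ((3 / 4 * t ^+ 2 + 1) ^+ 2 - t ^+ 3 / 2 - 2 * t + 4)
    + u * (6 * (t - 2) ^+ 2) =
  16 * ((y - y') ^+ 2 + (y + y') ^+ 2 - 2 * (x ^+ 3 + x - 1) - 2 * (x' ^+ 3 + x' - 1)).
  rewrite yd ys /u /t /q.
  by field.
by rewrite -e -e'; lra.
Qed.

Lemma pow9_inj (F : realFieldType) (a b : F) : a ^+ 9 = b ^+ 9 -> a = b.
Proof.
wlog ab : a b / a < b => [hw e|].
  by have [/hw->|/hw->|] := ltgtP a b.
suff lt9 : a ^+ 9 < b ^+ 9 by move=> e; rewrite e ltxx in lt9.
have [a0|a0] := leP 0 a.
  by rewrite ltr_pXn2r ?nnegrE // (le_trans a0) // ltW.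
have an : a ^+ 9 < 0 by rewrite exprn_odd_lt0.
have [b0|b0] := leP 0 b; first by apply: lt_le_trans an _; rewrite exprn_ge0.
have opp9 (x : F) : x ^+ 9 = - (- x) ^+ 9 by ring.
by rewrite (opp9 a) (opp9 b) ltrN2 ltr_pXn2r ?nnegrE ?oppr_ge0 ?ltrN2 ?ltW.
Qed.

Lemma absum_pow_inj P Q : P != 0 -> Q != 0 -> absum P ^+ 9 = absum Q ^+ 9 -> P = Q.
Proof.
move=> /ept_affP [x [y eP]] /ept_affP [x' [y' eQ]] /pow9_inj.
rewrite /absum eP eQ => /(curve_sum_inj (affP eP) (affP eQ)) [ex ey].
by apply: pt_opt_inj; rewrite eP eQ ex ey.
Qed.

Lemma surface_collision (R : realType) : exists N0 : nat, forall m n m' n' : int,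
  m != 0 -> n != 0 -> m' != 0 -> n' != 0 -> (N0 <= maxn `|m| `|n|)%N ->
  absum (mulG m) ^+ 9 + 2 * absum (mulG n) ^+ 9 =
  absum (mulG m') ^+ 9 + 2 * absum (mulG n') ^+ 9 -> m = m' /\ n = n'.
Proof.
have [N0 hN0] := no_large_collision R; exists N0 => m n m' n' m0 n0 m'0 n'0 hmn.
set Am := _ (mulG m) ^+ 9; set An := _ (mulG n) ^+ 9.
set Am' := _ (mulG m') ^+ 9; set An' := _ (mulG n') ^+ 9 => e.
pose N := maxn (maxn `|m| `|n|) (maxn `|m'| `|n'|).
pose c (i : 'I_4) : int := nth 0 [:: 1; 2; -1; -2] i.
pose k (i : 'I_4) : int := nth 1 [:: m; n; m'; n'] i.
have ord4 (P : 'I_4 -> Prop) : P ord0 -> P (inord 1) -> P (inord 2) -> P (inord 3) ->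
    forall i, P i.
  move=> P0 P1 P2 P3 [[|[|[|[|j]]]] hj] //.
  - by rewrite (_ : Ordinal hj = ord0) //; apply: val_inj.
  - by rewrite (_ : Ordinal hj = inord 1) //; apply: val_inj; rewrite /= inordK.
  - by rewrite (_ : Ordinal hj = inord 2) //; apply: val_inj; rewrite /= inordK.
  by rewrite (_ : Ordinal hj = inord 3) //; apply: val_inj; rewrite /= inordK.
have k0 i : k i != 0 by move: i; apply: ord4; rewrite /k ?inordK.
have kN i : (`|k i| <= N)%N.
  by move: i; apply: ord4; rewrite /k ?inordK //= /N; clear; lia.
have c2 i : `|c i| <= 2 by move: i; apply: ord4; rewrite /c ?inordK.
have rel : \sum_i (c i)%:~R * absum (mulG (k i)) ^+ 9 = 0.
  rewrite !big_ord_recl big_ord0 /c /k /= -/Am -/An -/Am' -/An'.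
  rewrite addr0 mulr1z mul1r.
  rewrite (_ : 2%:~R = 2) // (_ : (-1)%:~R = -1) // (_ : (-2)%:~R = -2) //.
  by apply/eqP; rewrite -subr_eq0; move: e => /eqP; rewrite -subr_eq0 => /eqP e;
    apply/eqP; rewrite -[RHS]e; ring.
have [cp cm] := hN0 _ c k N (leq_trans hmn (leq_maxl _ _)) k0 kN rel c2
  (eq_leq (card_ord 4)).
(* Among 1, 2, -1, -2 a partial sum vanishes only if 1 and -1 are both present or both absent, and
   likewise 2 and -2. Here the coefficient 2 of the function matters. *)
have pick (t : int) : \sum_(i | k i == t) c i = 0 -> (m == t) = (m' == t) /\ (n == t) = (n' == t).
  rewrite big_mkcond !big_ord_recl big_ord0 /c /k /=.
  by case: (m == t); case: (n == t); case: (m' == t); case: (n' == t).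
have [mp np] := pick _ cp; have [mm nm] := pick _ cm.
have memN (u v : int) : (u == N) = (v == N) -> (u == - N%:Z) = (v == - N%:Z) ->
    (`|u| = N)%N -> u = v.
  by move=> h1 h2 hu; move: h1 h2; rewrite -hu; clear; lia.
have N0' : forall t, t != 0 -> mulG t != 0 by move=> t; exact: mulG_neq0 R t.
have injA u v : u != 0 -> v != 0 -> absum (mulG u) ^+ 9 = absum (mulG v) ^+ 9 -> u = v.
  move=> u0 v0 /(absum_pow_inj (N0' _ u0) (N0' _ v0)) uv.
  apply/eqP; rewrite -subr_eq0; apply: contraT => /N0'.
  by rewrite mulGB uv subrr eqxx.
(* One of the four indices has absolute value N, which identifies it with its partner; the remaining
   pair then follows by injectivity of x + y. *)
have finish : m = m' \/ n = n'.
  have : [\/ `|m| = N, `|n| = N, `|m'| = N | `|n'| = N]%N.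
    rewrite /N; clear; case: (leqP (maxn `|m| `|n|) (maxn `|m'| `|n'|)) => _.
      by case: (leqP `|m'| `|n'|) => _; [apply: Or44|apply: Or43].
    by case: (leqP `|m| `|n|) => _; [apply: Or42|apply: Or41].
  case=> h; [left|right|left|right].
  - exact: memN mp mm h.
  - exact: memN np nm h.
  - exact/esym/(memN _ _ (esym mp) (esym mm) h).
  exact/esym/(memN _ _ (esym np) (esym nm) h).
case: finish => h; split=> //.
  apply: injA => //; move: e; rewrite /Am /Am' h => /addrI.
  by apply: mulfI.
by apply: injA => //; move: e; rewrite /An /An' h => /addIr.
Qed.

Lemma ept_of_subproof (q : curve_pts rat) : on_curve (Some (set_val q)).
Proof.
have : curve (set_val q) := set_mem (valP q).
by case: (set_val q) => x y e; apply/eqP; exact: e.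
Qed.

Definition ept_of (q : curve_pts rat) : curve_point := CurvePoint (ept_of_subproof q).

Lemma ept_of_neq0 q : ept_of q != 0.
Proof.
apply/ept_affP; exists (set_val q).1, (set_val q).2.
by rewrite /=; case: (set_val q).
Qed.

Lemma ept_of_inj : injective ept_of.
Proof. by move=> p q /(congr1 pt_opt) [] /val_inj. Qed.

Lemma surface_funE (p : surface_pts rat) :
  surface_fun p = absum (ept_of p.1) ^+ 9 + 2 * absum (ept_of p.2) ^+ 9.
Proof.
rewrite /surface_fun /absum /=.
by case: (set_val p.1) => ? ?; case: (set_val p.2) => ? ?.
Qed.

Lemma surface_fun_injective_away (R : realType) :
  injective_away_from_finite (@surface_fun rat).
Proof.
have [N0 hN0] := surface_collision R.
(* The shift by [N0] lets naturals enumerate the indices from -N0 to N0 - 1; the exceptional pairs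
   have both indices in this range. *)
pose ind (s : nat * nat) : curve_point * curve_point :=
  (mulG (s.1%:Z - N0%:Z), mulG (s.2%:Z - N0%:Z)).
pose A : set (curve_point * curve_point) := (ind @` (`I_(N0.*2) `*` `I_(N0.*2)))%classic.
pose e2 (p : surface_pts rat) := (ept_of p.1, ept_of p.2).
exists (e2 @^-1` A)%classic.
  apply: finite_preimage.
    move=> [p1 p2] [q1 q2] _ _ e.
    by congr (_, _); apply: ept_of_inj; [exact: (congr1 fst e)|exact: (congr1 snd e)].
  by apply: finite_image; apply: finite_setX; apply: finite_II.
move=> p q /set_mem pS /set_mem _; rewrite !surface_funE.
have [m em] := mordell_weil R (ept_of p.1); have [n en] := mordell_weil R (ept_of p.2).
have [m' em'] := mordell_weil R (ept_of q.1); have [n' en'] := mordell_weil R (ept_of q.2).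
have nz P t : ept_of P = genG *~ t -> t != 0.
  move=> eP; have := ept_of_neq0 P; rewrite eP; apply: contraNneq => ->.
  by rewrite mulr0z.
have large : (N0 <= maxn `|m| `|n|)%N.
  rewrite leqNgt; apply/negP => small; apply: pS; rewrite /A /=.
  exists (`|(m + N0%:Z)%R|%N, `|(n + N0%:Z)%R|%N).
    by move: small; clear; split => /=; lia.
  rewrite /ind /e2 /= em en; congr (mulG _, mulG _); move: small; clear; lia.
rewrite em en em' en' => /(hN0 m n m' n' (nz _ _ em) (nz _ _ en) (nz _ _ em')
  (nz _ _ en') large) [mm nn].
case: p q em en em' en' {pS} => [p1 p2] [q1 q2] /= em en em' en'.
by congr (_, _); apply: ept_of_inj; [rewrite em em' mm|rewrite en en' nn].
Qed.

(** * Density *)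

(** Here y3 is the ordinate of (x, y) minus the far point (X, w). The invariant differential is dx /
    (2 y) = dy / (3 x^2 + 1), so along the group the ordinate moves with speed 3 x^2 + 1, positive
    everywhere, and the far point amounts to a displacement of about w / X^2. *)
Lemma far_translation_bounds (F : realFieldType) (M X x y w : F) (l := (y + w) / (x - X))
    (y3 := l * (x - (l ^+ 2 - x - X)) - y) :
  1 <= M -> 0 < x <= M -> - M <= y <= M -> 0 < w ->
  y ^+ 2 = x ^+ 3 + x - 1 -> w ^+ 2 = X ^+ 3 + X - 1 -> 6000 * M ^+ 4 <= X ->
  w / (2 * X ^+ 2) <= y3 - y <= 80 * M ^+ 2 * (w / X ^+ 2).
Proof.
move=> M1 /andP[x0 xM] /andP[yM1 yM2] w0 ey ew hX.
have M0 : 0 < M := lt_le_trans ltr01 M1.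
have M2 : M <= M ^+ 2 by rewrite expr2 ler_peMl // ltW.
have M3 : M ^+ 2 <= M ^+ 3 by rewrite (exprS M 2) ler_peMl // sqr_ge0.
have M4 : M ^+ 3 <= M ^+ 4 by rewrite (exprS M 3) ler_peMl // exprn_ge0 // ltW.
have MX : 24 * M <= X by move: M0 M2 M3 M4 hX; clear; lra.
have M1X : M <= X by move: M0 MX; clear; lra.
have X0 : 0 < X := lt_le_trans M0 M1X.
have xltX : 2 * x <= X by move: M0 xM MX; clear; lra.
have d0 : 0 < X - x by move: x0 xltX; clear; lra.
have xX : x - X != 0 by rewrite -oppr_eq0 opprB gt_eqF.
have M21 : 1 <= M ^+ 2 by rewrite exprn_ege1.
have h2 : M ^+ 3 <= M ^+ 2 * X by rewrite (exprSr M 2) ler_wpM2l ?sqr_ge0.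
pose A := w * (3 * x ^+ 2 * X + x ^+ 3 + 3 * x).
pose E := 4 * w - 6 * x * y * X ^+ 2 + y * (3 * x ^+ 2 * X - 3 * X - x ^+ 3 - x + 4).
(* The part w X + A contains the expected w X (1 + 3 x^2); E will be at most w X / 2 in absolute
   value. *)
have key : (y3 - y) * (X - x) ^+ 3 = w * X + A - E.
  by rewrite /y3 /l /A /E; field: ey ew.
move: (y3 - y) key => s key {xX ey l y3}.
have x2 : 0 < x ^+ 2 <= M ^+ 2.
  by rewrite exprn_gt0 //= ler_pXn2r ?nnegrE // ltW.
have x3 : 0 < x ^+ 3 <= M ^+ 3.
  by rewrite exprn_gt0 //= ler_pXn2r ?nnegrE // ltW.
case/andP: x2 => x20 x2; case/andP: x3 => x30 x3.
have wX : 72 * M ^+ 2 * X <= w.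
  have p1 : 0 <= 72 * M ^+ 2 * X by rewrite !mulr_ge0 // ?sqr_ge0 // ltW.
  rewrite -(@ler_pXn2r _ 2) ?nnegrE // ?(ltW w0) // ew.
  rewrite (_ : (72 * M ^+ 2 * X) ^+ 2 = X ^+ 2 * (5184 * M ^+ 4)); last by ring.
  have : X ^+ 2 * (5184 * M ^+ 4) <= X ^+ 2 * X.
    have M40 : 0 <= M ^+ 4 by rewrite exprn_ge0 // ltW.
    by apply: (ler_wpM2l (sqr_ge0 X)); move: M40 hX; clear; lra.
  by rewrite -exprSr; move: M1 M1X; clear; lra.
move=> {ew}.
have A0 : 0 <= A by rewrite mulr_ge0 ?(ltW w0) // !addr_ge0 ?mulr_ge0 // ltW.
have A1 : A <= w * X * (7 * M ^+ 2).
  rewrite -mulrA ler_wpM2l ?(ltW w0) //.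
  have h1 : x ^+ 2 * X <= M ^+ 2 * X by rewrite ler_wpM2r // ltW.
  rewrite (mulrC X) -(mulrA 7) -mulrA; move: M1 M2 M3 M4 h1 h2 xM x3; clear; lra.
have yabs : `|y| <= M by rewrite ler_norml yM1 yM2.
have xabs : `|x| <= M by rewrite ger0_norm // ltW.
have E1 : `|E| <= w * X / 2.
  have b1 : `|4 * w| <= w * X / 6.
    rewrite ger0_norm ?mulr_ge0 ?(ltW w0) //.
    have : w * 24 <= w * X by rewrite ler_pM2l //; move: M1 MX; clear; lra.
    by clear; lra.
  have b2 : `|6 * x * y * X ^+ 2| <= w * X / 6.
    rewrite (_ : 6 * x * y * X ^+ 2 = X * (6 * X * (x * y))); last by ring.
    rewrite normrM (gtr0_norm X0) (_ : w * X / 6 = X * (w / 6)); last by field.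
    rewrite ler_pM2l // normrM (ger0_norm (mulr_ge0 (ler0n _ 6) (ltW X0))) normrM.
    have : `|x| * `|y| <= M * M by apply: ler_pM.
    rewrite -expr2 => /(ler_wpM2l (mulr_ge0 (ler0n F 6) (ltW X0))).
    by move: w0 wX; clear; lra.
  have b3 : `|y * (3 * x ^+ 2 * X - 3 * X - x ^+ 3 - x + 4)| <= w * X / 6.
    rewrite normrM.
    have h1 : `|3 * x ^+ 2 * X - 3 * X - x ^+ 3 - x + 4| <= 12 * M ^+ 2 * X.
      have h1 : x ^+ 2 * X <= M ^+ 2 * X by rewrite ler_wpM2r // ltW.
      have h3 : X <= M ^+ 2 * X by rewrite ler_peMl // ltW.
      have h4 : 0 < x ^+ 2 * X by rewrite mulr_gt0.
      rewrite ler_norml; move: M1 M1X x0 xM x30 x3 h1 h2 h3 h4; clear => *.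
      by apply/andP; split; lra.
    apply: (@le_trans _ _ (M * (12 * M ^+ 2 * X))); first exact: ler_pM.
    rewrite (_ : w * X / 6 = w / 6 * X); last by field.
    rewrite mulrA ler_pM2r //.
    have h5 : M ^+ 2 * M <= M ^+ 2 * X by rewrite ler_wpM2l ?sqr_ge0.
    by move: wX h5; clear; lra.
  by rewrite /E; apply: le_trans (ler_normD _ _) _;
    have := ler_normB (4 * w) (6 * x * y * X ^+ 2); move: b1 b2 b3; clear; lra.
move: E1; rewrite ler_norml => /andP[E1 E2].
have d3 : 0 < (X - x) ^+ 3 by rewrite exprn_gt0.
have d3l : (X / 2) ^+ 3 <= (X - x) ^+ 3.
  by rewrite ler_pXn2r ?nnegrE ?divr_ge0 ?(ltW X0) ?(ltW d0) //; move: xltX; clear; lra.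
have d3u : (X - x) ^+ 3 <= X ^+ 3 by rewrite ler_pXn2r ?nnegrE ?(ltW X0) ?(ltW d0) // gerBl ltW.
have Xn : X != 0 by rewrite gt_eqF.
apply/andP; split.
  rewrite -(ler_pM2r d3) key.
  have : w / (2 * X ^+ 2) * (X - x) ^+ 3 <= w / (2 * X ^+ 2) * X ^+ 3.
    by rewrite ler_wpM2l // divr_ge0 ?(ltW w0) // mulr_ge0 // sqr_ge0.
  rewrite (_ : w / (2 * X ^+ 2) * X ^+ 3 = w * X / 2); last by field.
  by move: A0 E2; clear; lra.
rewrite -(ler_pM2r d3) key.
have c0 : 0 <= 80 * M ^+ 2 * (w / X ^+ 2).
  by rewrite mulr_ge0 ?divr_ge0 ?(ltW w0) ?sqr_ge0 // mulr_ge0 // sqr_ge0.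
(* Since X - x >= X / 2, the constant 80 = 8 * 10 leaves 10 M^2 w X to bound w X + A - E. *)
have := ler_wpM2l c0 d3l.
rewrite (_ : 80 * M ^+ 2 * (w / X ^+ 2) * (X / 2) ^+ 3 = 10 * M ^+ 2 * (w * X)); last first.
  by field.
have wX0 : 0 < w * X by rewrite mulr_gt0.
have : w * X <= M ^+ 2 * (w * X) by rewrite ler_peMl // ltW.
by move: A1 E1 wX0; rewrite (mulrC (w * X)) -mulrA; clear; lra.
Qed.

(** The chord through P and -Q has a slope l with l (y1 - y2) = x1^2 + x1 x2 + x2^2 + 1 > 1, so
    close ordinates force a large slope and a large abscissa of P - Q. *)
Lemma close_ordinates_abscissa (F : realFieldType) (b N x1 y1 x2 y2 : F)
    (l := (y1 - - y2) / (x1 - x2)) :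
  0 <= b -> 3 * b <= N ^+ 2 -> 0 <= N -> 0 < x1 <= b -> 0 < x2 <= b -> x1 != x2 ->
  y1 ^+ 2 = x1 ^+ 3 + x1 - 1 -> y2 ^+ 2 = x2 ^+ 3 + x2 - 1 ->
  `|(y1 - y2) * N| < 1 -> b < l ^+ 2 - x1 - x2.
Proof.
move=> b0 hN N0 /andP[x10 x1b] /andP[x20 x2b] nx e1 e2 hd.
have d0 : x1 - x2 != 0 by rewrite subr_eq0.
have el : l * (y1 - y2) = x1 ^+ 2 + x1 * x2 + x2 ^+ 2 + 1.
  by rewrite /l; field: e1 e2.
have p12 : 0 < x1 * x2 by rewrite mulr_gt0.
have s1 := sqr_ge0 x1; have s2 := sqr_ge0 x2.
have l1 : 1 <= `|l| * `|y1 - y2| by rewrite -normrM el ger0_norm; lra.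
have yn : 0 < `|y1 - y2|.
  by rewrite lt_neqAle normr_ge0 andbT; apply: contraTneq l1 => <-; rewrite mulr0 -ltNge ltr01.
have lN : N < `|l|.
  rewrite -(ltr_pM2r yn); apply: lt_le_trans l1.
  by rewrite -{1}(ger0_norm N0) -normrM mulrC.
have : N ^+ 2 < `|l| ^+ 2 by rewrite ltr_pXn2r ?nnegrE.
by rewrite -normrX ger0_norm ?sqr_ge0 //; lra.
Qed.

Lemma ordinate_bound (F : realDomainType) (b x y : F) : 0 <= b -> 0 < x <= b ->
  y ^+ 2 = x ^+ 3 + x - 1 -> `|y| <= (b + 1) ^+ 2.
Proof.
move=> b0 /andP[x0 xb] e.
have b1 : 0 <= (b + 1) ^+ 2 by rewrite sqr_ge0.
rewrite -(@ler_pXn2r _ 2) ?nnegrE // -normrX ger0_norm ?sqr_ge0 // e.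
have : x ^+ 3 <= b ^+ 3 by rewrite ler_pXn2r ?nnegrE ?(ltW x0).
have b2 : 0 <= b ^+ 2 := sqr_ge0 _.
have b4 : 0 <= b ^+ 4 by rewrite exprn_ge0.
have b3 : 0 <= b ^+ 3 by rewrite exprn_ge0.
by rewrite (_ : ((b + 1) ^+ 2) ^+ 2 = b ^+ 4 + 4 * b ^+ 3 + 6 * b ^+ 2 + 4 * b + 1); [lra|ring].
Qed.

Lemma same_box (F : archiRealFieldType) (D N u v : F) : 0 <= N ->
  - D <= u -> - D <= v -> Num.truncn ((u + D) * N) = Num.truncn ((v + D) * N) ->
  `|(u - v) * N| < 1.
Proof.
move=> N0 hu hv e.
have u0 : 0 <= (u + D) * N by rewrite mulr_ge0 //; lra.
have v0 : 0 <= (v + D) * N by rewrite mulr_ge0 //; lra.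
have /andP := truncn_itv u0; have /andP := truncn_itv v0.
by rewrite e -natr1 ltr_norml => -[a1 a2] [a3 a4]; apply/andP; split; lra.
Qed.

Lemma pigeonhole_nat (K : nat) (f : nat -> nat) : (forall i, (f i <= K)%N) ->
  exists i j, i != j /\ f i = f j.
Proof.
move=> hf; pose g (i : 'I_K.+2) : 'I_K.+1 := inord (f i).
have : ~~ injectiveb g.
  by apply/injectiveP => /leq_card; rewrite !card_ord ltnn.
case/injectivePn => i [j nij /(congr1 val)]; rewrite /= !inordK ?ltnS // => e.
by exists i, j.
Qed.

Lemma unbounded_abscissa (R : realType) (b : nat) :
  exists P x y, pt_opt P = Some (x, y) /\ b%:R < x.
Proof.
apply: contrapT => H.
have xb P x y : pt_opt P = Some (x, y) -> 0 < x <= b%:R.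
  move=> e; rewrite (curve_x_gt0 (affP e)) leNgt; apply/negP => h.
  by apply: H; exists P, x, y.
have /choice [c hc] (i : nat) : exists c : rat * rat, pt_opt (mulG i.+1%:Z) = Some c.
  have /ept_affP [x [y ->]] : mulG i.+1%:Z != 0 by exact: (mulG_neq0 R).
  by exists (x, y).
(* Ordinates lie in [-D, D], cut into boxes of width 1 / N; the chord estimate asks for N^2 >= 3
   b. *)
pose N := (3 * b + 1)%N; pose D := ((b + 1) ^ 2)%N.
have hc' i : pt_opt (mulG i.+1%:Z) = Some ((c i).1, (c i).2) by rewrite hc; case: (c i).
have hD i : `|(c i).2| <= D%:R.
  rewrite natrX natrD; exact: ordinate_bound (ler0n _ b) (xb _ _ _ (hc' i)) (affP (hc' i)).
pose f i := Num.truncn (((c i).2 + D%:R) * N%:R).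
have [i|i [j [nij eij]]] := @pigeonhole_nat (2 * D * N)%N f.
  have := hD i; rewrite ler_norml => /andP[h1 h2].
  rewrite /f -(@natrK rat (2 * D * N)%N); apply: le_truncn.
  by rewrite (natrM _ (2 * D)) (natrM _ 2) ler_wpM2r ?ler0n //; lra.
have hd : `|((c i).2 - (c j).2) * N%:R| < 1.
  apply: (@same_box _ D%:R) => //; first by have := hD i; rewrite ler_norml => /andP[].
  by have := hD j; rewrite ler_norml => /andP[].
have nx : (c i).1 != (c j).1.
  apply/eqP => ex; have := hc' j; rewrite -ex => /(same_abscissa (hc' i)) [] /eqP.
    by rewrite -subr_eq0 -mulGB; apply/negP; apply: (mulG_neq0 R); move: nij; clear; lia.
  by rewrite -subr_eq0 opprK -mulGD; apply/negP; exact: (mulG_neq0 R).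
have hN : 3 * b%:R <= N%:R ^+ 2 :> rat.
  by rewrite -(natrX _ N) -(natrM _ 3) ler_nat /N; clear; lia.
have := close_ordinates_abscissa (ler0n _ b) hN (ler0n _ N) (xb _ _ _ (hc' i))
  (xb _ _ _ (hc' j)) nx (affP (hc' i)) (affP (hc' j)) hd.
by have /andP[_ /le_gtF ->] := xb _ _ _ (add_chord (hc' i) (opp_aff (hc' j)) nx).
Qed.

Lemma ratr_curve (F : realFieldType) (x y : rat) : y ^+ 2 = x ^+ 3 + x - 1 ->
  (ratr y : F) ^+ 2 = ratr x ^+ 3 + ratr x - 1.
Proof. by move=> e; rewrite -!rmorphXn -rmorphD -(rmorph1 (@ratr F)) -rmorphB e. Qed.

Lemma large_translation (R : realType) (B : R) :
  exists X w : rat, [/\ w ^+ 2 = X ^+ 3 + X - 1, 0 < w & B < ratr X].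
Proof.
have [P [X [W [eP hX]]]] := unbounded_abscissa R (Num.truncn B).+1.
exists X, `|W|; rewrite -normrX ger0_norm ?sqr_ge0 //; split; first exact: affP eP.
  by rewrite normr_gt0; exact: curve_y_neq0 (affP eP).
apply: lt_trans (truncnS_gt B) _.
by rewrite -(ratr_nat R) ltr_rat; apply: le_lt_trans hX; rewrite ler_nat.
Qed.

Lemma curve_abscissa_le (F : realDomainType) (x y a : F) : `|y| <= a ->
  y ^+ 2 = x ^+ 3 + x - 1 -> 0 < x <= 1 + a ^+ 2.
Proof.
move=> ya e; have x0 := curve_x_gt0 e; rewrite x0 /=.
have : `|y| ^+ 2 <= a ^+ 2 by rewrite ler_pXn2r ?nnegrE // (le_trans _ ya).
rewrite -normrX ger0_norm ?sqr_ge0 // e.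
have : 0 < x ^+ 3 by rewrite exprn_gt0.
by lra.
Qed.

(** As w is about X^(3/2), the quotient is about X^(-1/2). *)
Lemma small_slope (F : realFieldType) (X w h : F) : 0 < w -> 0 < h -> 1 <= X ->
  2 / h ^+ 2 < X -> w ^+ 2 = X ^+ 3 + X - 1 -> w / X ^+ 2 < h.
Proof.
move=> w0 h0 X1 hX e; have X0 : 0 < X by lra.
rewrite ltr_pdivrMr ?exprn_gt0 // -(@ltr_pXn2r _ 2) ?nnegrE ?mulr_ge0 ?sqr_ge0 ?ltW // e.
rewrite (_ : (h * X ^+ 2) ^+ 2 = X ^+ 3 * (X * h ^+ 2)); last by ring.
have X3 : 0 < X ^+ 3 by rewrite exprn_gt0.
have : 2 < X * h ^+ 2 by rewrite -ltr_pdivrMr ?exprn_gt0.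
rewrite -(ltr_pM2l X3).
have : X <= X ^+ 3 by rewrite exprS ler_peMr ?(ltW X0) // expr2 mulr_ege1.
by lra.
Qed.

Lemma chord_ordinate (x y X w : rat) : y ^+ 2 = x ^+ 3 + x - 1 ->
  w ^+ 2 = X ^+ 3 + X - 1 -> x != X ->
  let l := (y + w) / (x - X) in
  exists x', (l * (x - (l ^+ 2 - x - X)) - y) ^+ 2 = x' ^+ 3 + x' - 1.
Proof.
move=> e1 e2 nx l; have [P eP] := aff_exists e1.
have [Q eQ] : exists Q, pt_opt Q = Some (X, - w) by apply: aff_exists; rewrite sqrrN.
have := affP (add_chord eP eQ nx); rewrite opprK -/l => e.
by exists (l ^+ 2 - x - X).
Qed.

(* Translation by a rational point far out on the curve moves a bounded real
   point upwards by an arbitrarily small amount, so the ordinates of the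
   rational points leave no gap. *)
Lemma rational_ordinate_dense (R : realType) (c e : R) : 0 < e ->
  exists x y : rat, y ^+ 2 = x ^+ 3 + x - 1 /\ `|ratr y - c| < e.
Proof.
move=> e0; apply: contrapT => H.
have gap x y : y ^+ 2 = x ^+ 3 + x - 1 -> ratr y <= c -> ratr y <= c - e.
  move=> exy yc; rewrite leNgt; apply/negP => h; apply: H; exists x, y; split => //.
  by rewrite ltr_norml; apply/andP; split; lra.
(* By the gap, the supremum s of these ordinates stays at least e below c; the contradiction is a
   rational ordinate between s and c. *)
pose S : set R := [set r | exists x y : rat,
  [/\ y ^+ 2 = x ^+ 3 + x - 1, ratr y <= c & r = ratr y]]%classic.
have Sub : ubound S (c - e) by move=> _ [x [y [exy yc ->]]]; exact: gap exy yc.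
have S0 : (S !=set0)%classic.
  have [X [w [ew w0 hX]]] := large_translation (1 + c ^+ 2).
  exists (ratr (- w)), X, (- w); rewrite sqrrN; split => //.
  have ew' := ratr_curve R ew; have w0' : 0 < ratr w :> R by rewrite ltr0q.
  have c2 : 0 <= c ^+ 2 := sqr_ge0 c.
  have X3 : 0 < (ratr X : R) ^+ 3 by rewrite exprn_gt0 //; lra.
  have : `|c| ^+ 2 <= (ratr w : R) ^+ 2 by rewrite -normrX ger0_norm // ew'; lra.
  rewrite ler_pXn2r ?nnegrE ?(ltW w0') // ler_norml => /andP[h _].
  by rewrite raddfN /=; lra.
have hS : has_sup S by split => //; exists (c - e).
pose s := sup S.
have sc : s <= c - e by exact: ge_sup.
(* Bounds both coordinates of a point whose ordinate is within 1 of s. *)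
pose M := 1 + (`|s| + 1) ^+ 2.
have M1 : 1 <= M by rewrite /M lerDl sqr_ge0.
have sM : `|s| + 1 <= M.
  by rewrite /M; have := sqr_ge0 (`|s| + 1 - 1); have := normr_ge0 s; nra.
(* Makes the upward move at most e, so that it cannot jump beyond c. *)
pose h := e / (80 * M ^+ 2).
have h0 : 0 < h by rewrite divr_gt0 // mulr_gt0 // exprn_gt0 //; lra.
have [X [w [ew w0 hX]]] := large_translation (1 + 6000 * M ^+ 4 + 2 / h ^+ 2).
have M4 : 0 <= M ^+ 4 by rewrite exprn_ge0 //; lra.
have q0 : 0 <= 2 / h ^+ 2 by rewrite divr_ge0 // sqr_ge0.
have [hX1 hX2 hX3] : [/\ 1 <= ratr X :> R, 6000 * M ^+ 4 <= ratr X & 2 / h ^+ 2 < ratr X].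
  by split; move: hX M4 q0; clear; lra.
have ew' := ratr_curve R ew; have w0' : 0 < ratr w :> R by rewrite ltr0q.
have hwX := small_slope w0' h0 hX1 hX3 ew'.
have d0 : 0 < ratr w / (2 * ratr X ^+ 2) :> R.
  by rewrite divr_gt0 // mulr_gt0 // exprn_gt0 // (lt_le_trans ltr01 hX1).
(* An ordinate closer to s than the least possible move is carried past s. *)
pose d : R := Num.min 1 (ratr w / (2 * ratr X ^+ 2)).
have [|_ [x [y [exy yc ->]]] hy] := @sup_adherent _ _ d _ hS; first by rewrite /d lt_min ltr01.
have ys : ratr y <= s by apply: ub_le_sup; [exists (c - e)|exists x, y].
have [hy1 hy2] : ratr y > s - 1 /\ ratr y > s - ratr w / (2 * ratr X ^+ 2).
  have : d <= 1 by rewrite ge_min lexx.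
  have : d <= ratr w / (2 * ratr X ^+ 2) by rewrite ge_min lexx orbT.
  by move: hy; rewrite -/s; clearbody d; clear; split; lra.
have ya : `|ratr y : R| <= `|s| + 1.
  have := ler_norm s; have := ler_norm (- s); rewrite normrN.
  move: ys hy1; clear => *.
  by rewrite ler_norml; apply/andP; split; lra.
have exy' := ratr_curve R exy.
have xM : 0 < (ratr x : R) <= M := curve_abscissa_le ya exy'.
have yM : - M <= (ratr y : R) <= M by rewrite -ler_norml (le_trans ya).
have /andP[b1 b2] := far_translation_bounds M1 xM yM w0' exy' ew' hX2.
have nx : x != X.
  apply: contraTneq hX2 => <-; case/andP: xM => _ xM; rewrite -ltNge.
  apply: (le_lt_trans xM).
  have : M <= M ^+ 4 by rewrite exprS ler_peMr ?exprn_ege1 // (le_trans ler01).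
  by move: M1; clear; lra.
have [x' e'] := chord_ordinate exy ew nx.
move: b1 b2; set y3 : R := _ * _ - ratr y => b1 b2.
have y3E : y3 = ratr ((y + w) / (x - X) * (x - (((y + w) / (x - X)) ^+ 2 - x - X)) - y).
  by rewrite !(rmorphB, rmorphD, rmorphM, rmorphXn, fmorphV).
have y3c : y3 <= c.
  have : 80 * M ^+ 2 * (ratr w / ratr X ^+ 2) <= e.
    have M2 : 0 < 80 * M ^+ 2 by rewrite mulr_gt0 // exprn_gt0 // (lt_le_trans ltr01).
    by rewrite mulrC -ler_pdivlMr //; exact: ltW.
  by move: b2 ys sc; clear; lra.
have : y3 <= s.
  apply: ub_le_sup; first by exists (c - e).
  by exists x'; eexists; split; [exact: e'| |exact: y3E]; rewrite -y3E.
by move: b1 hy2; clear; lra.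
Qed.

(** * The real curve as a graph over the ordinate *)

(** The derivative 3 x^2 + 1 is at least 1. This gives both the uniqueness and the continuity of the
    abscissa as a function of the ordinate. *)
Lemma cubic_expanding (F : realDomainType) (a b : F) :
  `|a - b| <= `|(a ^+ 3 + a) - (b ^+ 3 + b)|.
Proof.
rewrite (_ : _ - (b ^+ 3 + b) = (a - b) * (a ^+ 2 + a * b + b ^+ 2 + 1)); last by ring.
rewrite normrM ler_peMr // ler_normr; apply/orP; left.
have := sqr_ge0 (a + b); have := sqr_ge0 a; have := sqr_ge0 b.
by rewrite sqrrD; lra.
Qed.

Lemma pair_continuous (S T U : topologicalType) (f : S -> T) (g : S -> U) :
  continuous f -> continuous g -> continuous (fun x => (f x, g x)).
Proof. by move=> cf cg x; exact: (cvg_pair (cf x) (cg x)). Qed.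

Section OrdinateParametrization.
Local Open Scope classical_set_scope.
Local Open Scope ring_scope.
Variable R : realType.

Lemma abscissa_exists (y : R) : exists x : R, x ^+ 3 + x = 1 + y ^+ 2.
Proof. by apply: cubic_surj; rewrite addr_ge0 // sqr_ge0. Qed.

Definition abscissa (y : R) : R := sval (cid (abscissa_exists y)).

Lemma abscissaE y : abscissa y ^+ 3 + abscissa y = 1 + y ^+ 2.
Proof. exact: svalP (cid (abscissa_exists y)). Qed.

Lemma abscissa_unique (x y : R) : y ^+ 2 = x ^+ 3 + x - 1 -> abscissa y = x.
Proof.
move=> e; apply/eqP; rewrite -subr_eq0 -normr_le0.
by apply: le_trans (cubic_expanding _ _) _; rewrite abscissaE e (addrC 1) subrK subrr normr0.
Qed.

Lemma abscissa_continuous : continuous abscissa.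
Proof.
move=> y; apply/cvgrPdist_lt => e e0.
have /cvgrPdist_lt/(_ e e0) : (fun z : R => z ^+ 2) z @[z --> y] --> y ^+ 2.
  exact: exprn_continuous.
apply: filterS => z; apply: le_lt_trans; apply: le_trans (cubic_expanding _ _) _.
by rewrite !abscissaE opprD addrACA subrr add0r.
Qed.

Lemma curve_of_subproof (y : R) : (abscissa y, y) \in @curve R.
Proof. by apply/mem_set; rewrite /curve /= abscissaE addrC addKr. Qed.

Definition curve_of (y : R) : curve_pts R :=
  exist (fun q => q \in @curve R) _ (curve_of_subproof y).

Definition ordinate (p : curve_pts R) : R := (set_val p).2.

Lemma curve_ofK : cancel curve_of ordinate. Proof. by []. Qed.

Lemma ordinateK : cancel ordinate curve_of.
Proof.
move=> p; have e : curve (set_val p) := set_mem (valP p).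
by apply: val_inj; rewrite /= (abscissa_unique e) -surjective_pairing.
Qed.

Lemma ordinate_continuous : continuous ordinate.
Proof.
move=> p; apply: (@continuous_comp _ _ _ set_val snd); first exact: initial_continuous.
exact: cvg_snd.
Qed.

Lemma curve_of_continuous : continuous curve_of.
Proof.
apply: continuous_comp_initial.
exact: (pair_continuous abscissa_continuous (fun y => cvg_id)).
Qed.

Lemma surface_of_continuous :
  continuous (fun y : R * R => (curve_of y.1, curve_of y.2)).
Proof.
apply: pair_continuous => y.
  apply: (@continuous_comp _ _ _ fst curve_of y); [exact: cvg_fst|exact: curve_of_continuous].
apply: (@continuous_comp _ _ _ snd curve_of y); [exact: cvg_snd|exact: curve_of_continuous].
Qed.

Lemma surface_homeomorphic : homeomorphic (surface_pts R) (R * R)%type.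
Proof.
exists (fun p => (ordinate p.1, ordinate p.2)), (fun y => (curve_of y.1, curve_of y.2)).
split=> [[p1 p2]|[y1 y2]||] /=.
- by rewrite !ordinateK.
- by rewrite !curve_ofK.
- apply: pair_continuous => p.
    apply: (@continuous_comp _ _ _ fst ordinate p); [exact: cvg_fst|exact: ordinate_continuous].
  apply: (@continuous_comp _ _ _ snd ordinate p); [exact: cvg_snd|exact: ordinate_continuous].
- exact: surface_of_continuous.
Qed.

Lemma rational_near (A : set R) (y : R) : nbhs y A ->
  exists2 q : curve_pts rat, A (ordinate (curve_map (@ratr R) q))
    & curve_of (ordinate (curve_map (@ratr R) q)) = curve_map (@ratr R) q.
Proof.
move=> /nbhs_ballP [e /= e0 sub].
have [a [b [eab bc]]] := rational_ordinate_dense y e0.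
have ab : (a, b) \in @curve rat by apply/mem_set.
exists (exist (fun q => q \in @curve rat) _ ab); last exact: ordinateK.
by apply: sub; rewrite /ball /= distrC.
Qed.

Lemma rational_points_dense : dense (@rational_points R).
Proof.
move=> O [[p1 p2] Op] Oo.
have [] : nbhs (ordinate p1, ordinate p2) ((fun y : R * R => (curve_of y.1, curve_of y.2)) @^-1` O).
  apply: surface_of_continuous => /=; rewrite !ordinateK.
  exact: open_nbhs_nbhs.
move=> [A B] /= [/rational_near [q1 A1 e1] /rational_near [q2 B2 e2]] sub.
exists (surface_map (@ratr R) (q1, q2)); split; last by exists (q1, q2).
by have := sub (_, _) (conj A1 B2); rewrite /= e1 e2.
Qed.

End OrdinateParametrization.

Theorem corollary1p3 (R : realType) :
  [/\ dense (@rational_points R),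
      homeomorphic (surface_pts R) (R * R)%type
    & injective_away_from_finite (@surface_fun rat)].
Proof.
split; first exact: rational_points_dense.
  exact: surface_homeomorphic.
exact: surface_fun_injective_away R.
Qed.
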